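(* Suppose that $D\subseteq\mathbb{R}^n$ is a closed set which is $d$-Ahlfors regular for some $d\in(0,n)$, and fix a number $k\in\mathbb{N}$. Then $$W^{k,p}_D(\mathbb{R}^n)=\Big\{u\in W^{k,p}(\mathbb{R}^n):\ \mathcal{R}^{(k)}_Du=0\ \text{ at }\mathcal{H}^d\text{-a.e. point on }D\Big\}$$ whenever $\max\{1,n-d\}<p<\infty$.
   Context: Throughout $n\ge2$; $\mathcal{H}^d$ is $d$-dimensional Hausdorff measure and $|\cdot|$ of a set is Lebesgue measure. $D$ is $d$-Ahlfors regular if there is $C\ge1$ with $C^{-1}r^d\le\mathcal{H}^d(B(x,r)\cap D)\le Cr^d$ for all $x\in D$, $0<r\le\operatorname{diam}(D)$. $W^{k,p}(\mathbb{R}^n)$ is the usual Sobolev space and $W^{k,p}_D(\mathbb{R}^n)$ is the closure in $W^{k,p}(\mathbb{R}^n)$ of $\{\varphi\in C^\infty_c(\mathbb{R}^n):D\cap\operatorname{supp}\varphi=\emptyset\}$. For $u\in W^{k,p}(\mathbb{R}^n)$ with $\max\{1,n-d\}<p<\infty$ the higher-order restriction to $D$ is $$(\mathcal{R}^{(k)}_Du)(x):=\Big\{\lim_{r\to0^+}\frac1{|B(x,r)|}\int_{B(x,r)}\partial^\alpha u\,dy\Big\}_{|\alpha|\le k-1},$$ where the limits exist at $\mathcal{H}^d$-a.e. $x\in D$ (a theorem of Jonsson and Wallin).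
   Formalization: D is additionally assumed not to be a single point: a singleton is vacuously d-Ahlfors regular under the stated definition, and the claim then fails, e.g. for n=2, d=1, k=1, p=3. *)

(* Defs.v *)
From HB Require Import structures.
From mathcomp Require Import all_boot all_order all_algebra.
From mathcomp Require Import all_classical all_reals all_analysis.
From mathcomp Require Import lra.

Set Implicit Arguments.
Unset Strict Implicit.
Unset Printing Implicit Defensive.
Import Order.TTheory GRing.Theory Num.Theory.
Import numFieldNormedType.Exports.
Local Open Scope classical_set_scope.
Local Open Scope ring_scope.

(* Euclidean structure: the norm, distance and balls that the library attaches
   to 'rV[R]_n are those of the sup norm.  It induces the same topology, but
   balls and diameters below are Euclidean. *)
Section euclidean.
Context {R : realType} {n : nat}.
Implicit Types (x y : 'rV[R]_n) (A : set 'rV[R]_n).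

Definition enorm x : R := Num.sqrt (\sum_(i < n) x ord0 i ^+ 2).

Definition eball x (r : R) : set 'rV[R]_n := [set y | enorm (y - x) < r].

(* The element 0 only matters for A = set0, whose diameter is 0. *)
Definition ediam A : \bar R :=
  ereal_sup (0%E |` [set z | exists x y, [/\ A x, A y & z = (enorm (x - y))%:E]]).

End euclidean.

(* d-dimensional Hausdorff (outer) measure, without normalising constant. *)
Section hausdorff.
Context {R : realType} {n : nat}.
Implicit Types (A D : set 'rV[R]_n) (d delta : R).

Definition hausdorff_pre d delta A : \bar R :=
  ereal_inf [set (\sum_(0 <= i <oo) poweR (ediam (U i)) d)%E
    | U in [set U : nat -> set 'rV[R]_n |
        A `<=` \bigcup_i U i /\ forall i, (ediam (U i) <= delta%:E)%E]].

Definition hausdorff d A : \bar R :=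
  ereal_sup [set hausdorff_pre d delta A | delta in [set delta | 0 < delta]].

(* The condition is vacuous when D has diameter 0, that is when D is empty or a
   singleton. *)
Definition ahlfors_regular d D : Prop :=
  exists2 C : R, 1 <= C &
    forall x r, D x -> 0 < r -> (r%:E <= ediam D)%E ->
      ((C^-1 * r `^ d)%:E <= hausdorff d (eball x r `&` D) <= (C * r `^ d)%:E)%E.

End hausdorff.

(* Lebesgue measure on R^n is obtained from iterated products on n-tuples. *)
Section lebesgue_cons.
Context {R : realType} {n : nat}.
Local Notation RR := (measurableTypeR R).
Variable m : {sigma_finite_measure set (n.-tuple RR) -> \bar R}.

Definition tcons (z : RR * n.-tuple RR) : n.+1.-tuple RR :=
  [the n.+1.-tuple RR of z.1 :: z.2].

Lemma measurable_tcons : measurable_fun [set: RR * n.-tuple RR] tcons.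
Proof. exact: measurable_cons. Qed.

Definition lebesgue_cons : set (n.+1.-tuple RR) -> \bar R :=
  pushforward (@lebesgue_measure R \x m)%E tcons.

Let lebesgue_cons0 : lebesgue_cons set0 = 0%E.
Proof. by apply: measure0; exact: measurable_tcons. Qed.

Let lebesgue_cons_ge0 A : (0 <= lebesgue_cons A)%E.
Proof. by apply: measure_ge0; exact: measurable_tcons. Qed.

Let lebesgue_cons_sigma_additive : semi_sigma_additive lebesgue_cons.
Proof. by apply: measure_semi_sigma_additive; exact: measurable_tcons. Qed.

HB.instance Definition _ := isMeasure.Build _ _ _ lebesgue_cons
  lebesgue_cons0 lebesgue_cons_ge0 lebesgue_cons_sigma_additive.

Let lebesgue_cons_sigma_finite : sigma_finite [set: n.+1.-tuple RR] lebesgue_cons.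
Proof.
have /sigma_finiteP[F [TF ndF Foo]] := sigma_finiteT (@lebesgue_measure R).
have /sigma_finiteP[G [TG ndG Goo]] := sigma_finiteT m.
pose g (t : n.+1.-tuple RR) : RR * n.-tuple RR :=
  (tnth t ord0, [tuple of behead t]).
have mg : measurable_fun [set: n.+1.-tuple RR] g.
  apply/measurable_fun_pairP; split.
    exact: (@measurable_tnth _ RR n.+1 ord0).
  exact: (@measurable_behead _ RR n).
have gK : g \o tcons = id.
  by apply/funext => -[a t]; congr pair => //; apply: val_inj.
exists (fun i => g @^-1` (F i `*` G i)).
  rewrite -preimage_bigcup; apply/esym; rewrite -subTset => t _.
  have [i _ Fi] : (\bigcup_i F i) (g t).1 by rewrite -TF.
  have [j _ Gj] : (\bigcup_i G i) (g t).2 by rewrite -TG.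
  exists (maxn i j) => //; split.
    by move: Fi; exact/subsetPset/ndF/leq_maxl.
  by move: Gj; exact/subsetPset/ndG/leq_maxr.
move=> i; have [mF Fi] := Foo i; have [mG Gi] := Goo i; split.
  by rewrite -[X in measurable X]setTI; apply: mg => //; exact: measurableX.
rewrite /lebesgue_cons /pushforward -comp_preimage gK preimage_id.
by rewrite product_measure1E// lte_mul_pinfty// ge0_fin_numE.
Qed.

HB.instance Definition _ := Measure_isSigmaFinite.Build _ _ _ lebesgue_cons
  lebesgue_cons_sigma_finite.

End lebesgue_cons.

Fixpoint lebesgue_tuple (R : realType) (n : nat) :
    {sigma_finite_measure set (n.-tuple (measurableTypeR R)) -> \bar R} :=
  match n with
  | 0 => @dirac _ _ [tuple] R
  | n'.+1 => lebesgue_cons (lebesgue_tuple R n')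
  end.

(* The library puts no sigma-algebra on matrices: row vectors get the Borel
   one. *)
HB.instance Definition _ (R : realType) (n : nat) :=
  Measurable.copy 'rV[R]_n (g_sigma_algebraType (@open 'rV[R]_n)).

Section lebesgue_rV.
Context {R : realType} {n : nat}.
Local Notation RR := (measurableTypeR R).

Definition rV_of_tuple (t : n.-tuple RR) : 'rV[R]_n := \row_(i < n) tnth t i.

Lemma measurable_rV_of_tuple : measurable_fun [set: n.-tuple RR] rV_of_tuple.
Proof.
apply: (@measurability _ _ _ _ _ _ (@open 'rV[R]_n)) => //.
move=> _ [U oU <-]; rewrite setTI.
pose B (c : 'rV[rat]_n * rat) : set 'rV[R]_n :=
  [set y | forall i, ball (ratr (c.1 ord0 i) : R) (ratr c.2) (y ord0 i)].
pose F c := if `[< B c `<=` U >] then B c else set0.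
have -> : U = \bigcup_c F c.
  apply/seteqP; split=> [x Ux|x [c _]]; last first.
    by rewrite /F; case: asboolP => // BU /BU.
  have /nbhs_ballP[e /= e0 xeU] : nbhs x U by exact: open_nbhs_nbhs.
  have [q] : exists q : rat, ratr q \in `]0, (e / 2)[%R.
    by apply: rat_in_itvoo; rewrite divr_gt0.
  rewrite in_itv/= => /andP[q0 qe].
  have /choice[r Hr] : forall i : 'I_n, exists r : rat,
      ratr r \in `](x ord0 i - ratr q), (x ord0 i + ratr q)[%R.
    by move=> i; apply: rat_in_itvoo; rewrite ltrBlDr -addrA ltrDl addr_gt0.
  have xr i : ball (ratr (r i) : R) (ratr q) (x ord0 i).
    have := Hr i; rewrite in_itv/= => /andP[h1 h2].
    rewrite /ball/= ltr_norml; apply/andP; split; lra.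
  exists ((\row_i r i), q) => //; rewrite /F asboolT.
    by move=> i /=; rewrite mxE.
  move=> y /= By; apply: xeU; split => // a i; rewrite (ord1 a) -[0]/ord0.
  have := By i; rewrite mxE => yr.
  have := xr i; move: yr; rewrite /ball/= !ltr_norml => /andP[? ?] /andP[? ?].
  apply/andP; split; move: e0 q0 qe => *; lra.
rewrite preimage_bigcup; apply: countable_bigcupT_measurable => [|c].
  exact: countableP.
rewrite /F; case: asboolP => _; last by rewrite preimage_set0.
have -> : rV_of_tuple @^-1` B c = \bigcap_(i in [set: 'I_n])
    ((@tnth n RR)^~ i @^-1` ball (ratr (c.1 ord0 i) : R) (ratr c.2)).
  apply/seteqP; split=> t /= Bt i; first by move=> _; have := Bt i; rewrite mxE.
  by rewrite mxE; exact: Bt.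
apply: fin_bigcap_measurable => // i _.
rewrite -[X in measurable X]setTI; apply: measurable_tnth => //.
rewrite ball_itv; exact: measurable_itv.
Qed.

Definition lebesgue_rV : set 'rV[R]_n -> \bar R :=
  pushforward (lebesgue_tuple R n) rV_of_tuple.

Let lebesgue_rV0 : lebesgue_rV set0 = 0%E.
Proof. by apply: measure0; exact: measurable_rV_of_tuple. Qed.

Let lebesgue_rV_ge0 A : (0 <= lebesgue_rV A)%E.
Proof. by apply: measure_ge0; exact: measurable_rV_of_tuple. Qed.

Let lebesgue_rV_sigma_additive : semi_sigma_additive lebesgue_rV.
Proof. by apply: measure_semi_sigma_additive; exact: measurable_rV_of_tuple. Qed.

HB.instance Definition _ := isMeasure.Build _ _ _ lebesgue_rV
  lebesgue_rV0 lebesgue_rV_ge0 lebesgue_rV_sigma_additive.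

End lebesgue_rV.
Arguments lebesgue_rV {R n}.

Section sobolev.
Context {R : realType} {n : nat}.
Local Notation mu := (@lebesgue_rV R n).
Implicit Types (f g u phi : 'rV[R]_n -> R) (alpha : 'I_n -> nat).

Definition mi_order alpha : nat := (\sum_(i < n) alpha i)%N.

Definition partial (i : 'I_n) f : 'rV[R]_n -> R :=
  fun x => 'D_(delta_mx ord0 i) f x.

Definition partial_mi alpha f : 'rV[R]_n -> R :=
  foldr (fun i => iter (alpha i) (partial i)) f (enum 'I_n).

(* All iterated partial derivatives, in any order, exist and are continuous. *)
Definition smooth f : Prop :=
  forall s : seq 'I_n,
    continuous (foldr partial f s) /\
    forall x i, derivable (foldr partial f s) x (delta_mx ord0 i).

Definition supp f : set 'rV[R]_n := closure [set x | f x != 0].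

Definition test_function f : Prop := smooth f /\ compact (supp f).

Definition loc_integrable f : Prop :=
  forall K, compact K -> mu.-integrable K (EFin \o f).

Definition is_weak_partial alpha u g : Prop :=
  [/\ loc_integrable u, loc_integrable g &
    forall phi, test_function phi ->
      \int[mu]_x (u x * partial_mi alpha phi x) =
      (-1) ^+ mi_order alpha * \int[mu]_x (g x * phi x)].

(* A representative of the weak derivative, which is unique up to null sets;
   arbitrary if there is none. *)
Definition weak_partial alpha u : 'rV[R]_n -> R :=
  xget (cst 0) [set g | is_weak_partial alpha u g].

(* Elements of W^{k,p} are handled as (Borel measurable) functions, without
   taking the quotient by a.e. equality. *)
Definition sobolev (k : nat) (p : R) : set ('rV[R]_n -> R) :=
  [set u | u \in Lfun mu p%:E /\
    forall alpha, (mi_order alpha <= k)%N ->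
      exists2 g, g \in Lfun mu p%:E & is_weak_partial alpha u g].

(* Multi-indices of order at most k have all entries at most k. *)
Definition sobolev_norm (k : nat) (p : R) u : \bar R :=
  poweR (\sum_(a : {ffun 'I_n -> 'I_k.+1} | (mi_order (fun i => a i) <= k)%N)
    poweR ('N[mu]_(p%:E)[EFin \o weak_partial (fun i => a i) u]) p)%E p^-1.

Definition sobolev_vanishing (D : set 'rV[R]_n) (k : nat) (p : R) :
    set ('rV[R]_n -> R) :=
  [set u | sobolev k p u /\
    forall e : R, 0 < e -> exists phi,
      [/\ test_function phi, D `&` supp phi = set0 &
          (sobolev_norm k p (u \- phi)%R < e%:E)%E]].

Definition ball_average f (x : 'rV[R]_n) (r : R) : R :=
  (fine (mu (eball x r)))^-1 * \int[mu]_(y in eball x r) f y.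

(* [is_restriction k u x l]: the limits defining the order-k restriction of u
   at x exist and are given by l.  The condition |alpha| <= k - 1 is written
   |alpha| < k to avoid truncated subtraction. *)
Definition is_restriction (k : nat) u (x : 'rV[R]_n)
    (l : ('I_n -> nat) -> R) : Prop :=
  forall alpha, (mi_order alpha < k)%N ->
    ball_average (weak_partial alpha u) x r @[r --> 0^'+] --> l alpha.

End sobolev.

(* Main.v *)
(* If the gradient of w is in L^p, averages of w over comparable balls at scale r
   differ by at most a constant times (r^(p - n) \int |grad w|^p)^(1/p).  At a point y with
   \int_(B(y,r)) |grad w|^p < t r^(d - kappa) for all r <= r0, where 0 < kappa < p - (n - d),
   these differences are summable over dyadic scales; by a Vitali covering, the other
   points of D form a set of H^d-measure at most C (r0^kappa / t) \int |grad w|^p.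

   Let u be a limit of test functions phi supported off D.  Near D the derivatives of u and
   of u - phi have the same averages at small scales, while u - phi has arbitrarily small
   energy: the points where the averages do not tend to 0 form a null set.

   Conversely, if the trace of u vanishes, lower regularity gives every small ball centred
   on D a point which is not exceptional and has zero trace, so that the energy around the
   ball controls the average over it.  This yields a Hardy inequality on neighbourhoods
   D_r of D, \int_(D_r) |w|^p <= C r^p \int_(D_20r) |grad w|^p, for all derivatives w of u of
   order < k.  Iterating it, and since |D| = 0, a derivative of order j is o(r^(k - j)) in
   L^p(D_r).  By the Leibniz formula, multiplying u by a cutoff which is 1 near D and whose
   derivatives of order i are O(r^-i) gives a function that tends to 0 with r in W^{k,p};
   it remains to replace u by a test function close to it. *)
Require Import Defs.
From HB Require Import structures.
From mathcomp Require Import all_boot all_order all_algebra.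
From mathcomp Require Import all_classical all_reals all_analysis.
From mathcomp Require Import measurable_realfun.
From mathcomp Require Import ring lra.
Set Implicit Arguments.
Unset Strict Implicit.
Unset Printing Implicit Defensive.
Import Order.TTheory GRing.Theory Num.Theory.
Import numFieldNormedType.Exports.
Local Open Scope classical_set_scope.
Local Open Scope ring_scope.

(** * Euclidean balls and Lebesgue measure *)

(** Traces are pointwise, whereas a weak derivative is known only up to a null set and
    [weak_partial] is an arbitrary representative. The two meet in averages over balls, and every
    estimate on averages comes from one inequality, [translation_bound]: the $L^p$ increment of $w$
    by a vector of length at most $r$ costs $r^p$ times the energy nearby. For smooth functions it
    is the fundamental theorem of calculus along the coordinate axes, and it survives $L^p$ limits.

    One covering argument serves both inclusions: in the first the threshold [t] is fixed and the
    energy tends to 0, in the second [t] is proportional to the energy in a ball.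

    In the converse, the terms of full order lose through the cutoff exactly the power of $r$ that
    the Hardy inequality gains; they are small only because the energy on $D_r$ tends to 0. The
    Leibniz formula is applied to a smooth approximation, whose error is multiplied by the
    derivative bounds of the cutoff; hence the width of the cutoff is fixed before the approximation
    is chosen. *)

Section euclidean_norm.
Context {R : realType} {n : nat}.
Implicit Types x y z : 'rV[R]_n.

Lemma enorm_ge0 x : 0 <= enorm x.
Proof. exact: sqrtr_ge0. Qed.

Lemma sqr_enorm x : enorm x ^+ 2 = \sum_(i < n) x ord0 i ^+ 2.
Proof. by rewrite sqr_sqrtr// sumr_ge0// => i _; exact: sqr_ge0. Qed.

Lemma enorm0 : enorm (0 : 'rV[R]_n) = 0.
Proof. by rewrite /enorm big1 ?sqrtr0// => i _; rewrite mxE expr0n. Qed.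

Lemma enormN x : enorm (- x) = enorm x.
Proof. by rewrite /enorm; congr Num.sqrt; apply: eq_bigr => i _; rewrite mxE sqrrN. Qed.

Lemma enormB x y : enorm (x - y) = enorm (y - x).
Proof. by rewrite -enormN opprB. Qed.

Lemma enormZ a x : enorm (a *: x) = `|a| * enorm x.
Proof.
rewrite /enorm -sqrtr_sqr -sqrtrM ?sqr_ge0//; congr Num.sqrt.
by rewrite mulr_sumr; apply: eq_bigr => i _; rewrite mxE exprMn.
Qed.

Lemma normr_coord_le x i : `|x ord0 i| <= enorm x.
Proof.
rewrite -sqrtr_sqr ler_wsqrtr// (bigD1 i)//= lerDl sumr_ge0// => j _.
exact: sqr_ge0.
Qed.

(** Cauchy-Schwarz: expand $\sum_i (|y| x_i - |x| y_i)^2 \ge 0$ and divide by $|x| |y|$; the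
    division is why vanishing norms are treated apart. *)
Lemma enorm_dot x y : \sum_(i < n) x ord0 i * y ord0 i <= enorm x * enorm y.
Proof.
have [x0|x0] := eqVneq (enorm x) 0.
  rewrite x0 mul0r big1// => i _.
  have := normr_coord_le x i; rewrite x0 normr_le0 => /eqP ->; exact: mul0r.
have [y0|y0] := eqVneq (enorm y) 0.
  rewrite y0 mulr0 big1// => i _.
  have := normr_coord_le y i; rewrite y0 normr_le0 => /eqP ->; exact: mulr0.
have xp : 0 < enorm x by rewrite lt0r x0 enorm_ge0.
have yp : 0 < enorm y by rewrite lt0r y0 enorm_ge0.
have : 0 <= \sum_(i < n) (enorm y * x ord0 i - enorm x * y ord0 i) ^+ 2.
  by rewrite sumr_ge0// => i _; exact: sqr_ge0.
under eq_bigr do rewrite sqrrB !exprMn.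
rewrite big_split/= sumrB -!mulr_sumr -!sqr_enorm.
have -> : \sum_(i < n) enorm y * x ord0 i * (enorm x * y ord0 i) *+ 2 =
    (2 * enorm x * enorm y) * \sum_(i < n) x ord0 i * y ord0 i.
  by rewrite mulr_sumr; apply: eq_bigr => i _; ring.
set s := (\sum_(i < n) _) => h.
have : 0 <= (2 * enorm x * enorm y) * (enorm x * enorm y - s) by lra.
by rewrite pmulr_rge0 ?subr_ge0// !mulr_gt0.
Qed.

Lemma enormD x y : enorm (x + y) <= enorm x + enorm y.
Proof.
rewrite -(@ler_pXn2r _ 2)// ?nnegrE ?addr_ge0 ?enorm_ge0//.
rewrite sqr_enorm sqrrD !sqr_enorm.
under eq_bigr do rewrite mxE sqrrD -mulr_natr.
rewrite !big_split/= lerD2r lerD2l -mulr_suml -[leRHS]mulr_natr ler_pM2r ?ltr0n//.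
exact: enorm_dot.
Qed.

Lemma enorm_le_sum x : enorm x <= \sum_(i < n) `|x ord0 i|.
Proof.
have s0 : 0 <= \sum_(i < n) `|x ord0 i| by exact: sumr_ge0.
rewrite -(@ler_pXn2r _ 2)// ?nnegrE ?enorm_ge0// sqr_enorm expr2 mulr_suml.
apply: ler_sum => i _; rewrite -real_normK ?num_real// expr2 ler_wpM2l//.
by rewrite (bigD1 i)//= lerDl sumr_ge0.
Qed.

Lemma enorm_triangle x y z : enorm (x - z) <= enorm (x - y) + enorm (y - z).
Proof. by apply: le_trans (enormD _ _); rewrite addrA subrK. Qed.

Lemma normr_coord_mx x i : `|x ord0 i| <= `|x|.
Proof.
rewrite /Num.norm/= mx_normrE.
exact: (@le_bigmax _ _ _ 0 (fun ij => `|x ij.1 ij.2|) (ord0, i)).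
Qed.

Lemma enorm_le_mx x : enorm x <= n%:R * `|x|.
Proof.
apply: (le_trans (enorm_le_sum _)).
have -> : n%:R * `|x| = \sum_(i < n) `|x|.
  by rewrite sumr_const card_ord mulr_natl.
by apply: ler_sum => i _; exact: normr_coord_mx.
Qed.

Lemma mx_le_enorm x : `|x| <= enorm x.
Proof.
rewrite /Num.norm/= mx_normrE; apply: bigmax_le => [|[i j] _]/=.
  exact: enorm_ge0.
by rewrite (ord1 i); exact: normr_coord_le.
Qed.

Lemma eball_center x r : 0 < r -> eball x r x.
Proof. by move=> r0; rewrite /eball/= subrr enorm0. Qed.

Lemma eballC x y r : eball x r y -> eball y r x.
Proof. by rewrite /eball/= enormB. Qed.

Lemma sub_eball x y r s : enorm (x - y) + r <= s -> eball x r `<=` eball y s.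
Proof.
move=> h z /= zx; apply: (le_lt_trans (enorm_triangle z x y)).
by apply: (lt_le_trans _ h); rewrite addrC ltrD2l.
Qed.

Lemma le_eball x r s : r <= s -> eball x r `<=` eball x s.
Proof. by move=> rs; apply: sub_eball; rewrite subrr enorm0 add0r. Qed.

Lemma nbhs_enormP x (A : set 'rV[R]_n) :
  nbhs x A <-> exists2 e, 0 < e & eball x e `<=` A.
Proof.
split=> [/nbhs_ballP[e /= e0 xeA]|[e e0 xeA]].
  exists e => // y yx; apply: xeA.
  rewrite mx_norm_ball /ball_/= distrC; exact: (le_lt_trans (mx_le_enorm _)).
(* Dividing by [n.+1] instead of [n] keeps the radius positive in dimension 0. *)
apply/nbhs_ballP; exists (e / n.+1%:R) => /=; first by rewrite divr_gt0.
move=> y; rewrite mx_norm_ball /ball_/= distrC => yx; apply: xeA.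
apply: (le_lt_trans (enorm_le_mx _)).
apply: (@le_lt_trans _ _ (n.+1%:R * `|y - x|)); first by rewrite ler_wpM2r// ler_nat.
by rewrite mulrC -ltr_pdivlMr.
Qed.

Lemma open_eball x r : open (eball x r).
Proof.
rewrite openE => y xry; apply/nbhs_enormP; exists (r - enorm (y - x)).
  by rewrite subr_gt0.
by apply: sub_eball; rewrite addrC subrK.
Qed.

Lemma open_enormP (A : set 'rV[R]_n) :
  open A <-> forall x, A x -> exists2 e, 0 < e & eball x e `<=` A.
Proof.
rewrite openE; split=> h x Ax; first by apply/nbhs_enormP; exact: h.
by apply/nbhs_enormP; exact: h.
Qed.

(** Open, hence measurable, whatever the set [A] is. *)
Definition ethick (A : set 'rV[R]_n) r : set 'rV[R]_n :=
  \bigcup_(x in A) eball x r.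

Lemma open_ethick A r : open (ethick A r).
Proof. by apply: bigcup_open => x _; exact: open_eball. Qed.

Lemma ethick_ethick A r s : ethick (ethick A r) s `<=` ethick A (r + s).
Proof.
move=> z [y [x Ax xy] yz]; exists x => //=.
apply: (le_lt_trans (enorm_triangle _ y _)).
by rewrite addrC; apply: ltrD.
Qed.

Lemma ethickS A B r s : A `<=` B -> r <= s -> ethick A r `<=` ethick B s.
Proof. by move=> AB rs z [y /AB By yz]; exists y => //; exact: (le_eball rs). Qed.

End euclidean_norm.

Section measurable_rV.
Context {R : realType} {n : nat}.
Local Notation V := 'rV[R]_n.
Local Notation RR := (measurableTypeR R).

Lemma open_measurable_rV (A : set V) : open A -> measurable A.
Proof. by move=> oA; exact: sub_sigma_algebra. Qed.

Lemma closed_measurable_rV (A : set V) : closed A -> measurable A.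
Proof.
by move=> /closed_openC/open_measurable_rV/measurableC; rewrite setCK.
Qed.

Lemma measurable_eball (x : V) r : measurable (eball x r).
Proof. by apply: open_measurable_rV; exact: open_eball. Qed.

Lemma measurable_ethick (A : set V) r : measurable (ethick A r).
Proof. by apply: open_measurable_rV; exact: open_ethick. Qed.

Lemma continuous_measurable_rV (f : V -> R) :
  continuous f -> measurable_fun [set: V] (f : V -> RR).
Proof.
move=> /continuousP cf; apply: (measurability _ (RGenOpens.measurableE R)) => //.
move=> _ [_ [a [b ->]] <-]; rewrite setTI; apply: open_measurable_rV.
by apply: cf; exact: interval_open.
Qed.

Lemma measurable_coord_rV i : measurable_fun [set: V] (fun x : V => x ord0 i : RR).
Proof. by apply: continuous_measurable_rV; exact: coord_continuous. Qed.

(** A map into row vectors factors through the tuple of its coordinates, and [rV_of_tuple] is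
    measurable. *)
Lemma measurable_rVP d (T : measurableType d) (f : T -> V) :
  measurable_fun [set: T] f <->
  forall i, measurable_fun [set: T] (fun t => f t ord0 i : RR).
Proof.
split=> [mf i|mf].
  exact: (measurableT_comp (measurable_coord_rV i)).
have -> : f = @rV_of_tuple R n \o (fun t => [tuple f t ord0 i | i < n]).
  by apply/funext => t; apply/rowP => i; rewrite mxE tnth_mktuple.
apply: measurableT_comp; first exact: measurable_rV_of_tuple.
apply/measurable_fun_tnthP => i.
rewrite (_ : _ \o _ = fun t => f t ord0 i)//.
by apply/funext => t /=; rewrite tnth_mktuple.
Qed.

Lemma measurable_funD_rV d (T : measurableType d) (f g : T -> V) :
  measurable_fun [set: T] f -> measurable_fun [set: T] g ->
  measurable_fun [set: T] (fun t => f t + g t).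
Proof.
move=> /measurable_rVP mf /measurable_rVP mg; apply/measurable_rVP => i.
under eq_fun do rewrite mxE.
exact: (measurable_funD (mf i) (mg i)).
Qed.

Lemma measurable_shift_rV (h : V) : measurable_fun [set: V] (fun x : V => x + h).
Proof. by apply: measurable_funD_rV => //; exact: measurable_cst. Qed.

End measurable_rV.

(** * Translation invariance of Lebesgue measure *)

Section translation_invariance.
Context {R : realType}.
Local Notation RR := (measurableTypeR R).

(** The pushforward by the shift agrees with Lebesgue measure on half-open intervals, which
    determine it. *)
Lemma lebesgue_measure_shift (a : R) (A : set R) : measurable (A : set RR) ->
  @lebesgue_measure R ((fun x : RR => x + a : RR) @^-1` A) = lebesgue_measure A.
Proof.
move=> mA.
have ms : measurable_fun [set: RR] (fun x : RR => x + a : RR).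
  by apply: measurable_funD => //; exact: measurable_cst.
pose ph : {mfun RR >-> RR} := HB.pack (fun x : RR => x + a : RR)
  (isMeasurableFun.Build _ _ _ _ _ ms).
apply/esym/(@lebesgue_measure_unique R (pushforward lebesgue_measure ph)) => //.
move=> _ [[b c]] _ <-/=.
rewrite /pushforward/=.
have -> : (fun x : R => x + a) @^-1` `]b, c]%classic = `](b - a), (c - a)]%classic.
  by apply/seteqP; split=> x /=; rewrite !in_itv/= ltrBlDr lerBrDr.
rewrite !lebesgue_measure_itv/= !lte_fin ltrD2r.
by case: ifPn => // _; rewrite -!EFinD; congr EFin; ring.
Qed.

Definition tuple_shift n (h : n.-tuple R) (t : n.-tuple RR) : n.-tuple RR :=
  [tuple tnth t i + tnth h i | i < n].

Lemma measurable_tuple_shift n (h : n.-tuple R) :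
  measurable_fun [set: n.-tuple RR] (tuple_shift h).
Proof.
apply/measurable_fun_tnthP => i.
rewrite (_ : _ \o _ = fun t : n.-tuple RR => tnth t i + tnth h i); last first.
  by apply/funext => t /=; rewrite tnth_mktuple.
by apply: measurable_funD; [exact: measurable_tnth|exact: measurable_cst].
Qed.

(** Induction on the dimension: the shift acts separately on head and tail, and the product measure
    is determined by its values on rectangles. *)
Lemma lebesgue_tuple_shift n (h : n.-tuple R) (A : set (n.-tuple RR)) :
  measurable A -> lebesgue_tuple R n (tuple_shift h @^-1` A) = lebesgue_tuple R n A.
Proof.
elim: n h A => [|n IH] h A mA.
  congr (lebesgue_tuple R 0 _); apply/funext => t /=; congr A.
  by rewrite (tuple0 t) (tuple0 (tuple_shift _ _)).
rewrite /= /lebesgue_cons /pushforward.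
pose s (z : RR * n.-tuple RR) : RR * n.-tuple RR :=
  (z.1 + tnth h ord0, tuple_shift [tuple of behead h] z.2).
have ms : measurable_fun [set: RR * n.-tuple RR] s.
  apply/measurable_fun_pairP; split.
    by apply: measurable_funD; [exact: measurable_fst|exact: measurable_cst].
  exact: (measurableT_comp (measurable_tuple_shift _) measurable_snd).
have -> : (@tcons R n) @^-1` (tuple_shift h @^-1` A) = s @^-1` (@tcons R n @^-1` A).
  apply/funext => -[a t]; rewrite /preimage/=; congr A.
  apply: eq_from_tnth => i; rewrite tnth_mktuple.
  case: (unliftP ord0 i) => [j ->|->].
    rewrite /tcons /= !tnthS tnth_mktuple tnth_behead; congr (_ + tnth h _).
    by apply: val_inj; rewrite /= inordK// ltnS.
  by rewrite /tcons !tnth0.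
set B := tcons @^-1` A.
have mB : measurable B.
  by rewrite /B -[X in measurable X]setTI; apply: measurable_tcons.
pose ph : {mfun (RR * n.-tuple RR)%type >-> (RR * n.-tuple RR)%type} :=
  HB.pack s (isMeasurableFun.Build _ _ _ _ _ ms).
apply/esym.
apply: (@product_measure_unique _ _ _ _ R lebesgue_measure (lebesgue_tuple R n)
  (pushforward (lebesgue_measure \x lebesgue_tuple R n)%E ph)) => //.
move=> C E mC mE.
transitivity ((lebesgue_measure \x lebesgue_tuple R n)%E
  (((fun x : RR => x + tnth h ord0 : RR) @^-1` C) `*`
   (tuple_shift [tuple of behead h] @^-1` E))) => //.
rewrite product_measure1E.
- by congr (_ * _)%E; [exact: lebesgue_measure_shift|exact: IH].
- rewrite -[X in measurable X]setTI; apply: measurable_funD => //.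
- rewrite -[X in measurable X]setTI; apply: measurable_tuple_shift => //.
Qed.

Context {n : nat}.
Local Notation V := 'rV[R]_n.
Local Notation mu := (@lebesgue_rV R n).

Lemma lebesgue_rV_shift (h : V) (A : set V) : measurable A ->
  mu ((fun x => x + h) @^-1` A) = mu A.
Proof.
move=> mA; rewrite /lebesgue_rV /pushforward.
rewrite -[RHS](lebesgue_tuple_shift [tuple h ord0 i | i < n]).
  congr (lebesgue_tuple R n _); apply/funext => t; rewrite /preimage/=; congr A.
  by apply/rowP => i; rewrite !mxE !tnth_mktuple.
by rewrite -[X in measurable X]setTI; apply: measurable_rV_of_tuple.
Qed.

Lemma ge0_integral_shift (h : V) (f : V -> \bar R) (A : set V) : measurable A ->
  measurable_fun A f -> (forall x, A x -> 0 <= f x)%E ->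
  (\int[mu]_(x in A) f x = \int[mu]_(x in (fun x => (x + h)%R) @^-1` A) f (x + h)%R)%E.
Proof.
move=> mA mf f0.
rewrite -[RHS](@ge0_integral_pushforward _ _ _ _ _ _ (measurable_shift_rV h) mu _ f)//; last first.
  by move=> x /[!inE]; exact: f0.
apply: eq_measure_integral => [|ms B mB _]; first exact: measurable_shift_rV.
by rewrite -[LHS](lebesgue_rV_shift h mB).
Qed.

End translation_invariance.

Section lebesgue_rV_sigma_finite.
Context {R : realType} {n : nat}.
Local Notation V := 'rV[R]_n.
Local Notation RR := (measurableTypeR R).

Lemma lebesgue_tuple_box m (A : 'I_m -> set R) :
  (forall i, measurable (A i : set RR)) ->
  lebesgue_tuple R m [set t | forall i, A i (tnth t i)] =
  (\prod_(i < m) lebesgue_measure (A i))%E.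
Proof.
elim: m A => [|m IH] A mA.
  by rewrite big_ord0 /= diracE mem_set// => -[].
rewrite big_ord_recl /= /lebesgue_cons /pushforward.
have -> : (@tcons R m) @^-1` [set t | forall i, A i (tnth t i)] =
   A ord0 `*` [set t | forall i, A (lift ord0 i) (tnth t i)].
  apply/seteqP; split=> -[a t]/=; rewrite /tcons/=.
    move=> h; split; first by have := h ord0; rewrite tnth0.
    by move=> i; have := h (lift ord0 i); rewrite tnthS.
  move=> [h0 h] i; case: (unliftP ord0 i) => [j ->|->].
    by rewrite tnthS.
  by rewrite tnth0.
have -> : [set t : m.-tuple RR | forall i, A (lift ord0 i) (tnth t i)] =
    \bigcap_(i in [set: 'I_m]) ((@tnth m RR)^~ i @^-1` A (lift ord0 i)).
  by apply/seteqP; split=> t /= h i; [move=> _; exact: h|exact: h].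
rewrite product_measure1E//; last first.
  apply: fin_bigcap_measurable => // i _.
  by rewrite -[X in measurable X]setTI; apply: measurable_tnth.
rewrite -IH//; congr (_ * lebesgue_tuple R m _)%E.
by apply/seteqP; split=> t /= h i; [exact: h|move=> _; exact: h].
Qed.

(** The product structure gives the volume of these boxes; inclusions between them and balls then
    bound the volume of balls without computing it. *)
Definition cube (x : V) (r : R) : set V :=
  [set y | forall i, x ord0 i - r < y ord0 i <= x ord0 i + r].

Lemma measurable_cube x r : measurable (cube x r).
Proof.
have -> : cube x r = \bigcap_(i in [set: 'I_n])
    ((fun y : V => y ord0 i : RR) @^-1` `]x ord0 i - r, x ord0 i + r]%classic).
  apply/seteqP; split=> y /= h i; first by move=> _; rewrite /= in_itv/=; exact: h.
  by have := h i I; rewrite /= in_itv.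
apply: fin_bigcap_measurable => // i _.
by rewrite -[X in measurable X]setTI; apply: measurable_coord_rV.
Qed.

Lemma lebesgue_cube x r : 0 <= r -> lebesgue_rV (cube x r) = ((2 * r) ^+ n)%:E.
Proof.
move=> r0; rewrite /lebesgue_rV/pushforward.
have -> : (@rV_of_tuple R n) @^-1` (cube x r) =
  [set t | forall i, `]x ord0 i - r, x ord0 i + r]%classic (tnth t i)].
  by apply/seteqP; split=> t /= h i; have := h i; rewrite /= in_itv/= mxE.
rewrite (@lebesgue_tuple_box n (fun i => `]x ord0 i - r, x ord0 i + r]%classic)); last first.
  by move=> i; exact: measurable_itv.
rewrite (eq_bigr (fun=> (2 * r)%:E)); last first.
  move=> i _; rewrite lebesgue_measure_itv/= lte_fin.
  rewrite -EFinD; case: ltP => h; congr EFin; lra.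
by rewrite prodEFin prodr_const card_ord.
Qed.

Lemma cube_eball x r : 0 < r -> cube x r `<=` eball x (n.+1%:R * r).
Proof.
move=> r0 y xy /=; apply: (le_lt_trans (enorm_le_sum _)).
apply: (@le_lt_trans _ _ (n%:R * r)); last by rewrite ltr_pM2r// ltr_nat.
rewrite mulr_natl -[X in _ *+ X]card_ord -sumr_const ler_sum// => i _.
by rewrite !mxE ler_norml; have /andP[h1 h2] := xy i; apply/andP; split; lra.
Qed.

Lemma eball_cube x r : eball x r `<=` cube x r.
Proof.
move=> y xy i; have := normr_coord_le (y - x) i.
rewrite !mxE => /le_lt_trans/(_ xy); rewrite ltr_norml => /andP[h1 h2].
by apply/andP; split; lra.
Qed.

Lemma lebesgue_rV_sigma_finite : sigma_finite [set: V] (@lebesgue_rV R n).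
Proof.
exists (fun k => cube 0 k%:R) => [|k].
  apply/esym; rewrite -subTset => x _.
  have x0 : 0 <= enorm x := enorm_ge0 x.
  exists (Num.bound (enorm x)) => //; apply: eball_cube; rewrite /eball/= subr0.
  exact: archi_boundP.
by split; [exact: measurable_cube|rewrite lebesgue_cube// ltry].
Qed.

HB.instance Definition _ := Measure_isSigmaFinite.Build _ _ _ (@lebesgue_rV R n)
  lebesgue_rV_sigma_finite.

End lebesgue_rV_sigma_finite.

Section ball_measure.
Context {R : realType} {n : nat}.
Local Notation V := 'rV[R]_n.
Local Notation mu := (@lebesgue_rV R n).

(** Volume of a cube inside the unit ball: with half-side $1/(n+1)$ the Euclidean norm is at most
    $n/(n+1) < 1$. *)
Definition ball_lower : R := (2 / n.+1%:R) ^+ n.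

Lemma ball_lower_gt0 : 0 < ball_lower.
Proof. by rewrite exprn_gt0// divr_gt0. Qed.

Lemma lebesgue_eball_ge (x : V) r : 0 < r ->
  ((ball_lower * r ^+ n)%:E <= mu (eball x r))%E.
Proof.
move=> r0; rewrite /ball_lower -exprMn -mulrA -(lebesgue_cube x); last first.
  by rewrite mulr_ge0 ?invr_ge0// ltW.
apply: le_measure; rewrite ?inE; [exact: measurable_cube|exact: measurable_eball|].
apply: subset_trans (cube_eball _) _.
  by rewrite mulr_gt0// invr_gt0.
by rewrite mulrA divff// mul1r.
Qed.

Lemma lebesgue_eball_le (x : V) r : 0 <= r -> (mu (eball x r) <= ((2 * r) ^+ n)%:E)%E.
Proof.
move=> r0; rewrite -(lebesgue_cube x)//.
apply: le_measure; rewrite ?inE; [exact: measurable_eball|exact: measurable_cube|].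
exact: eball_cube.
Qed.

Lemma lebesgue_eball_fin (x : V) r : mu (eball x r) \is a fin_num.
Proof.
rewrite ge0_fin_numE//.
have [r0|r0] := leP 0 r; first by apply: le_lt_trans (lebesgue_eball_le _ r0) (ltry _).
rewrite (_ : eball x r = set0) ?measure0 ?ltry//.
apply/seteqP; split=> // y /= h.
by have := le_lt_trans (enorm_ge0 _) h; rewrite ltNge (ltW r0).
Qed.

Lemma lebesgue_eball_gt0 (x : V) r : 0 < r -> (0 < mu (eball x r))%E.
Proof.
move=> r0; apply: lt_le_trans (lebesgue_eball_ge x r0).
by rewrite lte_fin mulr_gt0 ?ball_lower_gt0// exprn_gt0.
Qed.

Lemma lebesgue_eball_shift (x : V) r : mu (eball x r) = mu (eball 0 r).
Proof.
rewrite -(lebesgue_rV_shift x (measurable_eball x r)); congr (mu _).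
by apply/seteqP; split=> y /=; rewrite /eball/= addrK subr0.
Qed.

End ball_measure.

(** * Smooth functions *)

Section directional.
Context {R : realType} {n : nat}.
Local Notation V := 'rV[R]_n.
Implicit Types (f g : V -> R) (x v : V).

(** Directional derivatives are reduced to derivatives in one real variable, where the chain rule
    and the mean value theorem apply. *)
Lemma is_derive_line f x v (t : R) : derivable f (x + t *: v) v ->
  is_derive t 1 (fun s : R => f (x + s *: v)) ('D_v f (x + t *: v)).
Proof.
move=> df.
have E : (fun h : R => h^-1 *: (f (x + (h *: (1 : R) + t) *: v) - f (x + t *: v))) =
         (fun h : R => h^-1 *: (f (h *: v + (x + t *: v)) - f (x + t *: v))).
  apply/funext => h; congr (_ *: (f _ - _)).
  by rewrite scalerDl addrCA [h%:A]mulr1.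
apply: DeriveDef; first by rewrite /derivable/= E.
by rewrite /derive/= E.
Qed.

Lemma derivable_line f x v : derivable (fun s : R => f (x + s *: v)) 0 1 ->
  derivable f x v /\ 'D_v f x = 'D_1 (fun s : R => f (x + s *: v)) 0.
Proof.
have E : (fun h : R => h^-1 *: (f (x + (h *: (1 : R) + 0) *: v) - f (x + 0 *: v))) =
         (fun h : R => h^-1 *: (f (h *: v + x) - f x)).
  apply/funext => h; congr (_ *: (f _ - _)).
    by rewrite addr0 [h *: 1]mulr1 addrC.
  by rewrite scale0r addr0.
by rewrite /derivable /derive/= E.
Qed.

Lemma is_derive_lineP f x v (l : R) :
  is_derive (0 : R) 1 (fun s : R => f (x + s *: v)) l -> is_derive x v f l.
Proof.
move=> [/derivable_line[d e] h]; apply: DeriveDef => //.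
by rewrite e.
Qed.

Lemma mvt_line f x v (h : R) : 0 < h ->
  (forall y, derivable f y v) ->
  exists2 c : R, 0 < c < h & f (x + h *: v) - f x = h * 'D_v f (x + c *: v).
Proof.
move=> h0 df.
have dg (t : R) : is_derive t 1 (fun s : R => f (x + s *: v)) ('D_v f (x + t *: v)).
  exact: is_derive_line.
have cg : {within `[0, h], continuous (fun s : R => f (x + s *: v))}.
  apply: derivable_within_continuous => t _.
  by case: (dg t).
have [c] := MVT h0 (fun t _ => dg t) cg.
rewrite in_itv/= => ch; rewrite subr0 scale0r addr0 => ->.
by exists c => //; rewrite mulrC.
Qed.

End directional.

Section Cn.
Context {R : realType} {n : nat}.
Local Notation V := 'rV[R]_n.
Local Notation e i := (delta_mx ord0 i : V).
Implicit Types (f g : V -> R).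

(* Unlike [smooth], closed under products and compositions by induction on the order. *)
Fixpoint Cn (k : nat) f : Prop :=
  continuous f /\
  if k is k'.+1 then (forall x i, derivable f x (e i)) /\ forall i, Cn k' (partial i f)
  else True.

Lemma CnS k f : Cn k.+1 f <-> [/\ continuous f,
  forall x i, derivable f x (e i) & forall i, Cn k (partial i f)].
Proof. by split=> [[? []]|[]]. Qed.

Lemma Cn_continuous k f : Cn k f -> continuous f.
Proof. by case: k => [|k] []. Qed.

Lemma CnW k f : Cn k.+1 f -> Cn k f.
Proof.
elim: k f => [|k IH] f /CnS[cf df pf]; first by split.
by apply/CnS; split=> // i; apply: IH; exact: pf.
Qed.

Lemma smooth_partial i f : smooth f -> smooth (partial i f).
Proof. by move=> sf s; have := sf (rcons s i); rewrite foldr_rcons. Qed.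

Lemma smooth_foldr_partial f s : smooth f -> smooth (foldr partial f s).
Proof. by move=> sf; elim: s => [//|i s IH]; apply: smooth_partial. Qed.

Lemma smoothP f : smooth f <-> forall k, Cn k f.
Proof.
split=> [sf k|sf s].
  elim: k f sf => [|k IH] f sf; first by have [] := sf [::].
  have [cf df] := sf [::]; apply/CnS; split => // i.
  by apply: IH; exact: smooth_partial.
have H m : Cn m (foldr partial f s).
  elim: s m => [|i s IH] m; first exact: sf.
  by have /CnS[_ _] := IH m.+1; exact.
split; first exact: (Cn_continuous (H 0)).
by move=> x i; have /CnS[_ + _] := H 1; exact.
Qed.

Lemma smooth_continuous f : smooth f -> continuous f.
Proof. by move=> /(_ [::])[]. Qed.

Lemma smooth_derivable f x i : smooth f -> derivable f x (e i).
Proof. by move=> /(_ [::])[_]; exact. Qed.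

Lemma partial_cst i (c : R) : partial i (cst c : V -> R) = cst 0.
Proof. by apply/funext => x; rewrite /partial derive_cst. Qed.

Lemma Cn_cst k (c : R) : Cn k (cst c : V -> R).
Proof.
elim: k c => [|k IH] c; first by split=> // x; exact: cst_continuous.
apply/CnS; split => [|x i|i]; [exact: cst_continuous|exact: derivable_cst|].
by rewrite partial_cst; exact: IH.
Qed.

Lemma is_derive_coord x (v : V) i : is_derive x v (fun y : V => y ord0 i) (v ord0 i).
Proof.
apply: is_derive_lineP.
rewrite (_ : (fun s : R => _) = (fun s : R => x ord0 i + s * v ord0 i)); last first.
  by apply/funext => s; rewrite !mxE.
by apply: is_derive_eq; rewrite add0r scaler0 add0r [(v ord0 i)%:A]mulr1 ?mul1r.
Qed.

Lemma Cn_coord k i : Cn k (fun y : V => y ord0 i).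
Proof.
have c : continuous (fun y : V => y ord0 i) by exact: coord_continuous.
case: k => [|k]; first by split.
apply/CnS; split=> // [x j|j]; first by case: (is_derive_coord x (e j) i).
rewrite (_ : partial j _ = cst (e j ord0 i)); first exact: Cn_cst.
by apply/funext => x; rewrite /partial; case: (is_derive_coord x (e j) i).
Qed.

Lemma partialD i f g : (forall x, derivable f x (e i)) -> (forall x, derivable g x (e i)) ->
  partial i (f \+ g) = partial i f \+ partial i g.
Proof. by move=> df dg; apply/funext => x; rewrite /partial deriveD. Qed.

Lemma partialN i f : (forall x, derivable f x (e i)) -> partial i (\- f) = \- partial i f.
Proof. by move=> df; apply/funext => x; rewrite /partial deriveN. Qed.

Lemma partialM i f g : (forall x, derivable f x (e i)) -> (forall x, derivable g x (e i)) ->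
  partial i (f \* g) = (f \* partial i g) \+ (partial i f \* g).
Proof.
move=> df dg; apply/funext => x; rewrite /partial deriveM//=.
by congr (_ + _); rewrite /GRing.scale/= mulrC.
Qed.

Lemma CnD k f g : Cn k f -> Cn k g -> Cn k (f \+ g).
Proof.
have c f' g' : continuous f' -> continuous g' -> continuous (f' \+ g' : V -> R).
  by move=> cf cg x; exact: (cvgD (cf x) (cg x)).
elim: k f g => [|k IH] f g; first by move=> [cf _] [cg _]; split=> //; exact: c.
move=> /CnS[cf df pf] /CnS[cg dg pg]; apply/CnS.
split=> [|x i|i]; [exact: c|exact: derivableD|].
by rewrite partialD//; exact: (IH _ _ (pf i) (pg i)).
Qed.

Lemma CnN k f : Cn k f -> Cn k (\- f).
Proof.
elim: k f => [|k IH] f; first by move=> [cf _]; split=> // x; exact: (cvgN (cf x)).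
move=> /CnS[cf df pf]; apply/CnS.
split=> [x|x i|i]; [exact: (cvgN (cf x))|exact: derivableN|].
by rewrite partialN//; exact: (IH _ (pf i)).
Qed.

Lemma CnM k f g : Cn k f -> Cn k g -> Cn k (f \* g).
Proof.
have c f' g' : continuous f' -> continuous g' -> continuous (f' \* g' : V -> R).
  by move=> cf cg x; exact: (cvgM (cf x) (cg x)).
elim: k f g => [|k IH] f g hf hg.
  split=> //; apply: c; [exact: (Cn_continuous hf)|exact: (Cn_continuous hg)].
have /CnS[cf df pf] := hf; have /CnS[cg dg pg] := hg; apply/CnS.
split=> [|x i|i]; [exact: c|exact: derivableM|].
rewrite partialM//; apply: CnD; first exact: (IH _ _ (CnW hf) (pg i)).
exact: (IH _ _ (pf i) (CnW hg)).
Qed.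

Lemma is_derive_comp_dir f (g : R -> R) x v (a b : R) :
  is_derive x v f a -> is_derive (f x) 1 g b -> is_derive x v (g \o f) (b * a).
Proof.
move=> [df ea] dg; apply: is_derive_lineP.
have E : f x = f (x + 0 *: v) by rewrite scale0r addr0.
have d1 : is_derive (0 : R) 1 (fun s : R => f (x + s *: v)) a.
  have -> : a = 'D_v f (x + 0 *: v) by rewrite scale0r addr0.
  by apply: is_derive_line; rewrite scale0r addr0.
have dg' : is_derive ((fun s : R => f (x + s *: v)) 0) 1 g b by rewrite /= -E.
by have := @is_derive1_comp R g (fun s : R => f (x + s *: v)) 0 _ _ dg' d1; rewrite mulrC.
Qed.

(** Taking a whole sequence [G], each term the derivative of the previous one, lets the induction on
    [k] move on to the outer derivative. *)
Lemma Cn_comp k f (G : nat -> R -> R) j :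
  (forall j (t : R), is_derive t 1 (G j) (G j.+1 t)) -> Cn k f -> Cn k (G j \o f).
Proof.
move=> dG.
have cG m : continuous (G m).
  move=> t; apply: differentiable_continuous; apply/derivable1_diffP.
  by case: (dG m t).
have c f' m : continuous f' -> continuous (G m \o f' : V -> R).
  by move=> cf x; apply: continuous_comp; [exact: cf|exact: cG].
elim: k f j => [|k IH] f j hf; first by split=> //; apply: c; exact: (Cn_continuous hf).
have /CnS[cf df pf] := hf.
have D x i : is_derive x (e i) (G j \o f) (G j.+1 (f x) * partial i f x).
  by apply: is_derive_comp_dir; exact: DeriveDef.
apply/CnS; split=> [|x i|i]; [exact: c|by case: (D x i)|].
rewrite (_ : partial i _ = (G j.+1 \o f) \* partial i f).
  by apply: CnM; [exact: (IH _ _ (CnW hf))|exact: pf].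
by apply/funext => x; rewrite /partial; case: (D x i).
Qed.

Lemma is_derive_affine f x v (a : R) b : derivable f (a *: x + b) v ->
  is_derive x v (fun y => f (a *: y + b)) (a * 'D_v f (a *: x + b)).
Proof.
move=> df; apply: is_derive_lineP.
have E : (fun s : R => f (a *: (x + s *: v) + b)) =
    (fun t : R => f ((a *: x + b) + t *: v)) \o (fun s : R => a * s).
  by apply/funext => s /=; rewrite scalerDr scalerA addrAC.
rewrite E.
have d2 : is_derive (0 : R) 1 (fun s : R => a * s) a.
  by apply: is_derive_eq; exact: mulr1.
have d1 : is_derive (a * 0) 1 (fun t : R => f ((a *: x + b) + t *: v)) ('D_v f (a *: x + b)).
  have -> : 'D_v f (a *: x + b) = 'D_v f (a *: x + b + 0 *: v) by rewrite scale0r addr0.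
  by rewrite mulr0; apply: is_derive_line; rewrite scale0r addr0.
by have := @is_derive1_comp R _ (fun s : R => a * s) 0 _ _ d1 d2; rewrite mulrC.
Qed.

Lemma partial_affine i f (a : R) b : (forall x, derivable f x (e i)) ->
  partial i (fun y => f (a *: y + b)) = fun x => a * partial i f (a *: x + b).
Proof.
move=> df; apply/funext => x; rewrite /partial.
by case: (is_derive_affine (df (a *: x + b))).
Qed.

Lemma Cn_affine k f (a : R) b : Cn k f -> Cn k (fun y => f (a *: y + b)).
Proof.
have c f' : continuous f' -> continuous (fun y => f' (a *: y + b) : R).
  move=> cf x; apply: (@continuous_comp _ _ _ (fun y : V => a *: y + b) f'); last exact: cf.
  exact: (cvgD (@scaler_continuous _ _ a x) (cvg_cst b)).
elim: k f => [|k IH] f hf; first by split=> //; apply: c; exact: (Cn_continuous hf).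
have /CnS[cf df pf] := hf; apply/CnS.
split=> [|x i|i]; [exact: c|by case: (is_derive_affine (df (a *: x + b) i))|].
rewrite partial_affine//; apply: (@CnM _ (cst a) (fun x => partial i f (a *: x + b))).
  exact: Cn_cst.
exact: IH.
Qed.

Lemma foldr_partial_affine s f (a : R) b : smooth f ->
  foldr partial (fun y => f (a *: y + b)) s =
  fun x => a ^+ size s * foldr partial f s (a *: x + b).
Proof.
move=> sf; elim: s => [|i s IH] /=; first by apply/funext => x; rewrite mul1r.
rewrite IH.
have d x : derivable (fun y => foldr partial f s (a *: y + b)) x (e i).
  apply: (smooth_derivable); apply/smoothP => k; apply: Cn_affine.
  by have /smoothP := smooth_foldr_partial s sf; exact.
rewrite (@partialM i (cst (a ^+ size s)) (fun y => foldr partial f s (a *: y + b)) _ d); last first.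
  by move=> x; exact: derivable_cst.
rewrite partial_affine; last by move=> x; apply: smooth_derivable; exact: smooth_foldr_partial.
rewrite partial_cst; apply/funext => x /=.
by rewrite mul0r addr0 exprSr mulrA.
Qed.

Lemma smooth_cst (c : R) : smooth (cst c : V -> R).
Proof. by apply/smoothP => k; exact: Cn_cst. Qed.

Lemma smoothD f g : smooth f -> smooth g -> smooth (f \+ g).
Proof. by move=> /smoothP sf /smoothP sg; apply/smoothP => k; exact: CnD. Qed.

Lemma smoothN f : smooth f -> smooth (\- f).
Proof. by move=> /smoothP sf; apply/smoothP => k; exact: CnN. Qed.

Lemma smoothM f g : smooth f -> smooth g -> smooth (f \* g).
Proof. by move=> /smoothP sf /smoothP sg; apply/smoothP => k; exact: CnM. Qed.

Lemma smooth_affine f (a : R) b : smooth f -> smooth (fun y => f (a *: y + b)).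
Proof. by move=> /smoothP sf; apply/smoothP => k; exact: Cn_affine. Qed.

Lemma foldr_partialD s f g : smooth f -> smooth g ->
  foldr partial (f \+ g) s = foldr partial f s \+ foldr partial g s.
Proof.
move=> sf sg; elim: s => //= i s ->; rewrite partialD// => x;
  by apply: smooth_derivable; exact: smooth_foldr_partial.
Qed.

Lemma foldr_partialN s f : smooth f ->
  foldr partial (\- f) s = \- foldr partial f s.
Proof.
move=> sf; elim: s => //= i s ->; rewrite partialN// => x;
  by apply: smooth_derivable; exact: smooth_foldr_partial.
Qed.

End Cn.

(** * Symmetry of mixed partial derivatives *)

Section clairaut.
Context {R : realType} {n : nat}.
Local Notation V := 'rV[R]_n.
Local Notation e i := (delta_mx ord0 i : V).
Implicit Types (f : V -> R).

Lemma enorm_delta (i : 'I_n) : enorm (e i) = 1.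
Proof.
rewrite /enorm (bigD1 i)//= !mxE !eqxx/= expr1n big1 ?addr0 ?sqrtr1// => j ji.
by rewrite !mxE eqxx (negPf ji)/= expr0n.
Qed.

Lemma no_common_approx (a b w : R) :
  `|b - w| < `|a - b| / 2 -> `|a - w| < `|a - b| / 2 -> False.
Proof.
have : `|a - b| <= `|a - w| + `|b - w|.
  by rewrite (_ : a - b = (a - w) - (b - w)) ?ler_normB//; ring.
by lra.
Qed.

(** Two applications of the mean value theorem: first in direction [i] to the increment of [f] in
    direction [j], then in direction [j] to [partial i f]. *)
Lemma second_difference f i j x (h : R) : smooth f -> 0 < h ->
  exists y, enorm (y - x) < 2 * h /\
    f (x + h *: e i + h *: e j) - f (x + h *: e i) - f (x + h *: e j) + f x =
    h ^+ 2 * partial j (partial i f) y.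
Proof.
move=> sf h0.
pose g y := f (y + h *: e j) - f y.
have dgy y : is_derive y (e i) g (partial i f (y + h *: e j) - partial i f y).
  have d1 : is_derive y (e i) (fun y => f (y + h *: e j)) (partial i f (y + h *: e j)).
    have := @is_derive_affine R n f y (e i) 1 (h *: e j).
    rewrite !scale1r mul1r => H.
    have -> : (fun y => f (y + h *: e j)) = (fun y => f (1 *: y + h *: e j)).
      by apply/funext => z; rewrite scale1r.
    by apply: H; exact: smooth_derivable.
  have d2 : is_derive y (e i) f (partial i f y).
    by apply: DeriveDef => //; exact: smooth_derivable.
  exact: is_deriveB.
have [c1 /andP[c10 c1h] E1] : exists2 c : R, 0 < c < h &
    g (x + h *: e i) - g x = h * 'D_(e i) g (x + c *: e i).
  by apply: mvt_line => // y; case: (dgy y).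
have [c2 /andP[c20 c2h] E2] : exists2 c : R, 0 < c < h &
    partial i f (x + c1 *: e i + h *: e j) - partial i f (x + c1 *: e i) =
    h * partial j (partial i f) (x + c1 *: e i + c *: e j).
  by apply: mvt_line => // y; apply: smooth_derivable; exact: smooth_partial.
exists (x + c1 *: e i + c2 *: e j); split.
  rewrite -(addrA x) [x + _]addrC addrK; apply: (le_lt_trans (enormD _ _)).
  by rewrite !enormZ !enorm_delta !mulr1 !gtr0_norm//; lra.
have := E1; rewrite (@derive_val _ _ _ _ _ _ _ (dgy _)) E2 /g => E.
by rewrite expr2 -mulrA -E; ring.
Qed.

(** The second difference is symmetric in [i] and [j], so both mixed derivatives take a common value
    at points arbitrarily close to [x]; continuity then excludes that they differ at [x]. *)
Lemma partialC f i j : smooth f -> partial i (partial j f) = partial j (partial i f).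
Proof.
move=> sf; apply/funext => x; apply/eqP; rewrite -subr_eq0; apply/negP => /negP ab.
set a := partial i _ _ in ab; set b := partial j _ _ in ab.
have e0 : 0 < `|a - b| / 2 by rewrite divr_gt0// normr_gt0.
have near_c (g : V -> R) : smooth g -> exists2 d : R, 0 < d &
    forall y, enorm (y - x) < d -> `|g x - g y| < `|a - b| / 2.
  move=> /smooth_continuous/(_ x)/cvgrPdist_lt/(_ _ e0).
  by move=> /nbhs_enormP[d d0 H]; exists d => // y yd; apply: H.
have [d1 d10 H1] := near_c _ (smooth_partial i (smooth_partial j sf)).
have [d2 d20 H2] := near_c _ (smooth_partial j (smooth_partial i sf)).
pose h := Num.min d1 d2 / 2.
have m0 : 0 < Num.min d1 d2 by rewrite lt_min d10.
have h0 : 0 < h by rewrite divr_gt0.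
have h2 : 2 * h = Num.min d1 d2 by rewrite /h mulrC divfK.
have [y [yh Ey]] := second_difference j i x sf h0.
have [z [zh Ez]] := second_difference i j x sf h0.
move: yh zh; rewrite h2 !lt_min => /andP[yd1 _] /andP[_ zd2].
have E : partial i (partial j f) y = partial j (partial i f) z.
  apply: (@mulfI _ (h ^+ 2)); first by rewrite expf_neq0// gt_eqF.
  apply: (etrans (esym Ey)); apply: (etrans _ Ez).
  by rewrite [x + h *: e j + _]addrAC; congr (_ + _); exact: addrAC.
have := H1 _ yd1; have := H2 _ zd2; rewrite -/a -/b E; exact: no_common_approx.
Qed.

Lemma foldr_partialC f i s : smooth f ->
  foldr partial (partial i f) s = partial i (foldr partial f s).
Proof.
move=> sf; elim: s => //= j s ->.
by rewrite (partialC _ _ (smooth_foldr_partial _ sf)).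
Qed.

(** The head of [s] is moved to its place in [t] by successive transpositions. *)
Lemma perm_foldr_partial f s t : smooth f -> perm_eq s t ->
  foldr partial f s = foldr partial f t.
Proof.
move=> sf; elim: s t => [|i s IH] t.
  by rewrite perm_sym => /perm_nilP ->.
move=> st; have it : i \in t by rewrite -(perm_mem st) mem_head.
have : perm_eq (i :: s) (i :: rem i t).
  by apply: (perm_trans st); exact: perm_to_rem.
rewrite perm_cons => /IH /= ->.
elim: t it {st} => // j t IHt; rewrite inE /= eq_sym.
case: eqVneq => [->//|ji /=] it.
by rewrite (partialC _ _ (smooth_foldr_partial _ sf)) IHt.
Qed.

Definition mi_seq (alpha : 'I_n -> nat) : seq 'I_n :=
  flatten [seq nseq (alpha i) i | i <- enum 'I_n].

Lemma partial_miE alpha f : partial_mi alpha f = foldr partial f (mi_seq alpha).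
Proof.
rewrite /partial_mi /mi_seq; elim: (enum _) => //= i s ->.
by rewrite foldr_cat; elim: (alpha i) => //= m ->.
Qed.

Lemma size_mi_seq alpha : size (mi_seq alpha) = mi_order alpha.
Proof.
rewrite size_flatten /shape -map_comp sumnE big_map /mi_order big_enum/=.
by apply: eq_bigr => i _; rewrite size_nseq.
Qed.

Lemma count_mi_seq alpha i : count_mem i (mi_seq alpha) = alpha i.
Proof.
rewrite count_flatten -map_comp sumnE big_map big_enum/= (bigD1 i)//= big1.
  by rewrite count_nseq/= eqxx mul1n addn0.
by move=> j ji; rewrite count_nseq/= (negPf ji).
Qed.

End clairaut.

(** * Test functions and their supports *)

Section test_functions.
Context {R : realType} {n : nat}.
Local Notation V := 'rV[R]_n.
Local Notation e i := (delta_mx ord0 i : V).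
Implicit Types (f g : V -> R).

Lemma supp_bounded f : compact (supp f) ->
  exists2 r, 0 < r & forall x, f x != 0 -> enorm x < r.
Proof.
move=> /compact_bounded[M [_ HM]].
exists (n.+1%:R * (`|M| + 1)); first by rewrite mulr_gt0// ltr_pwDr.
move=> x fx0; apply: (le_lt_trans (enorm_le_mx _)).
apply: (@le_lt_trans _ _ (n%:R * (`|M| + 1))).
  rewrite ler_wpM2l//; apply: (HM (`|M| + 1)).
    by rewrite (le_lt_trans (ler_norm M))// ltrDl.
  exact: subset_closure.
by rewrite ltr_pM2r ?ltr_nat// ltr_pwDr.
Qed.

Lemma bounded_supp f r : (forall x, f x != 0 -> enorm x <= r) -> compact (supp f).
Proof.
move=> fr; apply: bounded_closed_compact; last exact: closed_closure.
exists r; split; first exact: num_real.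
move=> s rs x /= cx; apply: (le_trans (mx_le_enorm x)); apply: ltW.
apply/negPn/negP; rewrite -leNgt => sx.
have e0 : 0 < s - r by rewrite subr_gt0.
have [|y [fy0 yx]] := cx (eball x (s - r)).
  by apply/nbhs_enormP; exists (s - r).
have := fr _ fy0; apply/negP; rewrite -ltNge.
have := enorm_triangle x y 0; rewrite !subr0 enormB.
by move: yx; rewrite /eball/=; lra.
Qed.

(** Off the closed set [supp f] the function vanishes in a neighbourhood, so its difference
    quotients are eventually 0. *)
Lemma supp_partial i f : supp (partial i f) `<=` supp f.
Proof.
suff H : [set x | partial i f x != 0] `<=` supp f.
  have /closure_id E : closed (supp f) by exact: closed_closure.
  by rewrite E; exact: closureS.
move=> x /= pfx;  apply: contrapT => nfx.
have /nbhs_enormP[d d0 Hd] : nbhs x (~` supp f).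
  by apply: open_nbhs_nbhs; split => //; apply: closed_openC; exact: closed_closure.
move/eqP: pfx; apply.
have f0 y : eball x d y -> f y = 0.
  move=> /Hd nfy; apply/eqP/negPn/negP => fy0; apply: nfy.
  exact: subset_closure.
rewrite /partial /derive.
apply/cvg_lim => //; apply: (@cvg_trans _ ((fun=> (0 : R)) @ 0^')); last exact: cvg_cst.
apply: near_eq_cvg; near=> h.
rewrite /= (f0 x) ?subr0; last exact: eball_center.
rewrite f0 ?scaler0//.
rewrite /eball/= addrK enormZ enorm_delta mulr1.
near: h; apply: dnbhs0_lt => //.
Unshelve. all: by end_near. Qed.

Lemma supp_foldr_partial s f : supp (foldr partial f s) `<=` supp f.
Proof. by elim: s => //= i s IH; exact: subset_trans (@supp_partial i _) IH. Qed.

Lemma test_partial i f : test_function f -> test_function (partial i f).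
Proof.
move=> [sf cf]; split; first exact: smooth_partial.
apply: (subclosed_compact _ cf); first exact: closed_closure.
exact: supp_partial.
Qed.

Lemma test_foldr_partial s f : test_function f -> test_function (foldr partial f s).
Proof. by move=> tf; elim: s => [//|i s IH]; exact: test_partial. Qed.

Lemma test_smoothM f g : smooth f -> test_function g -> test_function (f \* g).
Proof.
move=> sf [sg /supp_bounded[r r0 gr]]; split; first exact: smoothM.
apply: (@bounded_supp _ r) => x /= fg; apply/ltW/gr.
by apply: contraNneq fg => ->; rewrite mulr0.
Qed.

Lemma testD f g : test_function f -> test_function g -> test_function (f \+ g).
Proof.
move=> [sf /supp_bounded[r r0 fr]] [sg /supp_bounded[s s0 gs]]; split; first exact: smoothD.
apply: (@bounded_supp _ (Num.max r s)) => x /= fg; rewrite le_max.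
apply/orP; have [f0|f0] := eqVneq (f x) 0; last by left; exact/ltW/fr.
by right; apply/ltW/gs; apply: contraNneq fg => ->; rewrite f0 addr0.
Qed.

Lemma testN f : test_function f -> test_function (\- f).
Proof.
move=> [sf /supp_bounded[r r0 fr]]; split; first exact: smoothN.
apply: (@bounded_supp _ r) => x /= fx; apply/ltW/fr.
by rewrite -oppr_eq0.
Qed.

Lemma test_continuous f : test_function f -> continuous f.
Proof. by move=> [/smooth_continuous]. Qed.

Lemma continuous_bounded_supp f r : continuous f -> (forall x, f x != 0 -> enorm x < r) ->
  exists2 M, 0 <= M & forall x, `|f x| <= M.
Proof.
move=> cf fr.
have cK : compact (closure (eball 0 r : set V)).
  apply: bounded_closed_compact; last exact: closed_closure.
  exists (r + 1); split; first exact: num_real.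
  move=> s rs x /= cx; apply: (le_trans (mx_le_enorm x)).
  have [|y [y0 yx]] := cx (eball x 1); first by apply/nbhs_enormP; exists 1.
  have := enorm_triangle x y 0; move: y0 yx; rewrite /eball/= !subr0 (enormB y).
  by lra.
have [M [_ HM]] : bounded_set (f @` closure (eball 0 r : set V)).
  apply: compact_bounded; apply: continuous_compact => //.
  exact: continuous_subspaceT.
exists (`|M| + 1); first by rewrite addr_ge0.
move=> x; have [->|fx0] := eqVneq (f x) 0; first by rewrite normr0 addr_ge0.
apply: (HM (`|M| + 1)); first by rewrite (le_lt_trans (ler_norm M))// ltrDl.
exists x => //; apply: subset_closure; rewrite /eball/= subr0; exact: fr.
Qed.

Lemma test_bounded f : test_function f -> exists2 M, 0 <= M & forall x, `|f x| <= M.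
Proof.
move=> [/smooth_continuous cf /supp_bounded[r r0 fr]].
exact: continuous_bounded_supp cf fr.
Qed.

End test_functions.

(** * A smooth bump function *)

Section flat_function.
Context {R : realType}.
Implicit Types (P : {poly R}) (t : R).

(* Derivatives of functions of this form are again of this form. *)
Definition flat P t : R := if 0 < t then P.[t^-1] * expR (- t^-1) else 0.

(** From $e^s = (e^{s/N})^N \ge (s/N)^N$. *)
Lemma pow_expRN (N : nat) (s : R) : 0 <= s -> s ^+ N * expR (- s) <= N%:R ^+ N.
Proof.
case: N => [|N] s0; first by rewrite !expr0 mul1r -expR0 ler_expR oppr_le0.
rewrite expRN ler_pdivrMr ?expR_gt0//.
have -> : expR s = expR (s / N.+1%:R) ^+ N.+1.
  by rewrite -expRM_natl mulrC divfK// pnatr_eq0.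
rewrite -exprMn lerXn2r ?nnegrE ?mulr_ge0 ?expR_ge0//.
rewrite -ler_pdivrMl// mulrC (le_trans _ (expR_ge1Dx _))//.
by rewrite lerDr.
Qed.

(** A polynomial of size [m] in $1/t$ is at most $C t^{-m}$ for $t \le 1$; trading $m + 2$ powers
    against the exponential leaves $t^2$, enough for a zero derivative at 0. *)
Lemma flat_small P : exists C : R, forall t, 0 < t <= 1 -> `|flat P t| <= C * t ^+ 2.
Proof.
pose m := size P.
pose C := \sum_(i < size P) `|P`_i|.
exists (C * m.+2%:R ^+ m.+2) => t /andP[t0 t1].
rewrite /flat t0 normrM [`|expR _|]gtr0_norm ?expR_gt0//.
have s1 : 1 <= t^-1 by rewrite invf_ge1.
have s0 : 0 <= t^-1 by exact: (le_trans ler01).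
have H : `|P.[t^-1]| <= C * t^-1 ^+ m.
  rewrite horner_coef mulr_suml (le_trans (ler_norm_sum _ _ _))// ler_sum// => i _.
  rewrite normrM ler_wpM2l// ger0_norm ?exprn_ge0// ler_weXn2l//.
  exact: ltnW.
have C0 : 0 <= C by exact: sumr_ge0.
apply: (@le_trans _ _ (C * t^-1 ^+ m * expR (- t^-1))).
  by rewrite ler_wpM2r// expR_ge0.
have -> : C * t^-1 ^+ m * expR (- t^-1) = C * (t^-1 ^+ m.+2 * expR (- t^-1)) * t ^+ 2.
  have <- : t^-1 ^+ m.+2 * t ^+ 2 = t^-1 ^+ m.
    by rewrite -addn2 exprD -mulrA -exprMn mulVf ?expr1n ?mulr1// gt_eqF.
  by ring.
rewrite ler_wpM2r ?sqr_ge0// ler_wpM2l//.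
exact: pow_expRN.
Qed.

(** With $s = 1/t$, the derivative of $P(s) e^{-s}$ in $s$ is $(P'(s) - P(s)) e^{-s}$, and $ds/dt =
    -s^2$. *)
Lemma flat_derive P t : is_derive t 1 (flat P) (flat ('X^2 * (P - P^`())) t).
Proof.
have [t0|t0] := ltP 0 t.
  apply: (@near_eq_is_derive R R R (fun s => P.[s^-1] * expR (- s^-1)) (flat P) t 1).
    near=> s; rewrite /flat ifT//.
    by near: s; exact: lt_nbhsr.
  have dV : is_derive t 1 (fun s : R => s^-1) (- t^-2).
    have t1 : (id t : R) != 0 by rewrite gt_eqF.
    have di := @derivable_id R R t 1.
    apply: DeriveDef; first exact: (derivableV t1 di).
    by rewrite (deriveV t1 di) derive_id [_ *: 1]mulr1.
  have dP : is_derive (t^-1) 1 (fun s => P.[s] * expR (- s))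
      (P.[t^-1] * - expR (- t^-1) + expR (- t^-1) * P^`().[t^-1]).
    have dE : is_derive (t^-1) 1 (fun s : R => expR (- s)) (- expR (- t^-1)).
      have := @is_derive1_comp R expR -%R (t^-1) _ _ (is_derive_expR (- t^-1))
        (is_deriveNid _ _).
      by rewrite mulrN1.
    exact: (is_deriveM (is_derive_poly P (t^-1)) dE).
  have -> : flat ('X^2 * (P - P^`())) t =
      (P.[t^-1] * - expR (- t^-1) + expR (- t^-1) * P^`().[t^-1]) * - t ^- 2.
    rewrite /flat t0 !(hornerE, hornerXn) -exprVn.
    set E := expR _; set p := P.[_]; set q := P^`().[_]; set w := t^-1.
    by ring.
  exact: (@is_derive1_comp R _ (fun s : R => s^-1) t _ _ dP dV).
have -> : flat ('X^2 * (P - P^`())) t = 0 by rewrite /flat ltNge t0.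
have ft0 : flat P t = 0 by rewrite /flat ltNge t0.
have [tn0|tp0] := ltP t 0.
  apply: (@near_eq_is_derive R R R (cst 0) (flat P) t 1) => //.
  near=> s; rewrite /flat ifF//; apply/negbTE; rewrite -leNgt ltW//.
  by near: s; exact: lt_nbhsl.
have {}t0 : t = 0 by apply/eqP; rewrite eq_le t0.
rewrite {}t0 {tp0} in ft0 *.
(* At 0 the quotients from the left vanish, and the quadratic bound makes those from the right tend
   to 0. *)
have [C HC] := flat_small P.
have C0 : 0 <= C by have := HC 1; rewrite ltr01 lexx expr1n mulr1 => /(_ isT); exact: le_trans.
have cv : h^-1 *: (flat P (h *: (1 : R) + 0) - flat P 0) @[h --> (0:R)^'] --> (0 : R).
  rewrite ft0; apply/cvgr0Pnorm_le => e e0.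
  near=> h.
  rewrite subr0 addr0 [h%:A]mulr1 normrZ.
  have [h0|h0] := ltP 0 h; last by rewrite /flat ltNge h0 normr0 mulr0 ltW.
  have h1 : h <= 1.
    apply: (le_trans (ler_norm _)); near: h; exact: dnbhs0_le.
  have hC : `|h| < e / (C + 1).
    by near: h; apply: dnbhs0_lt; rewrite divr_gt0// ltr_pwDr.
  have := HC h; rewrite h0 h1 => /(_ isT) H.
  rewrite normfV ler_pdivrMl ?normr_gt0 ?gt_eqF// (gtr0_norm h0) (le_trans H)//.
  rewrite expr2 mulrCA ler_wpM2l ?(ltW h0)//.
  move: hC; rewrite ltr_pdivlMr ?ltr_pwDr// gtr0_norm// => hC.
  by apply: ltW; apply: (le_lt_trans _ hC); rewrite mulrDr mulr1 mulrC lerDl ltW.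
apply: DeriveDef; first by apply/cvg_ex; exists 0.
exact/cvg_lim.
Unshelve. all: by end_near. Qed.

End flat_function.

Section smooth_bump.
Context {R : realType} {n : nat}.
Local Notation V := 'rV[R]_n.

Fixpoint flat_poly (j : nat) : {poly R} :=
  if j is j'.+1 then 'X^2 * (flat_poly j' - (flat_poly j')^`()) else 1.

(** The standard bump $\exp(-1/(1 - |x|^2))$, extended by 0 outside the unit ball. *)
Definition smooth_bump (x : V) : R := flat 1 (1 - \sum_(i < n) x ord0 i ^+ 2).

Lemma bump_smooth : smooth smooth_bump.
Proof.
pose q (x : V) : R := 1 - \sum_(i < n) x ord0 i ^+ 2.
have sq : smooth q.
  rewrite /q; apply: (@smoothD _ _ (cst 1) (\- (fun x : V => \sum_(i < n) x ord0 i ^+ 2))).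
    exact: smooth_cst.
  apply: smoothN; elim: (index_enum _) => [|i s IH].
    rewrite (_ : (fun _ => _) = cst 0); first exact: smooth_cst.
    by apply/funext => x; rewrite big_nil.
  rewrite (_ : (fun _ => _) = ((fun x : V => x ord0 i) \* (fun x : V => x ord0 i)) \+
     (fun x : V => \sum_(j <- s) x ord0 j ^+ 2)).
    apply: smoothD => //; apply: smoothM; apply/smoothP => k; exact: Cn_coord.
  by apply/funext => x; rewrite big_cons.
apply/smoothP => k.
apply: (@Cn_comp _ _ _ q (fun j => flat (flat_poly j)) 0) => [j t|].
  exact: flat_derive.
by have /smoothP := sq; exact.
Qed.

Lemma bump_ge0 x : 0 <= smooth_bump x.
Proof. by rewrite /smooth_bump /flat; case: ifP => // _; rewrite hornerE mul1r expR_ge0. Qed.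

Lemma bump_supp x : smooth_bump x != 0 -> enorm x < 1.
Proof.
rewrite /smooth_bump /flat; case: ifPn => [|_]; last by rewrite eqxx.
rewrite subr_gt0 -sqr_enorm => h _.
by rewrite -(@ltr_pXn2r _ 2)// ?nnegrE ?enorm_ge0// expr1n.
Qed.

Lemma bump_lower : exists2 m : R, 0 < m & forall x, enorm x <= 2^-1 -> m <= smooth_bump x.
Proof.
(* For $|x| \le 1/2$ one has $1 - |x|^2 \ge 3/4$. *)
exists (expR (- (4/3))); first exact: expR_gt0.
move=> x hx.
have s4 : \sum_(i < n) x ord0 i ^+ 2 <= 4^-1.
  rewrite -sqr_enorm (_ : 4^-1 = 2^-1 ^+ 2); last by rewrite expr2; lra.
  by rewrite lerXn2r ?nnegrE ?enorm_ge0.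
have q34 : 3/4 <= 1 - \sum_(i < n) x ord0 i ^+ 2 by lra.
have q0 : 0 < 1 - \sum_(i < n) x ord0 i ^+ 2 by lra.
rewrite /smooth_bump /flat q0 hornerE mul1r ler_expR lerN2 invf_ple ?posrE//.
by lra.
Qed.

Lemma bump_test : test_function smooth_bump.
Proof.
split; first exact: bump_smooth.
by apply: (@bounded_supp _ _ _ 1) => x /bump_supp/ltW.
Qed.

End smooth_bump.

(** * Integrals of powers *)

Section power_inequalities.
Context {R : realType}.
Implicit Types a b p : R.

Lemma powR_normD p a b : 0 <= p ->
  `|a + b| `^ p <= 2 `^ p * (`|a| `^ p + `|b| `^ p).
Proof.
move=> p0; apply: (@le_trans _ _ ((2 * Num.max `|a| `|b|) `^ p)).
  rewrite ge0_ler_powR ?nnegrE ?mulr_ge0 ?le_max ?normr_ge0//.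
  apply: (le_trans (ler_normD a b)); rewrite mulr_natl mulr2n.
  by apply: lerD; rewrite le_max lexx ?orbT.
rewrite powRM ?le_max ?normr_ge0// ler_wpM2l ?powR_ge0//.
by rewrite maxEle; case: ifP => _; rewrite ?lerDl ?lerDr powR_ge0.
Qed.

Lemma powR_norm_sum p (I : Type) (s : seq I) (F : I -> R) : 0 < p ->
  `|\sum_(i <- s) F i| `^ p <= (2 `^ p) ^+ size s * \sum_(i <- s) `|F i| `^ p.
Proof.
move=> p0; have h2 : 1 <= 2 `^ p :> R.
  by rewrite -[leLHS](powRr0 2); apply: ler_powR; [rewrite ler1n|exact: ltW].
elim: s => [|i s IH]; first by rewrite !big_nil mulr0 normr0 powR0// gt_eqF.
rewrite !big_cons (le_trans (powR_normD _ _ (ltW p0)))//= exprS -mulrA.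
rewrite ler_wpM2l ?powR_ge0// mulrDr; apply: lerD => //.
by rewrite ler_peMl ?powR_ge0// exprn_ege1.
Qed.

End power_inequalities.

Section integral_power.
Context d (T : measurableType d) (R : realType) (mu : {measure set T -> \bar R}).
Implicit Types (S : set T) (f g : T -> R) (p : R).

(** The $p$-th power of the $L^p$ norm on [S], with values in the extended reals so that
    inequalities can be stated before finiteness is known. *)
Definition Ip p S f : \bar R := (\int[mu]_(x in S) (`|f x| `^ p)%:E)%E.

Lemma measurable_powR_norm p S f : measurable_fun [set: T] f ->
  measurable_fun S (fun x => (`|f x| `^ p)%:E).
Proof.
move=> mf; apply/measurable_EFinP; apply: (measurable_funS measurableT) => //.
apply: (@measurableT_comp _ _ _ _ _ _ (fun x : R => x `^ p)) => //.
exact: measurableT_comp.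
Qed.

Lemma Ip_ge0 p S f : (0 <= Ip p S f)%E.
Proof. by apply: integral_ge0 => x _; rewrite lee_fin powR_ge0. Qed.

Lemma le_Ip p S f g : 0 <= p -> measurable S ->
  measurable_fun [set: T] f -> measurable_fun [set: T] g ->
  (forall x, S x -> `|f x| <= `|g x|) -> (Ip p S f <= Ip p S g)%E.
Proof.
move=> p0 mS mf mg fg; apply: ge0_le_integral => //.
- exact: measurable_powR_norm.
- exact: measurable_powR_norm.
- by move=> x Sx; rewrite lee_fin ge0_ler_powR ?nnegrE//; exact: fg.
Qed.

Lemma eq_Ip p S f g : (forall x, S x -> `|f x| = `|g x|) -> Ip p S f = Ip p S g.
Proof. by move=> fg; apply: eq_integral => x /[!inE] Sx; rewrite fg. Qed.

Lemma Ip_subset p S S' f : measurable S -> measurable S' -> measurable_fun [set: T] f ->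
  S `<=` S' -> (Ip p S f <= Ip p S' f)%E.
Proof.
move=> mS mS' mf SS'; apply: ge0_subset_integral => //.
exact: measurable_powR_norm.
Qed.

Lemma IpD p S f g : 0 <= p -> measurable S ->
  measurable_fun [set: T] f -> measurable_fun [set: T] g ->
  (Ip p S (f \+ g)%R <= (2 `^ p)%:E * (Ip p S f + Ip p S g))%E.
Proof.
move=> p0 mS mf mg; rewrite /Ip -ge0_integralD//; try exact: measurable_powR_norm.
rewrite -ge0_integralZl//; last first.
- by move=> x _; rewrite -EFinD lee_fin addr_ge0 ?powR_ge0.
- by apply: emeasurable_funD; exact: measurable_powR_norm.
apply: ge0_le_integral => //.
- by apply: measurable_powR_norm; exact: measurable_funD.
- apply: measurable_funeM; apply: emeasurable_funD; exact: measurable_powR_norm.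
- by move=> x _; rewrite -EFinD -EFinM lee_fin powR_normD.
Qed.

Lemma IpN p S f : Ip p S (\- f) = Ip p S f.
Proof. by apply: eq_Ip => x _; rewrite normrN. Qed.

Lemma IpB p S f g : 0 <= p -> measurable S ->
  measurable_fun [set: T] f -> measurable_fun [set: T] g ->
  (Ip p S (f \- g)%R <= (2 `^ p)%:E * (Ip p S f + Ip p S g))%E.
Proof.
move=> p0 mS mf mg; rewrite -(IpN p S g); apply: IpD => //.
exact: measurable_funN.
Qed.

Lemma IpZ p S f (c : R) : 0 <= p -> measurable S -> measurable_fun [set: T] f ->
  Ip p S (fun x => c * f x) = ((`|c| `^ p)%:E * Ip p S f)%E.
Proof.
move=> p0 mS mf; rewrite /Ip -ge0_integralZl//; last exact: measurable_powR_norm.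
by apply: eq_integral => x _; rewrite normrM powRM.
Qed.

Lemma ae_eq_Ip p S f g : measurable S -> measurable_fun [set: T] f ->
  measurable_fun [set: T] g -> {ae mu, forall x, f x = g x} -> Ip p S f = Ip p S g.
Proof.
move=> mS mf mg fg; apply: ae_eq_integral => //; try exact: measurable_powR_norm.
by apply: filterS fg => x /= -> _.
Qed.

Lemma Ip_eq0 p S f : 0 < p -> measurable S -> measurable_fun [set: T] f ->
  Ip p S f = 0%E -> {ae mu, forall x, S x -> f x = 0}.
Proof.
move=> p0 mS mf.
have H x : (`|(`|f x| `^ p)%:E| = (`|f x| `^ p)%:E)%E.
  by rewrite gee0_abs// lee_fin powR_ge0.
rewrite /Ip; under eq_integral do rewrite -H.
move=> /(ae_eq_integral_abs mu mS (measurable_powR_norm p (S := S) mf)).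
apply: filterS => x /= h Sx; have := h Sx => -[] /powR_eq0_eq0 /eqP.
by rewrite normr_eq0 => /eqP.
Qed.

(** Hoelder's inequality with the indicator of [S] as second factor, which yields the power of
    [mu S]. *)
Lemma jensen_power p S f : 1 < p -> measurable S -> (mu S < +oo)%E ->
  measurable_fun [set: T] f ->
  ((\int[mu]_(x in S) `|f x|%:E) `^ p <= mu S `^ (p - 1) * Ip p S f)%E.
Proof.
move=> p1 mS Sfin mf.
have p0 : 0 < p by apply: lt_trans p1.
pose q := (1 - p^-1)^-1.
have pV1 : p^-1 < 1 by rewrite invf_lt1.
have q0 : 0 < q by rewrite invr_gt0 subr_gt0.
have pq : p^-1 + q^-1 = 1 by rewrite invrK addrC subrK.
have mI : measurable_fun [set: T] (\1_S : T -> R) by exact: measurable_indic.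
have := hoelder mu (measurable_funM mf mI) mI p0 q0 pq.
have -> : ('N[mu]_1[EFin \o ((f \* \1_S) \* \1_S)%R] = \int[mu]_(x in S) `|f x|%:E)%E.
  rewrite Lnorm1 [RHS]integral_mkcond; apply: eq_integral => x _.
  rewrite /= patchE indicE; case: ifP => _; first by rewrite !mulr1.
  by rewrite !mulr0 normr0.
have -> : ('N[mu]_p%:E[EFin \o (f \* \1_S)%R] = Ip p S f `^ p^-1)%E.
  rewrite unlock /Ip [in RHS]integral_mkcond; congr (_ `^ _)%E; apply: eq_integral => x _.
  rewrite /= patchE indicE; case: ifP => _; first by rewrite mulr1.
  by rewrite mulr0 normr0 powR0// gt_eqF.
have -> : ('N[mu]_q%:E[EFin \o (\1_S : T -> R)] = mu S `^ q^-1)%E.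
  rewrite unlock; congr (_ `^ _)%E; rewrite -[RHS]mul1e -integral_cst//.
  rewrite [RHS]integral_mkcond; apply: eq_integral => x _.
  rewrite /= patchE indicE; case: ifP => _; first by rewrite normr1 powR1.
  by rewrite normr0 powR0// gt_eqF.
move=> H.
apply: (@le_trans _ _ ((Ip p S f `^ p^-1 * mu S `^ q^-1) `^ p)%E).
  apply: gt0_ler_poweR => //; rewrite ?in_itv/= ?leey ?andbT; first exact: ltW.
    by apply: integral_ge0 => x _; rewrite lee_fin.
  by rewrite mule_ge0 ?poweR_ge0.
rewrite poweRM ?poweR_ge0// -!poweRrM mulVf ?gt_eqF// poweRe1 ?Ip_ge0//.
rewrite muleC lee_wpmul2r ?Ip_ge0// (_ : q^-1 * p = p - 1)//.
by rewrite invrK mulrBl mul1r mulVf// gt_eqF.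
Qed.

End integral_power.
Arguments Ip {d T R} mu p S f.

Section tonelli.
Context {d1 d2 : measure_display} {T1 : measurableType d1} {T2 : measurableType d2}
  {R : realType}.
Variables (m1 : {sigma_finite_measure set T1 -> \bar R})
  (m2 : {sigma_finite_measure set T2 -> \bar R}).

(** Tonelli's theorem on the whole product, applied to the restriction of [F] to the rectangle. *)
Lemma tonelli_sets (A : set T1) (B : set T2) (F : T1 * T2 -> \bar R) :
  measurable A -> measurable B -> measurable_fun [set: T1 * T2] F ->
  (forall z, 0 <= F z)%E ->
  (\int[m1]_(x in A) \int[m2]_(y in B) F (x, y) =
   \int[m2]_(y in B) \int[m1]_(x in A) F (x, y))%E.
Proof.
move=> mA mB mF F0.
pose G z : \bar R := (F \_ (A `*` B)) z.
have mG : measurable_fun [set: T1 * T2] G.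
  apply/(measurable_restrictT _ _).1; first exact: measurableX.
  exact: measurable_funS mF.
have G0 z : (0 <= G z)%E by rewrite /G patchE; case: ifP.
have := @fubini_tonelli _ _ _ _ R m1 m2 G mG G0.
have -> : (\int[m1]_x \int[m2]_y G (x, y) = \int[m1]_(x in A) \int[m2]_(y in B) F (x, y))%E.
  rewrite [RHS]integral_mkcond; apply: eq_integral => x _; rewrite patchE.
  case: ifPn => xA.
    rewrite [RHS]integral_mkcond; apply: eq_integral => y _.
    by rewrite /G !patchE in_setX xA.
  by apply: integral0_eq => y _; rewrite /G patchE in_setX (negPf xA).
have -> : (\int[m2]_y \int[m1]_x G (x, y) = \int[m2]_(y in B) \int[m1]_(x in A) F (x, y))%E.
  rewrite [RHS]integral_mkcond; apply: eq_integral => y _; rewrite patchE.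
  case: ifPn => yB.
    rewrite [RHS]integral_mkcond; apply: eq_integral => x _.
    by rewrite /G !patchE in_setX yB andbT.
  by apply: integral0_eq => x _; rewrite /G patchE in_setX (negPf yB) andbF.
by [].
Qed.

Lemma measurable_inner_integral (B : set T2) (F : T1 * T2 -> \bar R) :
  measurable B -> measurable_fun [set: T1 * T2] F -> (forall z, 0 <= F z)%E ->
  measurable_fun [set: T1] (fun x => \int[m2]_(y in B) F (x, y))%E.
Proof.
move=> mB mF F0.
pose G z : \bar R := (F \_ ([set: T1] `*` B)) z.
have mG : measurable_fun [set: T1 * T2] G.
  apply/(measurable_restrictT _ _).1; first exact: measurableX.
  exact: measurable_funS mF.
have G0 z : (0 <= G z)%E by rewrite /G patchE; case: ifP.
have := @measurable_fun_fubini_tonelli_F _ _ _ _ R m2 G mG G0.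
apply: eq_measurable_fun => x _; rewrite /fubini_F [RHS]integral_mkcond.
apply: eq_integral => y _.
by rewrite /G !patchE in_setX in_setT.
Qed.

End tonelli.

Section integral_power_rV.
Context {R : realType} {n : nat}.
Local Notation V := 'rV[R]_n.
Local Notation mu := (@lebesgue_rV R n).
Implicit Types (S : set V) (f g w : V -> R) (p r : R) (x h : V).

Lemma measurable_comp_shift f h : measurable_fun [set: V] f ->
  measurable_fun [set: V] (fun x => f (x + h)).
Proof. by move=> mf; apply: measurableT_comp => //; exact: measurable_shift_rV. Qed.

Lemma preimage_shift_measurable h S : measurable S ->
  measurable ((fun x : V => x + h) @^-1` S).
Proof.
by move=> mS; rewrite -[X in measurable X]setTI; exact: measurable_shift_rV.
Qed.

Lemma Ip_shift p S f h : measurable S -> measurable_fun [set: V] f ->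
  Ip mu p S (fun x => f (x + h)) = Ip mu p ((fun x => x - h) @^-1` S) f.
Proof.
move=> mS mf; rewrite /Ip.
rewrite [RHS](ge0_integral_shift h)//.
- by congr (integral _ _ _); apply/seteqP; split=> x /=; rewrite /preimage/= addrK.
- exact: preimage_shift_measurable.
- exact: measurable_powR_norm.
Qed.

Lemma Ip_shiftT p f h : measurable_fun [set: V] f ->
  Ip mu p setT (fun x => f (x + h)) = Ip mu p setT f.
Proof. by move=> mf; rewrite Ip_shift// preimage_setT. Qed.

Lemma measurable_add_pair : measurable_fun [set: V * V] (fun z : V * V => z.1 + z.2).
Proof.
by apply: measurable_funD_rV; [exact: measurable_fst|exact: measurable_snd].
Qed.

Lemma measurable_diff_pair f : measurable_fun [set: V] f ->
  measurable_fun [set: V * V] (fun z : V * V => f (z.1 + z.2) - f z.1).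
Proof.
move=> mf; apply: measurable_funB.
  by apply: measurableT_comp => //; exact: measurable_add_pair.
by apply: measurableT_comp => //; exact: measurable_fst.
Qed.

End integral_power_rV.

(** * Averages over balls *)

Section averages.
Context {R : realType} {n : nat}.
Local Notation V := 'rV[R]_n.
Local Notation mu := (@lebesgue_rV R n).
Implicit Types (S : set V) (f g w : V -> R) (p r : R) (x h : V).

Lemma norm_le_1powR p (a : R) : 1 <= p -> `|a| <= 1 + `|a| `^ p.
Proof.
move=> p1; have [a1|a1] := leP `|a| 1; first by rewrite (le_trans a1)// lerDl powR_ge0.
by rewrite (le_trans (@le1r_powR _ _ _ (ltW a1) p1))// lerDr.
Qed.

(** On a set of finite measure, $|f| \le 1 + |f|^p$ suffices. *)
Lemma Ip_integrable p S f : 1 <= p -> measurable S -> (mu S < +oo)%E ->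
  measurable_fun [set: V] f -> (Ip mu p S f < +oo)%E -> mu.-integrable S (EFin \o f).
Proof.
move=> p1 mS Sfin mf If; apply/integrableP; split.
  by apply/measurable_EFinP; exact: measurable_funS mf.
apply: (@le_lt_trans _ _ (\int[mu]_(x in S) (1%:E + (`|f x| `^ p)%:E))%E).
  apply: ge0_le_integral => //.
  - by apply: measurableT_comp => //; apply/measurable_EFinP; exact: measurable_funS mf.
  - by apply: emeasurable_funD => //; exact: measurable_powR_norm.
  - by move=> x _; rewrite /= lee_fin norm_le_1powR.
rewrite ge0_integralD//; last exact: measurable_powR_norm.
by rewrite integral_cst// mul1e lte_add_pinfty.
Qed.

Lemma fine_eball_gt0 x r : 0 < r -> 0 < fine (mu (eball x r)).
Proof.
by move=> r0; rewrite fine_gt0// lebesgue_eball_gt0//= -ge0_fin_numE// lebesgue_eball_fin.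
Qed.

Lemma Ip_integrable_ball p x r f : 1 <= p -> measurable_fun [set: V] f ->
  (Ip mu p setT f < +oo)%E -> mu.-integrable (eball x r) (EFin \o f).
Proof.
move=> p1 mf If; apply: (Ip_integrable p1) => //.
- exact: measurable_eball.
- by rewrite -ge0_fin_numE// lebesgue_eball_fin.
- by apply: le_lt_trans If; apply: Ip_subset => //; exact: measurable_eball.
Qed.

Lemma ball_averageB f g x r : mu.-integrable (eball x r) (EFin \o f) ->
  mu.-integrable (eball x r) (EFin \o g) ->
  ball_average (f \- g)%R x r = ball_average f x r - ball_average g x r.
Proof.
move=> If Ig; rewrite /ball_average -mulrBr -RintegralB//.
exact: measurable_eball.
Qed.

Lemma ball_average_cst (c : R) x r : 0 < r -> ball_average (cst c : V -> R) x r = c.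
Proof.
move=> r0; rewrite /ball_average Rintegral_cst; last exact: measurable_eball.
by rewrite mulrC mulfK// gt_eqF// fine_eball_gt0.
Qed.

(** The $v^{p-1}$ of [jensen_power] and the $v^{-p}$ of the normalisation combine to $v^{-1}$, where
    $v$ is the volume of the ball. *)
Lemma ball_average_jensen p f x r : 1 < p -> 0 < r -> measurable_fun [set: V] f ->
  mu.-integrable (eball x r) (EFin \o f) ->
  ((`|ball_average f x r| `^ p)%:E <= (fine (mu (eball x r)))^-1%:E * Ip mu p (eball x r) f)%E.
Proof.
move=> p1 r0 mf If.
set B := eball x r; set v := fine (mu B).
have mB : measurable B by exact: measurable_eball.
have v0 : 0 < v by exact: fine_eball_gt0.
have Ev : mu B = v%:E by rewrite fineK// lebesgue_eball_fin.
have Bfin : (mu B < +oo)%E by rewrite Ev ltry.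
have p0 : 0 < p := lt_trans ltr01 p1.
have Iabs : (\int[mu]_(y in B) `|f y|%:E)%E \is a fin_num.
  rewrite ge0_fin_numE ?integral_ge0//.
  by have /integrableP[_] := If.
have H : ((\int[mu]_(y in B) `|f y|%:E) `^ p <= mu B `^ (p - 1) * Ip mu p B f)%E.
  exact: jensen_power.
set J := fine (\int[mu]_(y in B) `|f y|%:E)%E.
have J0 : 0 <= J by rewrite fine_ge0 ?integral_ge0.
have EJ : (\int[mu]_(y in B) `|f y|%:E = J%:E)%E by rewrite fineK.
have le1 : `|ball_average f x r| <= v^-1 * J.
  rewrite /ball_average normrM ger0_norm ?invr_ge0 ?(ltW v0)// ler_wpM2l ?invr_ge0 ?(ltW v0)//.
  exact: le_normr_Rintegral.
apply: (@le_trans _ _ ((v^-1 * J) `^ p)%:E).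
  by rewrite lee_fin ge0_ler_powR ?nnegrE ?mulr_ge0 ?invr_ge0 ?(ltW v0)// ltW.
rewrite powRM ?invr_ge0 ?(ltW v0)// EFinM.
move: H; rewrite EJ Ev !poweR_EFin => H.
apply: (@le_trans _ _ ((v^-1 `^ p)%:E * ((v `^ (p - 1))%:E * Ip mu p B f))%E).
  by apply: lee_wpmul2l => //; rewrite lee_fin powR_ge0.
rewrite muleA -EFinM; apply: lee_wpmul2r; first exact: Ip_ge0.
rewrite lee_fin powRB ?(gt_eqF v0)//; last by apply/implyP.
rewrite powRr1 ?(ltW v0)// -powR_inv1 ?(ltW v0)// -powRrM mulN1r.
rewrite mulrA -powRD ?(gt_eqF v0) ?implybT// addrC subrr powRr0 mul1r.
by rewrite powR_inv1// ltW.
Qed.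

Lemma integrable_cst_ball (b : R) x r : mu.-integrable (eball x r) (EFin \o (cst b : V -> R)).
Proof.
apply/integrableP; split; first by apply/measurable_EFinP; exact: measurable_cst.
rewrite (eq_integral (cst `|b|%:E))// integral_cst; last exact: measurable_eball.
by rewrite lte_mul_pinfty// -ge0_fin_numE// lebesgue_eball_fin.
Qed.

Lemma ball_average_sub_jensen p f c x r : 1 < p -> 0 < r -> measurable_fun [set: V] f ->
  mu.-integrable (eball x r) (EFin \o f) ->
  ((`|ball_average f x r - c| `^ p)%:E <=
   (fine (mu (eball x r)))^-1%:E * Ip mu p (eball x r) (f \- cst c)%R)%E.
Proof.
move=> p1 r0 mf If.
have Ic := integrable_cst_ball c x r.
have -> : ball_average f x r - c = ball_average (f \- cst c)%R x r.
  by rewrite ball_averageB// ball_average_cst.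
apply: ball_average_jensen => //.
  by apply: measurable_funB => //; exact: measurable_cst.
have := integrableB (measurable_eball x r) If Ic.
by under eq_fun do rewrite /= -EFinB.
Qed.

Lemma measurable_powR_diff_pair p f : measurable_fun [set: V] f ->
  measurable_fun [set: V * V] (fun z : V * V => (`|f (z.1 + z.2) - f z.1| `^ p)%:E).
Proof. by move=> /measurable_diff_pair/measurable_powR_norm; exact. Qed.

(* Stands in for the Poincare inequality: [G] plays the role of |grad w|^p, and [K] allows
   the segments from [x] to [x + h] to leave [S]. *)
Definition translation_bound p C K w (G : V -> R) :=
  [/\ measurable_fun [set: V] w, measurable_fun [set: V] G, forall x, 0 <= G x &
   forall S h r, measurable S -> 0 < r -> enorm h <= r ->
     (Ip mu p S (fun x => (w (x + h) - w x)%R) <=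
      (C * r `^ p)%:E * \int[mu]_(x in ethick S (K * r)) (G x)%:E)%E].

Lemma measurable_EFin_rV (S : set V) (G : V -> R) : measurable_fun [set: V] G ->
  measurable_fun S (EFin \o G).
Proof. by move=> mG; apply/measurable_EFinP; exact: measurable_funS mG. Qed.

Lemma ethick_eball x r s : ethick (eball x r) s `<=` eball x (r + s).
Proof.
move=> z [y xy yz]; rewrite /eball/=; apply: (le_lt_trans (enorm_triangle _ y _)).
by rewrite addrC; exact: ltrD.
Qed.

Definition diff_power p w (z : V * V) : \bar R := (`|w (z.1 + z.2) - w z.1| `^ p)%:E.

Lemma diff_power_ge0 p w z : (0 <= diff_power p w z)%E.
Proof. by rewrite lee_fin powR_ge0. Qed.

Lemma measurable_diff_power p w : measurable_fun [set: V] w ->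
  measurable_fun [set: V * V] (diff_power p w).
Proof. exact: measurable_powR_diff_pair. Qed.

Lemma measurable_diff_power_inner p w (B : set V) : measurable_fun [set: V] w ->
  measurable B ->
  measurable_fun [set: V] (fun a => \int[mu]_(h in B) diff_power p w (a, h))%E.
Proof.
move=> mw mB; apply: (measurable_inner_integral mu mB) => //; first exact: measurable_diff_power.
exact: diff_power_ge0.
Qed.

Lemma fine_eballV_ge0 x r : 0 < r -> (0 <= (fine (mu (eball x r)))^-1%:E)%E.
Proof. by move=> r0; rewrite lee_fin invr_ge0 ltW// fine_eball_gt0. Qed.

Lemma Ip_cst_shift p w (a : V) (S : set V) : measurable_fun [set: V] w -> measurable S ->
  Ip mu p S (w \- cst (w a))%R =
  (\int[mu]_(h in (fun z : V => (z + a)%R) @^-1` S) diff_power p w (a, h))%E.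
Proof.
move=> mw mS.
have mwc : measurable_fun [set: V] (w \- cst (w a)).
  by apply: measurable_funB => //; exact: measurable_cst.
have H := @ge0_integral_shift R n a (fun b => (`|w b - w a| `^ p)%:E) S mS.
rewrite [LHS]/Ip /= H; [|exact: (measurable_powR_norm _ mwc)|by []].
by apply: eq_integral => h _; rewrite /diff_power/= [h + a]addrC.
Qed.

(** Jensen's inequality gives the mean of $|w(b) - w(a)|^p$ over $b \in B(y,s)$; writing $b = a + h$
    and enlarging the range of $h$ to $B(0,\rho)$ makes the domain independent of $a$, as Tonelli's
    theorem will require. *)
Lemma value_sub_average_le p w a y s rho : 1 < p -> 0 < s ->
  measurable_fun [set: V] w -> mu.-integrable (eball y s) (EFin \o w) ->
  eball y s `<=` eball a rho ->
  ((`|w a - ball_average w y s| `^ p)%:E <=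
    (fine (mu (eball y s)))^-1%:E * \int[mu]_(h in eball 0 rho) diff_power p w (a, h))%E.
Proof.
move=> p1 s0 mw Iw ysa.
rewrite -normrN opprB; apply: (le_trans (ball_average_sub_jensen (w a) p1 s0 mw Iw)).
apply: lee_wpmul2l; first exact: fine_eballV_ge0.
rewrite Ip_cst_shift//; last exact: measurable_eball.
apply: ge0_subset_integral.
- exact: (preimage_shift_measurable _ (measurable_eball _ _)).
- exact: measurable_eball.
- have mFa : measurable_fun [set: V] (fun h => diff_power p w (a, h)).
    by apply: measurableT_comp; [exact: measurable_diff_power|exact: pair1_measurable].
  exact: measurable_funS mFa.
- by move=> h _; exact: diff_power_ge0.
- by move=> h /ysa; rewrite /eball/= addrK subr0.
Qed.

Lemma average_sub_average_le p w x y r s rho : 1 < p -> 0 < r -> 0 < s ->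
  measurable_fun [set: V] w -> (forall z t, mu.-integrable (eball z t) (EFin \o w)) ->
  (forall a, eball x r a -> eball y s `<=` eball a rho) ->
  ((`|ball_average w x r - ball_average w y s| `^ p)%:E <=
    (fine (mu (eball x r)))^-1%:E * ((fine (mu (eball y s)))^-1%:E *
    \int[mu]_(a in eball x r) \int[mu]_(h in eball 0 rho) diff_power p w (a, h)))%E.
Proof.
move=> p1 r0 s0 mw Iw ysa.
have mBx : measurable (eball x r) by exact: measurable_eball.
have mI := measurable_diff_power_inner p mw (measurable_eball 0 rho).
apply: (le_trans (ball_average_sub_jensen (ball_average w y s) p1 r0 mw (Iw x r))).
apply: lee_wpmul2l; first exact: fine_eballV_ge0.
rewrite -ge0_integralZl; first last.
- exact: fine_eballV_ge0.
- by move=> a _; apply: integral_ge0 => h _; exact: diff_power_ge0.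
- exact: measurable_funS mI.
- exact: mBx.
apply: ge0_le_integral.
- exact: mBx.
- by move=> a _; rewrite lee_fin powR_ge0.
- by apply: measurable_powR_norm; apply: measurable_funB => //; exact: measurable_cst.
- by apply: measurable_funeM; exact: measurable_funS mI.
- by move=> a xa; apply: value_sub_average_le => //; exact: ysa.
Qed.

(** Tonelli's theorem exchanges base point and increment, and [translation_bound] applies to each
    fixed increment. *)
Lemma integral_diff_power_le p C K w G (A : set V) rho : 0 < rho -> measurable A ->
  translation_bound p C K w G ->
  (\int[mu]_(a in A) \int[mu]_(h in eball 0 rho) diff_power p w (a, h) <=
    mu (eball 0 rho : set V) *
    ((C * rho `^ p)%:E * \int[mu]_(z in ethick A (K * rho)) (G z)%:E))%E.
Proof.
move=> rho0 mA [mw mG G0 T].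
have mB := measurable_eball (0 : V) rho.
rewrite (tonelli_sets mu mu)//; [|exact: measurable_diff_power|exact: diff_power_ge0].
rewrite muleC -integral_cst//.
have mF' : measurable_fun [set: V * V] (diff_power p w \o (fun z : V * V => (z.2, z.1))).
  by apply: measurableT_comp; [exact: measurable_diff_power|exact: measurable_fun_pair].
have mI : measurable_fun [set: V] (fun h => \int[mu]_(a in A) diff_power p w (a, h))%E.
  have := measurable_inner_integral mu mA mF'; apply.
  by move=> z; exact: diff_power_ge0.
apply: ge0_le_integral.
- exact: mB.
- by move=> h _; apply: integral_ge0 => a _; exact: diff_power_ge0.
- exact: measurable_funS mI.
- exact: measurable_cst.
- move=> h; rewrite /eball/= subr0 => hh.
  exact: (T A h rho mA rho0 (ltW hh)).
Qed.

(** One [ball_lower] for the volume of each of the two balls; $16^n = 2^n 8^n$, where $2^n$ pays for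
    $s \ge r/2$ and $(8r)^n$ bounds the volume of $B(0,4r)$; $4^p$ comes from increments of length
    up to $4r$. *)
Definition average_const p C : R :=
  C * 16 ^+ n * 4 `^ p / (@ball_lower R n) ^+ 2.

(** The difference $|w(a) - w(b)|^p$ is averaged over both balls. The radius [(1 + 4 * K) * r] is
    that of the first ball plus [K] times the largest increment [4 * r]. *)
Lemma average_comparison p C K w G x y r s : 1 < p -> 0 < r -> 0 <= C -> 0 <= K ->
  translation_bound p C K w G -> (Ip mu p setT w < +oo)%E ->
  r / 2 <= s <= r -> enorm (x - y) <= 2 * r ->
  ((`|ball_average w x r - ball_average w y s| `^ p)%:E <=
   (average_const p C * (r `^ p / r ^+ n))%:E *
     \int[mu]_(z in eball x ((1 + 4 * K) * r)) (G z)%:E)%E.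
Proof.
move=> p1 r0 C0 K0 T Iw /andP[rs sr] xy.
have [mw mG G0 _] := T.
have s0 : 0 < s by apply: lt_le_trans rs; rewrite divr_gt0.
have Iwb z t : mu.-integrable (eball z t) (EFin \o w).
  by apply: (@Ip_integrable_ball p) => //; exact: ltW.
(* The increment is less than $r + 2r + s \le 4r$. *)
have sub a : eball x r a -> eball y s `<=` eball a (4 * r).
  move=> xa; apply: sub_eball.
  have := enorm_triangle y x a; move: xa; rewrite /eball/= (enormB a x) (enormB y x).
  by move: sr xy; lra.
apply: (le_trans (average_sub_average_le p1 r0 s0 mw Iwb sub)).
have r40 : 0 < 4 * r by rewrite mulr_gt0.
have L3 := integral_diff_power_le r40 (measurable_eball x r) T.
set J := (\int[mu]_(z in eball x ((1 + 4 * K) * r)) (G z)%:E)%E.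
have J0 : (0 <= J)%E by apply: integral_ge0 => z _; rewrite lee_fin.
have LJ : (\int[mu]_(z in ethick (eball x r) (K * (4 * r))) (G z)%:E <= J)%E.
  apply: ge0_subset_integral.
  - exact: measurable_ethick.
  - exact: measurable_eball.
  - exact: measurable_EFin_rV.
  - by move=> z _; rewrite lee_fin.
  - apply: (subset_trans (@ethick_eball _ _ _)); apply: le_eball.
    by rewrite (_ : r + K * (4 * r) = (1 + 4 * K) * r)//; ring.
set c := @ball_lower R n.
have c0 : 0 < c := ball_lower_gt0.
have vV z t : 0 < t -> (fine (mu (eball z t)))^-1 <= (c * t ^+ n)^-1.
  move=> t0; rewrite lef_pV2 ?posrE ?fine_eball_gt0 ?mulr_gt0 ?exprn_gt0//.
  by rewrite -lee_fin fineK ?lebesgue_eball_fin// lebesgue_eball_ge.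
have M : (mu (eball 0 (4 * r) : set V) <= ((8 * r) ^+ n)%:E)%E.
  apply: (le_trans (lebesgue_eball_le _ (ltW r40))).
  by rewrite mulrA -natrM.
have P4 : 0 <= C * (4 * r) `^ p by rewrite mulr_ge0 ?powR_ge0.
apply: (@le_trans _ _ ((c * r ^+ n)^-1%:E * ((c * s ^+ n)^-1%:E *
  (((8 * r) ^+ n)%:E * ((C * (4 * r) `^ p)%:E * J))))%E).
  apply: lee_pmul.
  - exact: fine_eballV_ge0.
  - apply: mule_ge0; first exact: fine_eballV_ge0.
    by apply: integral_ge0 => a _; apply: integral_ge0 => h _; exact: diff_power_ge0.
  - by rewrite lee_fin vV.
  apply: lee_pmul.
  - exact: fine_eballV_ge0.
  - by apply: integral_ge0 => a _; apply: integral_ge0 => h _; exact: diff_power_ge0.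
  - by rewrite lee_fin vV.
  apply: (le_trans L3); apply: lee_pmul => //.
  - apply: mule_ge0; first by rewrite lee_fin.
    by apply: integral_ge0 => z _; rewrite lee_fin.
  - by apply: lee_wpmul2l; rewrite ?lee_fin.
rewrite !muleA -!EFinM; apply: lee_wpmul2r => //; rewrite lee_fin /average_const -/c.
have sn : (c * s ^+ n)^-1 <= 2 ^+ n / (c * r ^+ n).
  rewrite !invfM mulrCA ler_wpM2l ?invr_ge0 ?(ltW c0)//.
  rewrite ler_pdivlMr ?exprn_gt0// ler_pdivrMl ?exprn_gt0// -exprMn.
  rewrite lerXn2r ?nnegrE ?mulr_ge0 ?(ltW r0) ?(ltW s0)//.
  by rewrite -ler_pdivrMr.
have rn0 : 0 < r ^+ n by rewrite exprn_gt0.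
apply: (@le_trans _ _ ((c * r ^+ n)^-1 * (2 ^+ n / (c * r ^+ n)) * (8 * r) ^+ n *
  (C * (4 * r) `^ p))).
  rewrite ler_wpM2r// ler_wpM2r ?exprn_ge0 ?mulr_ge0 ?(ltW r0)// ler_wpM2l//.
  by rewrite invr_ge0 mulr_ge0 ?(ltW c0) ?(ltW rn0).
rewrite powRM ?(ltW r0)// exprMn (_ : 16 ^+ n = 2 ^+ n * 8 ^+ n); last first.
  by rewrite -exprMn -natrM.
set A2 := 2 ^+ n; set A8 := 8 ^+ n; set P := 4 `^ p; set Q := r `^ p; set X := r ^+ n in rn0 *.
rewrite le_eqVlt; apply/orP; left; apply/eqP; field.
by rewrite (gt_eqF c0) (gt_eqF rn0).
Qed.

End averages.

Section geometric.
Context {R : realType}.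

Lemma geometric_sum_le (q : R) m : 0 <= q < 1 -> \sum_(0 <= i < m) q ^+ i <= (1 - q)^-1.
Proof.
move=> /andP[q0 q1]; have q10 : 0 < 1 - q by rewrite subr_gt0.
rewrite -[leRHS]mul1r ler_pdivlMr//.
suff -> : (\sum_(0 <= i < m) q ^+ i) * (1 - q) = 1 - q ^+ m.
  by rewrite gerBl exprn_ge0.
elim: m => [|m IH]; first by rewrite big_geq// mul0r expr0 subrr.
by rewrite big_nat_recr//= mulrDl IH exprS; ring.
Qed.

Lemma nneseries_geometric_le (c q : R) : 0 <= c -> 0 <= q < 1 ->
  (\sum_(0 <= i <oo) (c * q ^+ i)%:E <= (c / (1 - q))%:E)%E.
Proof.
move=> c0 q01; have /andP[q0 _] := q01.
apply: lime_le.
  by apply: is_cvg_nneseries => i _ _; rewrite lee_fin mulr_ge0 ?exprn_ge0.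
apply: nearW => m; rewrite sumEFin lee_fin -mulr_sumr ler_wpM2l//.
exact: geometric_sum_le.
Qed.

(** The least [m] with $r_0 2^{-m-1} \le r$; its minimality gives the upper bound on [r]. *)
Lemma dyadic_interval (r0 r : R) : 0 < r -> r <= r0 ->
  exists m, r0 / 2 ^+ m / 2 <= r <= r0 / 2 ^+ m.
Proof.
move=> r_gt0 rr0.
have r00 : 0 < r0 := lt_le_trans r_gt0 rr0.
pose P m := r0 / 2 ^+ m.+1 <= r.
have exP : exists m, P m.
  pose N := Num.bound (r0 / r).
  exists N; rewrite /P ler_pdivrMr ?exprn_gt0// mulrC -ler_pdivrMr//.
  apply: (@le_trans _ _ N%:R); first by apply/ltW/archi_boundP; rewrite divr_ge0 ?ltW.
  by rewrite -natrX ler_nat ltnW// ltnW// ltn_expl.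
case: (ex_minnP exP) => m Pm minm; exists m.
rewrite -mulrA -invfM -exprSr -/(P m) Pm/=.
case: m Pm minm => [|m] Pm minm; first by rewrite expr0 divr1.
by rewrite leNgt; apply/negP => /ltW h; have := minm m h; rewrite ltnn.
Qed.

Lemma powR_half_exp (a : R) (r0 : R) m : 0 <= r0 ->
  (r0 / 2 ^+ m) `^ a = r0 `^ a * ((2^-1) `^ a) ^+ m.
Proof.
move=> r00; rewrite powRM ?invr_ge0 ?exprn_ge0//; congr (_ * _).
by rewrite -exprVn -powR_mulrn ?invr_ge0// -powRrM mulrC powRrM powR_mulrn// powR_ge0.
Qed.

Lemma powRK (p x : R) : 0 < p -> 0 <= x -> (x `^ p) `^ p^-1 = x.
Proof. by move=> p0 x0; rewrite -powRrM divff ?gt_eqF// powRr1. Qed.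

Lemma half_powR_lt1 (a : R) : 0 < a -> 0 <= (2^-1 : R) `^ a < 1.
Proof.
move=> a0; rewrite powR_ge0/=.
have e1 : 1 = (1 : R) `^ a by rewrite powR1.
by rewrite [X in _ < X]e1 gt0_ltr_powR ?nnegrE ?invr_ge0// invf_lt1 ?ltr1n.
Qed.

End geometric.

(** * Averages along dyadic radii *)

Section chain.
Context {R : realType} {n : nat}.
Local Notation V := 'rV[R]_n.
Local Notation mu := (@lebesgue_rV R n).
Variables (p C K : R) (w G : V -> R).
Hypotheses (p1 : 1 < p) (C0 : 0 <= C) (K0 : 0 <= K).
Hypotheses (T : translation_bound p C K w G) (Iw : (Ip mu p setT w < +oo)%E).

Let L := 1 + 4 * K.
Let C1 := @average_const R n p C.

Let C1_ge0 : 0 <= C1.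
Proof.
rewrite /C1 /average_const divr_ge0 ?exprn_ge0 ?(ltW ball_lower_gt0)//.
by rewrite !mulr_ge0 ?exprn_ge0 ?powR_ge0.
Qed.

(** The energy hypothesis is normalised so that the factor $r^p / r^n$ of [average_comparison]
    cancels and a difference of order $r^a$ remains. *)
Lemma average_step y r s (t a : R) : 0 < r -> 0 <= t -> r / 2 <= s <= r ->
  (\int[mu]_(z in eball y (L * r)) (G z)%:E <= (t * (r ^+ n / r `^ p * (r `^ a) `^ p))%:E)%E ->
  `|ball_average w y r - ball_average w y s| <= (C1 * t) `^ p^-1 * r `^ a.
Proof.
move=> r0 t0 rs H.
have p0 : 0 < p := lt_trans ltr01 p1.
have yy : enorm (y - y) <= 2 * r by rewrite subrr enorm0 mulr_ge0// ltW.
have := average_comparison p1 r0 C0 K0 T Iw rs yy.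
rewrite -/C1 -/L => A.
have B : `|ball_average w y r - ball_average w y s| `^ p <= C1 * t * (r `^ a) `^ p.
  rewrite -lee_fin; apply: (le_trans A).
  have c0 : (0 <= (C1 * (r `^ p / r ^+ n))%:E)%E.
    rewrite lee_fin; apply: mulr_ge0 => //.
    by apply: divr_ge0; [exact: powR_ge0|exact/exprn_ge0/ltW].
  apply: (le_trans (lee_wpmul2l c0 H)); rewrite -EFinM lee_fin.
  have rp0 : r `^ p != 0 by rewrite gt_eqF// powR_gt0.
  have rn0 : r ^+ n != 0 by rewrite gt_eqF// exprn_gt0.
  set X := (r `^ a) `^ p; set Y := r `^ p in rp0 *; set Z := r ^+ n in rn0 *.
  rewrite le_eqVlt; apply/orP; left; apply/eqP; field.
  by rewrite rp0.
have -> : (C1 * t) `^ p^-1 * r `^ a = (C1 * t * (r `^ a) `^ p) `^ p^-1.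
  rewrite (powRM _ (mulr_ge0 C1_ge0 t0)) ?powR_ge0//.
  by rewrite (powRK p0 (powR_ge0 r a)).
have -> : `|ball_average w y r - ball_average w y s| =
    (`|ball_average w y r - ball_average w y s| `^ p) `^ p^-1.
  by rewrite powRK.
have m0 : 0 <= C1 * t * (r `^ a) `^ p.
  by apply: mulr_ge0; [exact: mulr_ge0|exact: powR_ge0].
by apply: ge0_ler_powR => //; rewrite ?invr_ge0 ?nnegrE ?powR_ge0// ltW.
Qed.

(** Telescoping over the radii $r_0 2^{-i}$ gives a geometric series of ratio $2^{-a}$. The last
    step goes from a dyadic radius down to [r] itself, as [average_step] accepts any radius within a
    factor 2. *)
Lemma average_chain y r0 (t a : R) : 0 < r0 -> 0 <= t -> 0 < a ->
  (forall i, let r := r0 / 2 ^+ i in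
   (\int[mu]_(z in eball y (L * r)) (G z)%:E <= (t * (r ^+ n / r `^ p * (r `^ a) `^ p))%:E)%E) ->
  forall r, 0 < r <= r0 -> `|ball_average w y r0 - ball_average w y r| <=
    (C1 * t) `^ p^-1 * r0 `^ a / (1 - 2^-1 `^ a).
Proof.
move=> r00 t0 a0 H r /andP[rp rr0].
pose rr i := r0 / 2 ^+ i.
have rr0' i : 0 < rr i by rewrite divr_gt0 ?exprn_gt0.
pose c := (C1 * t) `^ p^-1 * r0 `^ a.
have c0 : 0 <= c by rewrite mulr_ge0 ?powR_ge0.
pose q : R := 2^-1 `^ a.
have q01 : 0 <= q < 1 by exact: half_powR_lt1.
have step i s : rr i / 2 <= s <= rr i ->
    `|ball_average w y (rr i) - ball_average w y s| <= c * q ^+ i.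
  move=> hs; have := average_step (rr0' i) t0 hs (H i).
  by rewrite /rr powR_half_exp ?(ltW r00)// mulrA.
have tele m : `|ball_average w y r0 - ball_average w y (rr m)| <=
    c * \sum_(0 <= i < m) q ^+ i.
  elim: m => [|m IH]; first by rewrite /rr expr0 divr1 subrr normr0 big_geq// mulr0.
  rewrite big_nat_recr//= mulrDr (le_trans _ (lerD IH (step m (rr m.+1) _)))//.
    rewrite (_ : _ - _ = (ball_average w y r0 - ball_average w y (rr m)) +
      (ball_average w y (rr m) - ball_average w y (rr m.+1))) ?ler_normD//.
    by rewrite addrA subrK.
  rewrite /rr exprSr invfM mulrA lexx/= ler_pdivrMr// ler_pMr ?ler1n//.
  exact: rr0'.
have [m hm] := dyadic_interval rp rr0.
apply: (@le_trans _ _ (c * \sum_(0 <= i < m.+1) q ^+ i)); last first.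
  by rewrite ler_wpM2l// geometric_sum_le.
rewrite big_nat_recr//= mulrDr (le_trans _ (lerD (tele m) (step m r hm)))//.
rewrite (_ : _ - _ = (ball_average w y r0 - ball_average w y (rr m)) +
    (ball_average w y (rr m) - ball_average w y r)) ?ler_normD//.
by rewrite addrA subrK.
Qed.

End chain.

(** * Coverings and exceptional sets *)

Section covering.
Context {R : realType} {n : nat}.
Local Notation V := 'rV[R]_n.
Local Notation mu := (@lebesgue_rV R n).

Lemma lee_sum_size (I : eqType) (F : seq I) (f : I -> \bar R) (t : R) :
  (forall y, y \in F -> (t%:E <= f y)%E) -> (((size F)%:R * t)%:E <= \sum_(y <- F) f y)%E.
Proof.
elim: F => [|y F IH] H; first by rewrite big_nil mul0r.
rewrite big_cons /= mulrS mulrDl mul1r EFinD; apply: leeD.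
  by apply: H; rewrite mem_head.
by apply: IH => z zF; apply: H; rewrite in_cons zF orbT.
Qed.

(* Single-scale Vitali covering: a maximal family of disjoint balls of radius
   [s] centred in [E] is finite since each ball carries mass at least [t]. *)
Lemma single_scale_vitali (G : V -> R) (E U : set V) (s t M : R) :
  0 < s -> 0 < t -> measurable U -> measurable_fun [set: V] G -> (forall x, 0 <= G x) ->
  (forall y, E y -> eball y s `<=` U) ->
  (forall y, E y -> (t%:E <= \int[mu]_(z in eball y s) (G z)%:E)%E) ->
  (\int[mu]_(z in U) (G z)%:E <= M%:E)%E ->
  exists F : seq V, [/\ forall y, y \in F -> E y, (size F)%:R * t <= M &
    E `<=` \bigcup_(y in [set` F]) eball y (2 * s)].
Proof.
move=> s0 t0 mU mG G0 EU Et UM.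
pose sep (F : seq V) := [/\ forall y, y \in F -> E y, uniq F &
  forall y z, y \in F -> z \in F -> y != z -> 2 * s <= enorm (y - z)].
have card F : sep F -> (size F)%:R * t <= M.
  move=> [FE uF dF]; rewrite -lee_fin; apply: le_trans UM.
  have triv : trivIset [set` F] (fun y => eball y s).
    move=> y z /= yF zF [v [yv zv]]; apply/eqP/negPn/negP => yz.
    have := dF _ _ yF zF yz; have := enorm_triangle y v z.
    by move: yv zv; rewrite /eball/= (enormB v y); lra.
  have mB (y : V) : measurable (eball y s) by exact: measurable_eball.
  have E1 : (\int[mu]_(z in \big[setU/set0]_(y <- F) eball y s) (G z)%:E =
     \sum_(y <- F) \int[mu]_(z in eball y s) (G z)%:E)%E.
    apply: (@ge0_integral_bigsetU _ _ _ mu _ (fun y : V => eball y s) (EFin \o G) F mB uF triv).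
    - exact: measurable_EFin_rV.
    - by move=> z _; rewrite lee_fin.
  apply: (@le_trans _ _ (\int[mu]_(z in \big[setU/set0]_(y <- F) eball y s) (G z)%:E)%E).
    by rewrite E1; apply: lee_sum_size => y /FE/Et.
  apply: ge0_subset_integral.
  - by apply: bigsetU_measurable => y _; exact: mB.
  - exact: mU.
  - exact: measurable_EFin_rV.
  - by move=> z _; rewrite lee_fin.
  - rewrite -bigcup_seq => z [y /= yF]; apply: EU; exact: FE.
pose P k := `[< exists F, sep F /\ size F = k >].
have exP : exists k, P k by exists 0; apply/asboolP; exists [::].
have bP k : P k -> (k <= Num.bound (M / t))%N.
  move=> /asboolP[F [sF <-]].
  rewrite -(ler_nat R) (le_trans _ (ltW (archi_boundP _)))//.
    by rewrite ler_pdivlMr//; exact: card.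
  by rewrite divr_ge0 ?(ltW t0)// (le_trans _ (card F sF))// mulr_ge0// ltW.
case: (ex_maxnP exP bP) => k /asboolP[F [sF Fk]] maxk.
exists F; have [FE uF dF] := sF; split=> //; first exact: card.
move=> x Ex; apply: contrapT => nx.
have far y : y \in F -> 2 * s <= enorm (x - y).
  by move=> yF; rewrite leNgt; apply/negP => h; apply: nx; exists y.
have xF : x \notin F.
  apply/negP => /far; rewrite subrr enorm0 leNgt => /negP; apply.
  by rewrite mulr_gt0.
have : P k.+1.
  apply/asboolP; exists (x :: F); split; last by rewrite /= Fk.
  split=> [y||y z]; rewrite ?inE /= ?xF//.
    by move=> /orP[/eqP ->|/FE].
  move=> /orP[/eqP ->|yF] /orP[/eqP ->|zF]; rewrite ?eqxx// => yz.
  - exact: far.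
  - by rewrite enormB; exact: far.
  - exact: dF.
by move=> /maxk; rewrite ltnn.
Qed.

End covering.

Section hausdorff_cover.
Context {R : realType} {n : nat}.
Local Notation V := 'rV[R]_n.
Local Notation mu := (@lebesgue_rV R n).
Variables (H : {outer_measure set V -> \bar R}) (D : set V) (c d rho1 : R).
Hypotheses (c0 : 0 <= c)
  (HD : forall y r, D y -> 0 < r <= rho1 -> (H (eball y r `&` D) <= (c * r `^ d)%:E)%E).

Lemma outer_measure_finite_cover (A : set V) (F : seq V) (r b : R) : 0 <= b ->
  (forall y, y \in F -> (H (eball y r `&` D) <= b%:E)%E) ->
  A `<=` D -> A `<=` \bigcup_(y in [set` F]) eball y r ->
  (H A <= ((size F)%:R * b)%:E)%E.
Proof.
move=> b0; elim: F A => [|y F IH] A HF AD AF.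
  have -> : A = set0 by apply/seteqP; split=> // x /AF[].
  by rewrite outer_measure0 lee_fin mul0r.
have AU : A `<=` (eball y r `&` D) `|` (A `&` \bigcup_(y in [set` F]) eball y r).
  move=> x Ax; have [z /=] := AF x Ax; rewrite in_cons => /orP[/eqP ->|zF] xz.
    by left; split=> //; exact: AD.
  by right; split=> //; exists z.
apply: (le_trans (le_outer_measure _ _ _ AU)); apply: (le_trans (outer_measureU2 _ _ _)).
rewrite /= mulrS mulrDl mul1r EFinD; apply: leeD; first by apply: HF; rewrite mem_head.
apply: IH.
- by move=> z zF; apply: HF; rewrite in_cons zF orbT.
- by move=> x [/AD].
- by move=> x [].
Qed.

(** At the scale $r_i = r_0 2^{-i}$ the covering lemma gives at most $M / (t r_i^{d-\kappa})$ balls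
    of radius $2 L r_i$, each of measure at most $c (2 L r_i)^d$. Their total is of order
    $r_i^\kappa$, which is summable over $i$. The outer measure [H] stays abstract because it is a
    content [hausdorff_pre] in [large_average_null] and the Hausdorff measure in
    [zero_trace_point]. *)
Lemma exceptional_set_small (G : V -> R) (A U : set V) (r0 L t kappa M : R) :
  0 < r0 -> 1 <= L -> 2 * L * r0 <= rho1 -> 0 < t -> 0 < kappa -> 0 <= d ->
  measurable U -> measurable_fun [set: V] G -> (forall x, 0 <= G x) ->
  A `<=` D -> (forall y, A y -> eball y (L * r0) `<=` U) ->
  (\int[mu]_(z in U) (G z)%:E <= M%:E)%E ->
  (H [set y | A y /\ exists i : nat, let r := (r0 / 2 ^+ i)%R in
      ((t * r `^ (d - kappa))%:E <= \int[mu]_(z in eball y (L * r)) (G z)%:E)%E] <=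
   (c * (2 * L) `^ d * r0 `^ kappa / (1 - 2^-1 `^ kappa) * (M / t))%:E)%E.
Proof.
move=> r00 L1 Lr0 t0 k0 d0 mU mG G0 AD AU UM.
have L0 : 0 < L := lt_le_trans ltr01 L1.
have M0 : 0 <= M.
  by rewrite -lee_fin; apply: le_trans UM; apply: integral_ge0 => z _; rewrite lee_fin.
pose r i := r0 / 2 ^+ i.
have rp i : 0 < r i by rewrite divr_gt0 ?exprn_gt0.
have rr0 i : r i <= r0.
  by rewrite /r ler_pdivrMr ?exprn_gt0// ler_peMr ?(ltW r00)// exprn_ege1// ler1n.
pose E i := [set y | A y /\
  ((t * r i `^ (d - kappa))%:E <= \int[mu]_(z in eball y (L * r i)) (G z)%:E)%E].
pose q : R := 2^-1 `^ kappa.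
pose cc := c * (2 * L) `^ d * r0 `^ kappa * (M / t).
have cc0 : 0 <= cc.
  by rewrite /cc; do 3 (apply: mulr_ge0; rewrite ?powR_ge0 ?divr_ge0 ?(ltW t0)//).
have HE i : (H (E i) <= (cc * q ^+ i)%:E)%E.
  have ti : 0 < t * r i `^ (d - kappa) by rewrite mulr_gt0// powR_gt0.
  have Lri : 0 < L * r i by rewrite mulr_gt0.
  have EU y : E i y -> eball y (L * r i) `<=` U.
    move=> [Ay _]; apply: subset_trans (AU y Ay); apply: le_eball.
    by rewrite ler_wpM2l// ltW.
  have Et y : E i y ->
      ((t * r i `^ (d - kappa))%:E <= \int[mu]_(z in eball y (L * r i)) (G z)%:E)%E.
    by case.
  have [F [FE Fs EF]] := single_scale_vitali Lri ti mU mG G0 EU Et UM.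
  have b0 : 0 <= c * (2 * (L * r i)) `^ d by rewrite mulr_ge0// powR_ge0.
  have := @outer_measure_finite_cover (E i) F (2 * (L * r i)) _ b0.
  move=> /(_ _ _ EF) HEF; apply: (le_trans (HEF _ _)).
  - move=> y yF; apply: HD; first by apply: AD; case: (FE _ yF).
    rewrite mulr_gt0//= (le_trans _ Lr0)// -mulrA ler_wpM2l// ler_wpM2l//.
    exact: ltW.
  - by move=> y [/AD].
  rewrite lee_fin.
  have sF : (size F)%:R <= M / (t * r i `^ (d - kappa)) by rewrite ler_pdivlMr.
  apply: (le_trans (ler_wpM2r b0 sF)).
  rewrite mulrA powRM ?mulr_ge0 ?(ltW L0) ?(ltW (rp i))//.
  have -> : cc * q ^+ i = c * (2 * L) `^ d * r i `^ kappa * (M / t).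
    by rewrite /cc /q /r powR_half_exp ?(ltW r00)//; ring.
  rewrite powRB; last by apply/implyP => _; rewrite gt_eqF.
  have X0 : r i `^ d != 0 by rewrite gt_eqF// powR_gt0.
  have Y0 : r i `^ kappa != 0 by rewrite gt_eqF// powR_gt0.
  move: X0 Y0; set X := r i `^ d; set Y := r i `^ kappa; set P := (2 * L) `^ d => X0 Y0.
  have tn : t != 0 by rewrite gt_eqF.
  rewrite le_eqVlt; apply/orP; left; apply/eqP; field.
    by rewrite tn X0 Y0.
  exact: ltW.
apply: (@le_trans _ _ (H (\bigcup_i E i))).
  apply: le_outer_measure => y [Ay [i yi]]; exists i => //.
apply: (le_trans (outer_measure_sigma_subadditive H E)).
apply: (@le_trans _ _ (\sum_(0 <= i <oo) (cc * q ^+ i)%:E)%E).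
  by apply: lee_nneseries => // i _; exact: outer_measure_ge0.
apply: (le_trans (nneseries_geometric_le cc0 (half_powR_lt1 k0))).
by rewrite lee_fin /cc -/q; set X := (1 - q)^-1; rewrite le_eqVlt; apply/orP; left; apply/eqP; ring.
Qed.

End hausdorff_cover.

(** * Hausdorff measure *)

Section double_series.
Context {R : realType}.

(** A bijection from $\mathbb{N}$ onto $\mathbb{N}^2$, used to merge countably many covers into one
    sequence. *)
Lemma nneseries_pairing : exists f : nat -> nat * nat,
  (forall ij, exists m, f m = ij) /\
  forall a : nat -> nat -> \bar R, (forall i j, (0 <= a i j)%E) ->
  (\sum_(0 <= m <oo) a (f m).1 (f m).2 = \sum_(0 <= i <oo) \sum_(0 <= j <oo) a i j)%E.
Proof.
have /card_esym/ppcard_eqP[f] := card_nat2.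
exists f; split=> [ij|a a0].
  exists (f^-1%FUN ij); exact: (invK (mem_set I)).
rewrite nneseries_esumT//.
rewrite -(@reindex_esum R nat (nat * nat)%type setT setT f (fun k => a k.1 k.2))//.
rewrite (_ : [set: nat * nat] = [set: nat] `*`` (fun=> [set: nat])); last first.
  by apply/seteqP; split=> -[i j].
rewrite -(@esum_esum R nat nat setT (fun=> setT) a)//.
rewrite nneseries_esumT; last by move=> i; exact: nneseries_ge0.
by apply: eq_esum => i _; rewrite nneseries_esumT.
Qed.

End double_series.

Section hausdorff_outer.
Context {R : realType} {n : nat}.
Local Notation V := 'rV[R]_n.
Local Notation mu := (@lebesgue_rV R n).
Implicit Types (A D : set V) (d delta : R).

Lemma ediam_ge0 A : (0 <= ediam A)%E.
Proof. by apply: ereal_sup_ubound; left. Qed.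

Lemma ediam0 : ediam (set0 : set V) = 0%E.
Proof.
apply/eqP; rewrite eq_le ediam_ge0 andbT; apply: ge_ereal_sup.
by move=> z [-> //|[x [y []]]].
Qed.

Lemma le_ediam A x y : A x -> A y -> ((enorm (x - y))%:E <= ediam A)%E.
Proof. by move=> Ax Ay; apply: ereal_sup_ubound; right; exists x, y. Qed.

Lemma ediam_eball x r A : 0 <= r -> (ediam (eball x r `&` A) <= (2 * r)%:E)%E.
Proof.
move=> r0; apply: ge_ereal_sup => _ [->|[y [z [[xy _] [xz _] ->]]]].
  by rewrite lee_fin mulr_ge0.
rewrite lee_fin; have := enorm_triangle y x z; move: xy xz.
by rewrite /eball/= (enormB x z); lra.
Qed.

Lemma hausdorff_pre_ge0 d delta A : (0 <= hausdorff_pre d delta A)%E.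
Proof.
apply: le_ereal_inf_tmp => _ [U _ <-].
by apply: nneseries_ge0 => i _ _; exact: poweR_ge0.
Qed.

Lemma hausdorff_pre0 d delta : 0 < d -> 0 <= delta -> hausdorff_pre d delta (set0 : set V) = 0%E.
Proof.
move=> d0 dl0; apply/eqP; rewrite eq_le hausdorff_pre_ge0 andbT.
apply: ereal_inf_lbound; exists (fun=> set0).
  by split=> // i; rewrite ediam0 lee_fin.
by apply: eseries0 => i _ _; rewrite ediam0 poweR0r// gt_eqF.
Qed.

Lemma le_hausdorff_pre d delta A B : A `<=` B ->
  (hausdorff_pre d delta A <= hausdorff_pre d delta B)%E.
Proof.
move=> AB; apply: le_ereal_inf_tmp => _ [U [BU Ud] <-].
by apply: ereal_inf_lbound; exists U => //; split=> //; exact: subset_trans BU.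
Qed.

(** Near-optimal covers of the [A i], with errors $e / 2^{i+1}$, are merged into a single cover.
    They exist once all terms are finite; an infinite term makes the inequality trivial. *)
Lemma hausdorff_pre_subadditive d delta : sigma_subadditive (@hausdorff_pre R n d delta).
Proof.
move=> A; have [[i ioo]|] := pselect (exists i, hausdorff_pre d delta (A i) = +oo%E).
  rewrite (eseries_pinfty _ _ ioo) ?leey// => m _.
  by rewrite -ltNye (lt_le_trans _ (hausdorff_pre_ge0 _ _ _)).
rewrite -forallNE => Aoo.
apply/lee_addgt0Pr => e e0.
rewrite (le_trans _ (epsilon_trick _ _ _))//; last 2 first.
- by move=> m; exact: hausdorff_pre_ge0.
- exact: ltW.
pose P i (U : nat -> set V) := [/\ A i `<=` \bigcup_j U j,
  forall j, (ediam (U j) <= delta%:E)%E &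
  (\sum_(0 <= j <oo) poweR (ediam (U j)) d <=
    hausdorff_pre d delta (A i) + (e / (2 ^ i.+1)%:R)%:E)%E].
have /choice[U HU] : forall i, exists U, P i U.
  move=> i.
  have fi : hausdorff_pre d delta (A i) \is a fin_num.
    rewrite ge0_fin_numE ?hausdorff_pre_ge0// lt_neqAle leey andbT.
    by apply/eqP; exact: Aoo.
  have ei : 0 < e / (2 ^ i.+1)%:R by rewrite divr_gt0.
  have [_ [U [AU Ud] <-] lt] := lb_ereal_inf_adherent ei fi.
  by exists U; split => //; exact: ltW.
have [f [surjf sumf]] := @nneseries_pairing R.
apply: (@le_trans _ _ (\sum_(0 <= i <oo) \sum_(0 <= j <oo) poweR (ediam (U i j)) d)%E).
  rewrite -sumf; last by move=> i j; exact: poweR_ge0.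
  apply: ereal_inf_lbound; exists (fun m => U (f m).1 (f m).2) => //; split.
    move=> x [i _ Aix]; have [AU _ _] := HU i; have [j _ Ux] := AU _ Aix.
    by have [m fm] := surjf (i, j); exists m => //; rewrite fm.
  by move=> m; have [_ + _] := HU (f m).1; exact.
apply: lee_nneseries => i _; last by have [_ _] := HU i.
by move=> _; apply: nneseries_ge0 => j _ _; exact: poweR_ge0.
Qed.

Definition hausdorff_pre_outer d delta (d0 : 0 < d) (dl0 : 0 <= delta) :
    {outer_measure set V -> \bar R} :=
  HB.pack (@hausdorff_pre R n d delta) (isOuterMeasure.Build R V _
    (hausdorff_pre0 d0 dl0) (hausdorff_pre_ge0 d delta) (@le_hausdorff_pre d delta)
    (@hausdorff_pre_subadditive d delta)).

Lemma hausdorff_pre_le d delta A : 0 < delta ->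
  (hausdorff_pre d delta A <= hausdorff d A)%E.
Proof. by move=> dl0; apply: ereal_sup_ubound; exists delta. Qed.

Lemma hausdorff_ge0 d A : (0 <= hausdorff d A)%E.
Proof. by apply: le_trans (hausdorff_pre_ge0 d 1 A) _; exact: hausdorff_pre_le. Qed.

Lemma hausdorff0 d : 0 < d -> hausdorff d (set0 : set V) = 0%E.
Proof.
move=> d0; apply/eqP; rewrite eq_le hausdorff_ge0 andbT; apply: ge_ereal_sup.
by move=> _ [delta dl0 <-]; rewrite hausdorff_pre0// ltW.
Qed.

Lemma le_hausdorff d A B : A `<=` B -> (hausdorff d A <= hausdorff d B)%E.
Proof.
move=> AB; apply: ge_ereal_sup => _ [delta dl0 <-].
by apply: le_trans (le_hausdorff_pre _ _ AB) _; exact: hausdorff_pre_le.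
Qed.

Lemma hausdorff_subadditive d : sigma_subadditive (@hausdorff R n d).
Proof.
move=> A; apply: ge_ereal_sup => _ [delta dl0 <-].
apply: (le_trans (@hausdorff_pre_subadditive d delta A)).
apply: lee_nneseries => i _; first by move=> _; exact: hausdorff_pre_ge0.
exact: hausdorff_pre_le.
Qed.

Definition hausdorff_outer d (d0 : 0 < d) : {outer_measure set V -> \bar R} :=
  HB.pack (@hausdorff R n d) (isOuterMeasure.Build R V _
    (hausdorff0 d0) (hausdorff_ge0 d) (@le_hausdorff d) (@hausdorff_subadditive d)).

Lemma hausdorff_pre_eball d delta D x r : 0 < d -> 0 <= r -> 2 * r <= delta ->
  (hausdorff_pre d delta (eball x r `&` D) <= ((2 * r) `^ d)%:E)%E.
Proof.
move=> d0 r0 rd.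
pose U (i : nat) : set V := if i == 0%N then eball x r `&` D else set0.
apply: (@le_trans _ _ (\sum_(0 <= i <oo) poweR (ediam (U i)) d)%E).
  apply: ereal_inf_lbound; exists U => //.
  split=> [y xy|[|i]]; rewrite /U/=; first by exists 0%N.
    by apply: (le_trans (ediam_eball _ _ r0)); rewrite lee_fin.
  by rewrite ediam0 lee_fin (le_trans _ rd)// mulr_ge0.
rewrite (nneseries_split _ 1); last by move=> i _; exact: poweR_ge0.
rewrite [X in (_ + X)%E]eseries0 ?adde0; last first.
  by move=> [|i]// _ _; rewrite /U/= ediam0 poweR0r// gt_eqF.
rewrite add0n big_nat1 -poweR_EFin gt0_ler_poweR ?(ltW d0)//.
- by rewrite in_itv/= leey ediam_ge0.
- by rewrite in_itv/= leey lee_fin mulr_ge0.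
- exact: ediam_eball.
Qed.

(** A set of diameter [r] lies in the closed ball of radius [r] about any of its points; the open
    ball would fail, for instance when [r] is 0. *)
Definition cball (x : V) (r : R) : set V := [set y | enorm (y - x) <= r].

Lemma closed_cball x r : closed (cball x r).
Proof.
rewrite -[cball x r]setCK closedC; apply/open_enormP => y /negP.
rewrite -ltNge => ry; exists (enorm (y - x) - r); first by rewrite subr_gt0.
move=> z yz /=; apply/negP; rewrite -ltNge.
have := enorm_triangle y z x; move: yz; rewrite /eball/= (enormB z y); lra.
Qed.

Lemma lebesgue_cball_le x r : (0 < n)%N -> 0 <= r ->
  (mu (cball x r) <= ((4 * r) ^+ n)%:E)%E.
Proof.
move=> n0 r0.
have mC : measurable (cball x r) by apply: closed_measurable_rV; exact: closed_cball.
have sub s : r < s -> (mu (cball x r) <= ((2 * s) ^+ n)%:E)%E.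
  move=> rs; apply: (le_trans _ (lebesgue_eball_le x _)); last first.
    exact: (le_trans r0 (ltW rs)).
  apply: le_measure; rewrite ?inE//; first exact: measurable_eball.
  by move=> y; rewrite /cball/eball/= => /le_lt_trans; apply.
have [r1|r1] := ltP 0 r.
  by have := sub (2 * r); rewrite mulrA -natrM; apply; lra.
(* A single point is enclosed in open balls of small radius, whose volume tends to 0 in positive
   dimension. *)
have -> : r = 0 by apply/eqP; rewrite eq_le r0 r1.
rewrite mulr0 expr0n (gtn_eqF n0) /=.
apply/lee_addgt0Pr => e e0; rewrite add0e.
pose s := Num.min e 1.
have s0 : 0 < s by rewrite lt_min e0 ltr01.
have s1 : s <= 1 by rewrite ge_min lexx orbT.
have := sub (s / 2); rewrite (_ : r = 0); last by apply/eqP; rewrite eq_le r0 r1.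
rewrite divr_gt0// => /(_ isT) h; apply: (le_trans h).
rewrite mulrC divfK// lee_fin.
apply: (@le_trans _ _ s); last by rewrite ge_min lexx.
by rewrite -[leRHS]expr1 ler_wiXn2l// ltW.
Qed.

(* A set of diameter r <= delta has volume at most 4^n delta^(n - d) r^d. *)
Lemma hausdorff_finite_null d A : (0 < n)%N -> 0 < d < n%:R -> measurable A ->
  (hausdorff d A < +oo)%E -> mu A = 0%E.
Proof.
move=> n0 /andP[d0 dn] mA Hfin.
have hf : hausdorff d A \is a fin_num by rewrite ge0_fin_numE ?hausdorff_ge0.
set M := fine (hausdorff d A).
have M0 : 0 <= M by rewrite fine_ge0 ?hausdorff_ge0.
have H delta : 0 < delta ->
    (mu A <= (4 ^+ n * delta `^ (n%:R - d) * (M + 1))%:E)%E.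
  move=> dl0.
  have pf : hausdorff_pre d delta A \is a fin_num.
    rewrite ge0_fin_numE ?hausdorff_pre_ge0//.
    exact: le_lt_trans (hausdorff_pre_le _ _ dl0) Hfin.
  have [_ [U [AU Ud] <-] lt] := lb_ereal_inf_adherent ltr01 pf.
  have {}lt : (\sum_(0 <= i <oo) poweR (ediam (U i)) d <= (M + 1)%:E)%E.
    apply: (le_trans (ltW lt)); rewrite EFinD; apply: leeD => //.
    by rewrite fineK//; exact: hausdorff_pre_le.
  have fU i : ediam (U i) \is a fin_num.
    by rewrite ge0_fin_numE ?ediam_ge0// (le_lt_trans (Ud i))// ltry.
  pose r i := fine (ediam (U i)).
  have r0 i : 0 <= r i by rewrite fine_ge0 ?ediam_ge0.
  have rd i : r i <= delta by rewrite -lee_fin fineK.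
  have /choice[x Hx] : forall i, exists x, U i `<=` cball x (r i).
    move=> i; have [->|/set0P[x Ux]] := eqVneq (U i) set0; first by exists 0.
    by exists x => y Uy; rewrite /cball/= -lee_fin fineK//; exact: le_ediam.
  have mC i : measurable (cball (x i) (r i)).
    by apply: closed_measurable_rV; exact: closed_cball.
  have AC : A `<=` \bigcup_i cball (x i) (r i).
    by move=> y /AU[i _ /Hx yi]; exists i.
  apply: (@le_trans _ _ (\sum_(0 <= i <oo) mu (cball (x i) (r i)))%E).
    exact: (measure_sigma_subadditive _ mC mA AC).
  apply: (@le_trans _ _ (\sum_(0 <= i <oo)
      (4 ^+ n * delta `^ (n%:R - d))%:E * poweR (ediam (U i)) d)%E); last first.
    rewrite nneseriesZl; last by move=> i _; exact: poweR_ge0.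
    rewrite [leRHS]EFinM; apply: lee_wpmul2l => //.
    by rewrite lee_fin mulr_ge0 ?exprn_ge0 ?powR_ge0.
  apply: lee_nneseries => // i _.
  apply: (le_trans (lebesgue_cball_le _ n0 (r0 i))).
  rewrite -[ediam _]fineK// poweR_EFin -EFinM lee_fin exprMn -mulrA ler_wpM2l ?exprn_ge0//.
  rewrite -/(r i) -powR_mulrn//.
  have [->|ri0] := eqVneq (r i) 0.
    rewrite powR0 ?mulr_ge0 ?powR_ge0// pnatr_eq0 -lt0n//.
  have -> : (r i) `^ n%:R = (r i) `^ (n%:R - d) * (r i) `^ d.
    by rewrite -powRD ?subrK// ri0 implybT.
  rewrite ler_wpM2r ?powR_ge0// ge0_ler_powR ?nnegrE ?subr_ge0 ?(ltW dn) ?(ltW dl0)//.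
apply/eqP; rewrite eq_le measure_ge0 andbT.
apply/lee_addgt0Pr => e e0; rewrite add0e.
pose c := 4 ^+ n * (M + 1) : R.
have c0 : 0 < c by rewrite mulr_gt0 ?exprn_gt0// ltr_pwDr.
(* The solution of $c\,\delta^{n-d} = e$. *)
pose delta := (e / c) `^ (n%:R - d)^-1.
have dl0 : 0 < delta by apply: powR_gt0; rewrite divr_gt0.
apply: (le_trans (H delta dl0)); rewrite lee_fin.
have -> : delta `^ (n%:R - d) = e / c.
  rewrite /delta -powRrM mulVf ?powRr1 ?divr_ge0 ?(ltW e0) ?(ltW c0)//.
  by rewrite gt_eqF// subr_gt0.
by rewrite mulrAC -/c mulrC divfK// gt_eqF.
Qed.

(** The covering lemma with density 1: volume limits the number of disjoint balls of radius $r/2$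
    centred in a bounded piece of [D], so finitely many balls of radius [r] cover that piece. *)
Lemma ahlfors_finite (D : set V) d c r N : 0 < d -> 0 < r -> 0 <= c ->
  (forall x, D x -> (hausdorff d (eball x r `&` D) <= c%:E)%E) ->
  (hausdorff d (D `&` eball 0 N) < +oo)%E.
Proof.
move=> d0 r0 c0 HD.
have r20 : 0 < r / 2 by rewrite divr_gt0.
pose t := @ball_lower R n * (r / 2) ^+ n.
have t0 : 0 < t by rewrite mulr_gt0 ?ball_lower_gt0 ?exprn_gt0.
pose M := fine (mu (eball (0 : V) (N + r))).
have intE (S : set V) : measurable S -> (\int[mu]_(z in S) (cst 1 z : R)%:E = mu S)%E.
  by move=> mS; rewrite (eq_integral (cst 1%:E))// integral_cst// mul1e.
have EU y : (D `&` eball 0 N) y -> eball y (r / 2) `<=` eball 0 (N + r).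
  by move=> [_]; rewrite /eball/= subr0 => y0; apply: sub_eball; rewrite subr0; lra.
have Et y : (D `&` eball 0 N) y -> (t%:E <= \int[mu]_(z in eball y (r / 2)) (cst 1 z : R)%:E)%E.
  move=> _; rewrite intE; last exact: measurable_eball.
  exact: lebesgue_eball_ge.
have EM : (\int[mu]_(z in eball (0 : V) (N + r)) (cst 1 z : R)%:E <= M%:E)%E.
  rewrite intE; last exact: measurable_eball.
  by rewrite /M fineK// lebesgue_eball_fin.
have [F [FE Fs EF]] := single_scale_vitali r20 t0 (measurable_eball _ _)
  (measurable_cst _) (fun _ => ler01) EU Et EM.
rewrite mulrC divfK// in EF.
apply: le_lt_trans (ltry ((size F)%:R * c)).
apply: (@outer_measure_finite_cover _ _ (hausdorff_outer d0) D _ F r) => //.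
by move=> y yF; apply: HD; case: (FE _ yF).
Qed.

(** Bounded pieces of [D] have finite measure in a dimension $d < n$, hence volume 0, and countably
    many of them exhaust [D]. *)
Lemma ahlfors_null (D : set V) d c r : (0 < n)%N -> 0 < d < n%:R -> 0 < r -> 0 <= c ->
  closed D -> (forall x, D x -> (hausdorff d (eball x r `&` D) <= c%:E)%E) -> mu D = 0%E.
Proof.
move=> n0 dn r0 c0 cD HD; have /andP[d0 _] := dn.
have mD : measurable D by exact: closed_measurable_rV.
have mDN (N : nat) : measurable (D `&` eball 0 N%:R).
  by apply: measurableI => //; exact: measurable_eball.
apply/eqP; rewrite eq_le measure_ge0 andbT.
have DU : D `<=` \bigcup_N (D `&` eball 0 N%:R).
  move=> x Dx; exists (Num.bound (enorm x)) => //; split=> //.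
  by rewrite /eball/= subr0; exact: (archi_boundP (enorm_ge0 x)).
apply: (le_trans (measure_sigma_subadditive _ mDN mD DU)).
rewrite eseries0// => N _ _; apply: (hausdorff_finite_null n0 dn) => //.
exact: (ahlfors_finite _ d0 r0 c0 HD).
Qed.

End hausdorff_outer.

(** * Traces on regular sets and the Hardy inequality *)

Section trace.
Context {R : realType} {n : nat}.
Local Notation V := 'rV[R]_n.
Local Notation mu := (@lebesgue_rV R n).
Variables (p C K d : R) (D : set V).
Hypotheses (p1 : 1 < p) (C0 : 0 <= C) (K0 : 0 <= K) (d0 : 0 < d) (pd : n%:R - d < p).

Let L := 1 + 4 * K.
Let C1 := @average_const R n p C.
(* Half of the exponent 1 - (n - d) / p for which averages could be Hoelder continuous; the
   other half, [kappa], makes the coverings of exceptional sets summable over the scales. *)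
Let a := (p - (n%:R - d)) / (2 * p).
Let kappa := p * a.

Let p0 : 0 < p. Proof. exact: lt_trans p1. Qed.
Let L1 : 1 <= L. Proof. by rewrite lerDl mulr_ge0. Qed.
Let L0 : 0 < L. Proof. exact: lt_le_trans L1. Qed.
Let a0 : 0 < a. Proof. by rewrite divr_gt0 ?subr_gt0// mulr_gt0. Qed.
Let kappa0 : 0 < kappa. Proof. exact: mulr_gt0. Qed.
Let C1_ge0 : 0 <= C1.
Proof.
rewrite /C1 /average_const divr_ge0 ?exprn_ge0 ?(ltW ball_lower_gt0)//.
by rewrite !mulr_ge0 ?exprn_ge0 ?powR_ge0.
Qed.

Let kappaE : d - kappa = n%:R - p + kappa.
Proof.
have p2 : p != 0 by rewrite gt_eqF.
have : 2 * kappa = p - (n%:R - d) by rewrite /kappa /a; field.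
by lra.
Qed.

(** Where the two halves of the exponent meet: the energy decay that [average_chain] asks for is the
    power of [r] that [exceptional_set_small] counts. *)
Let thresholdE (r : R) : 0 < r -> r ^+ n / r `^ p * (r `^ a) `^ p = r `^ (d - kappa).
Proof.
move=> r0; have rn0 := gt_eqF r0.
rewrite kappaE -powRrM (mulrC a) -/kappa powRD ?rn0 ?implybT//.
by rewrite powRB ?rn0 ?implybT// powR_mulrn// ltW.
Qed.

(** Outside this set the energy hypothesis of [average_chain] holds at all dyadic scales at once. *)
Definition exceptional (G : V -> R) (A : set V) (r0 t : R) : set V :=
  [set y | A y /\ exists i : nat, let r := (r0 / 2 ^+ i)%R in
     ((t * r `^ (d - kappa))%:E <= \int[mu]_(z in eball y (L * r)) (G z)%:E)%E].

Let C2 := C1 `^ p^-1 / (1 - 2^-1 `^ a).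

Let C2_ge0 : 0 <= C2.
Proof.
have /andP[_ q1] := half_powR_lt1 a0.
by rewrite divr_ge0 ?powR_ge0// subr_ge0 ltW.
Qed.

Lemma average_outside_exceptional w G (A : set V) r0 t y : 0 < r0 -> 0 < t ->
  translation_bound p C K w G -> (Ip mu p setT w < +oo)%E -> A y ->
  ~ exceptional G A r0 t y ->
  forall r, 0 < r <= r0 -> `|ball_average w y r0 - ball_average w y r| <=
    C2 * t `^ p^-1 * r0 `^ a.
Proof.
move=> r00 t0 T Iw Ay nE r hr.
have H i : let r := r0 / 2 ^+ i in (\int[mu]_(z in eball y (L * r)) (G z)%:E <=
    (t * (r ^+ n / r `^ p * (r `^ a) `^ p))%:E)%E.
  move=> /=; rewrite leNgt; apply/negP => h; apply: nE; split=> //; exists i => /=.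
  by rewrite -thresholdE ?ltW// divr_gt0 ?exprn_gt0.
have := average_chain p1 C0 K0 T Iw r00 (ltW t0) a0 H hr.
rewrite -/C1 (powRM _ C1_ge0 (ltW t0)) => h; apply: (le_trans h).
rewrite /C2; set X := (1 - _)^-1; set Y := C1 `^ _; set Z := t `^ _; set W := r0 `^ _.
by rewrite le_eqVlt; apply/orP; left; apply/eqP; ring.
Qed.

Definition large_average_set (w : V -> R) (lambda : R) : set V :=
  [set y | D y /\ ~ \forall r \near 0^'+, `|ball_average w y r| <= lambda].

(* The content [hausdorff_pre d delta] of a ball of small radius r is at most (2 r)^d whatever
   [D] is: no regularity is needed. *)
Lemma large_average_null w (lambda delta : R) : 0 < lambda -> 0 < delta ->
  (forall e, 0 < e -> exists v G, [/\ translation_bound p C K v G,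
     (Ip mu p setT v <= e%:E)%E, (\int[mu]_z (G z)%:E <= e%:E)%E &
     forall y, D y -> \forall r \near 0^'+, ball_average w y r = ball_average v y r]) ->
  hausdorff_pre d delta (large_average_set w lambda) = 0%E.
Proof.
move=> l0 dl0 approx.
pose H := @hausdorff_pre_outer R n d delta d0 (ltW dl0).
pose rho1 := delta / 2.
have rho10 : 0 < rho1 by rewrite divr_gt0.
have HD y r : D y -> 0 < r <= rho1 -> (H (eball y r `&` D) <= (2 `^ d * r `^ d)%:E)%E.
  move=> _ /andP[r0 rr]; rewrite -powRM// ?(ltW r0)//.
  by apply: hausdorff_pre_eball => //; rewrite ?(ltW r0)// mulrC -ler_pdivlMr.
pose r0 := rho1 / (2 * L).
have r00 : 0 < r0 by rewrite divr_gt0// mulr_gt0.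
have Lr0 : 2 * L * r0 <= rho1 by rewrite mulrC divfK// gt_eqF// mulr_gt0.
(* Chosen so that for $t = b^p$ the whole dyadic chain contributes at most [lambda / 2]; [C2 + 1]
   avoids a division by 0. *)
pose b := lambda / 2 / (C2 + 1) / r0 `^ a.
have b0 : 0 < b.
  by rewrite divr_gt0 ?powR_gt0// divr_gt0 ?divr_gt0// ltr_pwDr.
pose t := b `^ p.
have t0 : 0 < t by exact: powR_gt0.
have tb : C2 * t `^ p^-1 * r0 `^ a <= lambda / 2.
  rewrite /t powRK ?(ltW b0)// /b.
  have ra0 : r0 `^ a != 0 by rewrite gt_eqF// powR_gt0.
  have C20 : C2 + 1 != 0 by rewrite gt_eqF// ltr_pwDr.
  rewrite mulrA divfK// mulrA ler_pdivrMr ?ltr_pwDr// mulrC ler_wpM2l ?lerDl//.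
  by rewrite divr_ge0// ltW.
(* By Jensen's inequality, a ball of radius [r0] with average above [lambda / 2] carries at least
   this much of $\int |v|^p$. *)
pose ts := (lambda / 2) `^ p * (@ball_lower R n * r0 ^+ n).
have ts0 : 0 < ts.
  by rewrite mulr_gt0 ?powR_gt0 ?divr_gt0// mulr_gt0 ?ball_lower_gt0 ?exprn_gt0.
pose c1 := (2 `^ d * (2 * r0) `^ d) / ts.
pose c2 := 2 `^ d * (2 * L) `^ d * r0 `^ kappa / (1 - 2^-1 `^ kappa) / t.
have c10 : 0 <= c1 by rewrite divr_ge0 ?(ltW ts0)// mulr_ge0 ?powR_ge0.
have c20 : 0 <= c2.
  have /andP[_ q1] := half_powR_lt1 kappa0.
  rewrite divr_ge0 ?(ltW t0)// divr_ge0 ?subr_ge0 ?(ltW q1)//.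
  by rewrite mulr_ge0 ?powR_ge0// mulr_ge0 ?powR_ge0.
have two0 : 0 <= 2 `^ d :> R by exact: powR_ge0.
(* None of [r0], [t], [c1], [c2] depends on [e], so letting [e] tend to 0 gives content 0. A large
   average at small radii forces either a large average at the fixed radius [r0] or an exceptional
   point. *)
have bound e : 0 < e -> (H (large_average_set w lambda) <= ((c1 + c2) * e)%:E)%E.
  move=> e0; have [v [G [T Iv IG loc]]] := approx e e0.
  have [mv mG G0 _] := T.
  have Ivf : (Ip mu p setT v < +oo)%E by apply: le_lt_trans Iv (ltry _).
  have Ivb z s : mu.-integrable (eball z s) (EFin \o v).
    by apply: (@Ip_integrable_ball _ _ p) => //; exact: ltW.
  pose S := [set y | D y /\ lambda / 2 < `|ball_average v y r0|].
  have sub : large_average_set w lambda `<=` S `|` exceptional G D r0 t.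
    move=> y [Dy ny]; apply: contrapT => /not_orP[nS nE]; apply: ny.
    have hS : `|ball_average v y r0| <= lambda / 2.
      by rewrite leNgt; apply/negP => h; apply: nS.
    have near1 := loc y Dy.
    near=> r.
    have -> : ball_average w y r = ball_average v y r by near: r.
    have hr : 0 < r <= r0.
      apply/andP; split; first by near: r; exact: nbhs_right_gt.
      by near: r; exact: nbhs_right_le.
    have := average_outside_exceptional r00 t0 T Ivf Dy nE hr.
    move=> /le_trans/(_ tb) h.
    have := ler_normB (ball_average v y r0) (ball_average v y r0 - ball_average v y r).
    by rewrite subKr; lra.
  apply: (le_trans (le_outer_measure H _ _ sub)).
  apply: (le_trans (outer_measureU2 H _ _)).
  rewrite mulrDl EFinD; apply: leeD; last first.
    have := @exceptional_set_small R n H D _ d rho1 two0 HD G D setT r0 L t kappa e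
      r00 L1 Lr0 t0 kappa0 (ltW d0) measurableT mG G0 (@subset_refl _ _)
      (fun _ _ => @subsetT _ _) IG.
    move=> /le_trans; apply; rewrite lee_fin /c2.
    set X := (1 - _)^-1; set Y := _ * _ * X.
    by rewrite le_eqVlt; apply/orP; left; apply/eqP; ring.
  have mvp : measurable_fun [set: V] (fun z => `|v z| `^ p).
    by apply/measurable_EFinP; exact: measurable_powR_norm.
  have St y : S y -> (ts%:E <= \int[mu]_(z in eball y r0) (`|v z| `^ p)%:E)%E.
    move=> [Dy hS].
    have := ball_average_jensen p1 r00 mv (Ivb y r0).
    set vv := fine _; set I := (\int[mu]_(z in _) _)%E => J.
    have vv0 : 0 < vv by exact: fine_eball_gt0.
    have hJ : (((lambda / 2) `^ p)%:E <= vv^-1%:E * I)%E.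
      apply: le_trans J; rewrite lee_fin ge0_ler_powR ?nnegrE ?(ltW p0) ?(ltW hS)//.
      by rewrite divr_ge0// ltW.
    apply: (@le_trans _ _ (vv%:E * ((lambda / 2) `^ p)%:E)%E).
      rewrite -EFinM lee_fin /ts mulrC ler_wpM2r ?powR_ge0//.
      by rewrite -lee_fin /vv fineK ?lebesgue_eball_fin// lebesgue_eball_ge.
    have vvE : (0 <= vv%:E)%E by rewrite lee_fin ltW.
    apply: (le_trans (lee_wpmul2l vvE hJ)).
    by rewrite muleA -EFinM divff ?gt_eqF// mul1e.
  have [F [FS Fs SF]] := single_scale_vitali r00 ts0 measurableT mvp
    (fun z => powR_ge0 _ _) (fun _ _ => @subsetT _ _) St Iv.
  have := @outer_measure_finite_cover R n H D S F (2 * r0) (2 `^ d * (2 * r0) `^ d).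
  move=> /(_ _ _ _ SF) h; apply: (le_trans (h _ _ _)).
  - by rewrite mulr_ge0 ?powR_ge0.
  - move=> y yF; apply: HD; first by case: (FS _ yF).
    rewrite mulr_gt0//= (le_trans _ Lr0)// ler_wpM2r ?(ltW r00)//.
    by rewrite ler_peMr.
  - by move=> y [].
  rewrite lee_fin /c1 mulrAC ler_pdivlMr// mulrAC mulrC ler_wpM2l//.
  by rewrite mulr_ge0 ?powR_ge0.
apply/eqP; rewrite eq_le hausdorff_pre_ge0 andbT.
apply/lee_addgt0Pr => e e0; rewrite add0e.
have c120 : 0 < c1 + c2 + 1 by rewrite ltr_pwDr// addr_ge0.
have e10 : 0 < e / (c1 + c2 + 1) by rewrite divr_gt0.
apply: (le_trans (bound _ e10)); rewrite lee_fin mulrCA mulrC -[leRHS]mul1r ler_wpM2r ?(ltW e0)//.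
by rewrite ler_pdivrMr// mul1r lerDl.
Unshelve. all: by end_near. Qed.

(** Failure to converge to 0 is witnessed by some threshold $1/(m+1)$, and for each threshold all
    the contents [hausdorff_pre] vanish. *)
Lemma trace_null w :
  (forall e, 0 < e -> exists v G, [/\ translation_bound p C K v G,
     (Ip mu p setT v <= e%:E)%E, (\int[mu]_z (G z)%:E <= e%:E)%E &
     forall y, D y -> \forall r \near 0^'+, ball_average w y r = ball_average v y r]) ->
  hausdorff d [set y | D y /\ ~ (ball_average w y r @[r --> 0^'+] --> (0 : R))] = 0%E.
Proof.
move=> approx.
have H (lambda : R) : 0 < lambda -> hausdorff d (large_average_set w lambda) = 0%E.
  move=> l0; apply/eqP; rewrite eq_le hausdorff_ge0 andbT; apply: ge_ereal_sup.
  by move=> _ [delta dl0 <-]; rewrite large_average_null.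
have sub : [set y | D y /\ ~ (ball_average w y r @[r --> 0^'+] --> (0 : R))] `<=`
    \bigcup_m large_average_set w m.+1%:R^-1.
  move=> y [Dy ny]; apply: contrapT => nl; apply: ny.
  apply/cvgr0Pnorm_le => e e0.
  have [m me] : exists m, m.+1%:R^-1 <= e :> R.
    exists (Num.bound e^-1); rewrite invf_ple ?posrE//.
    by rewrite (le_trans (ltW (archi_boundP _)))// ?invr_ge0 ?(ltW e0)// ler_nat.
  have [h|h] := pselect (\forall r \near 0^'+, `|ball_average w y r| <= m.+1%:R^-1).
    by near=> r; apply: le_trans me; near: r.
  by exfalso; apply: nl; exists m.
apply/eqP; rewrite eq_le hausdorff_ge0 andbT.
apply: (le_trans (le_hausdorff _ sub)).
apply: (le_trans (@hausdorff_subadditive R n d (fun m => large_average_set w m.+1%:R^-1))).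
by rewrite eseries0// => m _ _; exact: H.
Unshelve. all: by end_near. Qed.

(** * Zero traces and the Hardy inequality *)

Section zero_trace.
Variables (c c' rho1 : R) (w G : V -> R).
Hypotheses (c0 : 0 < c) (c'0 : 0 < c')
  (HD : forall y r, D y -> 0 < r <= rho1 ->
    (hausdorff d (eball y r `&` D) <= (c * r `^ d)%:E)%E)
  (HL : forall y r, D y -> 0 < r <= rho1 ->
    ((c' * r `^ d)%:E <= hausdorff d (eball y r `&` D))%E)
  (T : translation_bound p C K w G) (Iw : (Ip mu p setT w < +oo)%E)
  (IG : (\int[mu]_z (G z)%:E < +oo)%E)
  (w0 : hausdorff d [set y | D y /\ ~ (ball_average w y r @[r --> 0^'+] --> (0 : R))] = 0%E).

(* Chosen so that, in [zero_trace_point], the exceptional points have at most half of the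
   measure that lower regularity gives to [D] in the ball. *)
Let C6 := 2 * (c * (2 * L) `^ d) / ((1 - 2^-1 `^ kappa) * c').
Let C3 := C2 `^ p * C6.

Let q1 : 0 < 1 - 2^-1 `^ kappa :> R.
Proof. by have /andP[_ h] := half_powR_lt1 kappa0; rewrite subr_gt0. Qed.

Let C6_gt0 : 0 < C6.
Proof.
apply: divr_gt0; last exact: mulr_gt0.
apply: mulr_gt0 => //; apply: mulr_gt0 => //; apply: powR_gt0; exact: mulr_gt0.
Qed.

(** Lower regularity leaves in $B(x, r_0) \cap D$ a point that is neither exceptional nor of nonzero
    trace. There the average at radius [r0] differs from its limit 0 by the chain bound, whose
    $p$-th power is proportional to [t] and hence to [M]. *)
Lemma zero_trace_point x r0 M : D x -> 0 < r0 -> 2 * L * r0 <= rho1 -> 0 < M ->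
  (\int[mu]_(z in eball x ((1 + L) * r0)) (G z)%:E <= M%:E)%E ->
  exists y, [/\ D y, enorm (y - x) < r0 &
    `|ball_average w y r0| `^ p <= C3 * (M * (r0 `^ p / r0 ^+ n))].
Proof.
move=> Dx r00 Lr0 M0 GM.
have [mw mG G0 _] := T.
pose A := eball x r0 `&` D.
pose H := @hausdorff_outer R n d d0.
pose t := C6 * (r0 `^ kappa / r0 `^ d) * M.
have rk : 0 < r0 `^ kappa by exact: powR_gt0.
have rd : 0 < r0 `^ d by exact: powR_gt0.
have t0 : 0 < t by rewrite mulr_gt0// mulr_gt0// divr_gt0.
have r0rho : r0 <= rho1.
  apply: le_trans Lr0; rewrite ler_peMl ?(ltW r00)//.
  by rewrite (le_trans L1)// ler_peMl ?(ltW L0)// ler1n.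
have [y [Ay nE ny]] : exists y, [/\ A y, ~ exceptional G A r0 t y &
    ball_average w y r @[r --> 0^'+] --> (0 : R)].
  apply: contrapT => no.
  have sub : A `<=` exceptional G A r0 t `|`
      [set y | D y /\ ~ (ball_average w y r @[r --> 0^'+] --> (0 : R))].
    move=> y Ay; apply: contrapT => /not_orP[nE nN]; apply: no; exists y; split=> //.
    by apply: contrapT => h; apply: nN; split=> //; case: Ay.
  have AU y : A y -> eball y (L * r0) `<=` eball x ((1 + L) * r0).
    move=> [xy _]; apply: sub_eball.
    have -> : (1 + L) * r0 = r0 + L * r0 by ring.
    by rewrite lerD2r ltW.
  have HE := @exceptional_set_small R n H D c d rho1 (ltW c0) HD G A _ r0 L t kappa M
    r00 L1 Lr0 t0 kappa0 (ltW d0) (measurable_eball x ((1 + L) * r0)) mG G0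
    (@subIsetr _ _ _) AU GM.
  have := HL Dx; move=> /(_ r0); rewrite r00 r0rho => /(_ isT).
  apply/negP; rewrite -ltNge.
  apply: (@le_lt_trans _ _ (H (exceptional G A r0 t) + 0)%E).
    apply: (le_trans (le_outer_measure H _ _ sub)).
    by apply: (le_trans (outer_measureU2 H _ _)); rewrite [X in (_ + X)%E]w0.
  rewrite adde0; apply: (le_lt_trans HE); rewrite lte_fin.
  have -> : c * (2 * L) `^ d * r0 `^ kappa / (1 - 2^-1 `^ kappa) * (M / t) =
      (c' * r0 `^ d) / 2.
    have P0 : (2 * L) `^ d != 0 by rewrite gt_eqF// powR_gt0// mulr_gt0.
    rewrite /t /C6; move: P0 rk rd q1.
    set P := (2 * L) `^ d; set Q := 1 - _; set X := r0 `^ kappa; set Y := r0 `^ d.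
    move=> P0 /lt0r_neq0 X0 /lt0r_neq0 Y0 /lt0r_neq0 Q0.
    have cn := lt0r_neq0 c0; have cn' := lt0r_neq0 c'0; have Mn := lt0r_neq0 M0.
    by field; rewrite P0 X0 Y0 Q0 cn cn' Mn.
  rewrite ltr_pdivrMr// ltr_pMr ?ltr1n//; exact: mulr_gt0.
have [xy Dy] := Ay; exists y; split=> //.
(* The average at [r0] is compared with the one at a small radius, which tends to 0 and is absorbed
   by [e]. *)
have B : `|ball_average w y r0| <= C2 * t `^ p^-1 * r0 `^ a.
  apply/ler_addgt0Pr => e e0.
  have h := average_outside_exceptional r00 t0 T Iw Ay nE.
  have : \forall r \near (0 : R)^'+, `|ball_average w y r0| <= C2 * t `^ p^-1 * r0 `^ a + e.
    near=> r.
    have hr : 0 < r <= r0.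
      apply/andP; split; first by near: r; exact: nbhs_right_gt.
      by near: r; exact: nbhs_right_le.
    have he : `|ball_average w y r| <= e.
      by near: r; move: ny => /cvgr0Pnorm_le; apply.
    have := ler_normD (ball_average w y r0 - ball_average w y r) (ball_average w y r).
    by rewrite subrK => /le_trans; apply; apply: lerD => //; exact: h.
  by move=> /filter_ex[].
have B0 : 0 <= C2 * t `^ p^-1 * r0 `^ a.
  by apply: mulr_ge0; [apply: mulr_ge0; first exact: C2_ge0|]; exact: powR_ge0.
apply: (@le_trans _ _ ((C2 * t `^ p^-1 * r0 `^ a) `^ p)).
  by rewrite ge0_ler_powR ?nnegrE ?(ltW p0).
have B1 := @powR_ge0 R t p^-1; have B2 := @powR_ge0 R r0 a.
have B3 := mulr_ge0 C2_ge0 B1.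
rewrite (powRM _ B3 B2) (powRM _ C2_ge0 B1).
rewrite -[X in _ * X * _ <= _]powRrM mulVf ?gt_eqF// powRr1 ?(ltW t0)//.
have th := thresholdE r00.
move: th; rewrite powRD ?(gt_eqF r00) ?implybT// powRN => th.
have -> : (r0 `^ a) `^ p = r0 `^ d / r0 `^ kappa * (r0 `^ p / r0 ^+ n).
  have rp0 : r0 `^ p != 0 by rewrite gt_eqF// powR_gt0.
  have rn0 : r0 ^+ n != 0 by rewrite gt_eqF// exprn_gt0.
  rewrite -th; move: rp0 rn0; set X := (r0 `^ a) `^ p.
  set Y := r0 `^ p; set Z := r0 ^+ n => rp0 rn0.
  by field; rewrite rp0 rn0.
rewrite /t /C3; move: rk rd => /lt0r_neq0 + /lt0r_neq0.
set X := r0 `^ kappa; set Y := r0 `^ d; set Z := _ / r0 ^+ n; set W := C2 `^ p.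
move=> X0 Y0; rewrite le_eqVlt; apply/orP; left; apply/eqP; field.
by rewrite X0 Y0.
Unshelve. all: by end_near. Qed.

Let C4 := 2 `^ p * (C1 + C3).

Let C3_ge0 : 0 <= C3.
Proof. by rewrite mulr_ge0 ?powR_ge0// ltW. Qed.

Let mass_fin (S : set V) : measurable S ->
  (\int[mu]_(z in S) (G z)%:E)%E \is a fin_num.
Proof.
have [_ mG G0 _] := T.
move=> mS; rewrite ge0_fin_numE; last by apply: integral_ge0 => z _; rewrite lee_fin.
apply: le_lt_trans IG; apply: ge0_subset_integral => //.
  exact: measurable_EFin_rV.
by move=> z _; rewrite lee_fin.
Qed.

(** From [x] to a zero-trace point [y] within [2 * r0] at equal radii by [average_comparison], then
    from [y] to its limit 0. The radius [(2 + L) * r0] contains the energy balls of both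
    comparisons. *)
Lemma zero_trace_average x r0 : 0 < r0 -> 2 * L * r0 <= rho1 -> ethick D r0 x ->
  ((`|ball_average w x r0| `^ p)%:E <= (C4 * (r0 `^ p / r0 ^+ n))%:E *
     \int[mu]_(z in eball x ((2 + L) * r0)) (G z)%:E)%E.
Proof.
move=> r00 Lr0 [x' Dx' xx'].
have [mw mG G0 _] := T.
have mB z s : measurable (eball z s : set V) by exact: measurable_eball.
set I := (\int[mu]_(z in _) _)%E.
have Ifin : I \is a fin_num by exact: mass_fin.
have I0 : (0 <= I)%E by apply: integral_ge0 => z _; rewrite lee_fin.
have iI0 : 0 <= fine I by exact: fine_ge0.
have le_mass z s : eball z s `<=` eball x ((2 + L) * r0) ->
    (\int[mu]_(u in eball z s) (G u)%:E <= I)%E.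
  move=> sub; apply: ge0_subset_integral => //; first exact: measurable_EFin_rV.
  by move=> u _; rewrite lee_fin.
pose Q := r0 `^ p / r0 ^+ n.
have Q0 : 0 <= Q by rewrite divr_ge0 ?powR_ge0// exprn_ge0// ltW.
(* [zero_trace_point] takes a positive bound on the energy, which itself may vanish; [eta] is
   removed afterwards. *)
have pt eta : 0 < eta -> `|ball_average w x r0| `^ p <= C4 * Q * (fine I + eta).
  move=> eta0.
  have M0 : 0 < fine I + eta by rewrite ltr_wpDl.
  have IM : (I <= (fine I + eta)%:E)%E.
    by rewrite EFinD fineK// leeDl// lee_fin ltW.
  have GM : (\int[mu]_(z in eball x' ((1 + L) * r0)) (G z)%:E <= (fine I + eta)%:E)%E.
    apply: le_trans IM; apply: le_mass; apply: sub_eball.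
    have -> : (2 + L) * r0 = r0 + (1 + L) * r0 by ring.
    by rewrite lerD2r enormB ltW.
  have [y [Dy yx' By]] := zero_trace_point Dx' r00 Lr0 M0 GM.
  have xy : enorm (x - y) <= 2 * r0.
    have := enorm_triangle x x' y; move: xx' yx'; rewrite /eball/= (enormB x' y); lra.
  have hs : r0 / 2 <= r0 <= r0 by rewrite lexx andbT ler_pdivrMr// ler_peMr ?(ltW r00)// ler1n.
  have A := average_comparison p1 r00 C0 K0 T Iw hs xy.
  have {}A : `|ball_average w x r0 - ball_average w y r0| `^ p <= C1 * Q * (fine I + eta).
    rewrite -lee_fin; apply: (le_trans A); rewrite [leRHS]EFinM; apply: lee_wpmul2l.
      by rewrite lee_fin mulr_ge0.
    apply: le_trans IM; apply: le_mass; apply: le_eball.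
    by rewrite ler_wpM2r ?(ltW r00)// lerDr.
  have := powR_normD (ball_average w x r0 - ball_average w y r0) (ball_average w y r0) (ltW p0).
  rewrite subrK => /le_trans; apply.
  have -> : C4 * Q * (fine I + eta) =
      2 `^ p * (C1 * Q * (fine I + eta) + C3 * ((fine I + eta) * Q)).
    by rewrite /C4; set P := 2 `^ p; ring.
  by rewrite ler_wpM2l ?powR_ge0// lerD.
rewrite -(fineK Ifin) -EFinM lee_fin; apply/ler_addgt0Pr => e e0.
have C4Q : 0 <= C4 * Q by rewrite mulr_ge0// mulr_ge0 ?powR_ge0// addr_ge0.
have e1 : 0 < e / (C4 * Q + 1) by rewrite divr_gt0// ltr_pwDr.
apply: (le_trans (pt _ e1)); rewrite mulrDr lerD2l mulrCA ger_pMr//.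
by rewrite ler_pdivrMr ?ltr_pwDr// mul1r lerDl.
Qed.

(** By Tonelli's theorem the left side is the integral over $h \in B(0,s)$ of the mass of [F] on $S
    + h$, a subset of the [s]-neighbourhood of [S]. *)
Lemma mass_shift (F : V -> R) (S : set V) s : measurable_fun [set: V] F ->
  (forall z, 0 <= F z) -> measurable S ->
  (\int[mu]_(x in S) \int[mu]_(z in eball x s) (F z)%:E <=
    mu (eball 0 s : set V) * \int[mu]_(z in ethick S s) (F z)%:E)%E.
Proof.
move=> mF F0 mS.
pose Fp (z : V * V) := (F (z.1 + z.2))%:E.
have mFp : measurable_fun [set: V * V] Fp.
  by apply/measurable_EFinP; apply: measurableT_comp => //; exact: measurable_add_pair.
have Fp0 z : (0 <= Fp z)%E by rewrite lee_fin.
have mB z t : measurable (eball z t : set V) by exact: measurable_eball.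
have -> : (\int[mu]_(x in S) \int[mu]_(z in eball x s) (F z)%:E =
    \int[mu]_(x in S) \int[mu]_(h in eball 0 s) Fp (x, h))%E.
  apply: eq_integral => x _.
  have := @ge0_integral_shift R n x (EFin \o F) (eball x s) (mB x s).
  move=> ->; [|exact: measurable_EFin_rV|by move=> z _; rewrite lee_fin].
  have -> : (fun z : V => z + x) @^-1` eball x s = eball 0 s.
    by apply/seteqP; split=> z; rewrite /eball/= addrK subr0.
  by apply: eq_integral => h _; rewrite /Fp/= [h + x]addrC.
rewrite (tonelli_sets mu mu)// muleC -integral_cst//.
have mFp' : measurable_fun [set: V * V] (Fp \o (fun z : V * V => (z.2, z.1))).
  by apply: measurableT_comp => //; exact: measurable_fun_pair.
apply: ge0_le_integral => //.
- by move=> h _; exact: integral_ge0.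
- have := measurable_inner_integral mu mS mFp' (fun z => Fp0 _).
  exact: measurable_funS.
- move=> h; rewrite /eball/= subr0 => hs; rewrite /Fp/=.
  have mSh : measurable ((fun x : V => x - h) @^-1` S) by exact: preimage_shift_measurable.
  have F0E z : (0 <= (EFin \o F) z)%E by rewrite lee_fin.
  have E := @ge0_integral_shift R n h (EFin \o F) _ mSh
    (@measurable_EFin_rV R n _ F mF) (fun z _ => F0E z).
  have -> : (\int[mu]_(x in S) (F (x + h))%:E =
      \int[mu]_(z in (fun x : V => (x - h)%R) @^-1` S) (F z)%:E)%E.
    rewrite E; congr (integral _ _ _).
    by apply/seteqP; split=> x; rewrite /preimage/= addrK.
  apply: ge0_subset_integral => //.
  + exact: measurable_ethick.
  + exact: measurable_EFin_rV.
  + by move=> z _; rewrite lee_fin.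
  + by move=> z Sz; exists (z - h) => //; rewrite /eball/= opprB addrC subrK.
Qed.

(** [C] belongs to $w$ minus its average, where the volume of the ball cancels; [C4] to the average
    itself, with $(2(2 + L))^n$ the volume bound for $B(0, (2 + L) r_0)$ over $r_0^n$; $2^p$
    separates the two. *)
Definition hardy_const := 2 `^ p * (C + C4 * (2 * (2 + L)) ^+ n).

(** The value $w(x)$ is split into its deviation from the average on $B(x, r_0)$ and that average,
    which [zero_trace_average] controls; both bounds are then integrated over the neighbourhood. *)
Lemma hardy_neighbourhood r0 : 0 < r0 -> 2 * L * r0 <= rho1 ->
  (Ip mu p (ethick D r0) w <= (hardy_const * r0 `^ p)%:E *
    \int[mu]_(z in ethick D ((3 + L) * r0)) (G z)%:E)%E.
Proof.
move=> r00 Lr0; have [mw mG G0 _] := T.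
set S := ethick D r0; set I := (\int[mu]_(z in _) _)%E.
have mS : measurable S by exact: measurable_ethick.
have mB z t : measurable (eball z t : set V) by exact: measurable_eball.
pose Q := r0 `^ p / r0 ^+ n.
have Q0 : 0 <= Q by rewrite divr_ge0 ?powR_ge0// exprn_ge0// ltW.
have C40 : 0 <= C4 by rewrite mulr_ge0 ?powR_ge0// addr_ge0.
pose v := fine (mu (eball (0 : V) r0)).
have v0 : 0 < v by exact: fine_eball_gt0.
have vE : mu (eball (0 : V) r0) = v%:E by rewrite fineK// lebesgue_eball_fin.
pose f1 x := (\int[mu]_(h in eball 0 r0) diff_power p w (x, h))%E.
pose f2 x := (\int[mu]_(z in eball x ((2 + L) * r0)) (G z)%:E)%E.
have mf1 : measurable_fun [set: V] f1 by exact: measurable_diff_power_inner.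
have mf2 : measurable_fun [set: V] f2.
  pose Fp (z : V * V) := (G (z.1 + z.2))%:E.
  have mFp : measurable_fun [set: V * V] Fp.
    by apply/measurable_EFinP; apply: measurableT_comp => //; exact: measurable_add_pair.
  have := @measurable_inner_integral _ _ _ _ _ mu (eball 0 ((2 + L) * r0)) Fp (mB _ _) mFp.
  move=> /(_ (fun z => G0 _)); apply: eq_measurable_fun => x _; rewrite /f2.
  have := @ge0_integral_shift R n x (EFin \o G) _ (mB x ((2 + L) * r0)).
  move=> ->; [|exact: measurable_EFin_rV|by move=> z _; rewrite lee_fin].
  have -> : (fun z : V => z + x) @^-1` eball x ((2 + L) * r0) = eball 0 ((2 + L) * r0).
    by apply/seteqP; split=> z; rewrite /eball/= addrK subr0.
  by apply: eq_integral => h _; rewrite /Fp/= [h + x]addrC.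
have f10 x : (0 <= f1 x)%E by apply: integral_ge0 => h _; exact: diff_power_ge0.
have f20 x : (0 <= f2 x)%E by apply: integral_ge0 => z _; rewrite lee_fin.
have Iwb z s : mu.-integrable (eball z s) (EFin \o w).
  by apply: (@Ip_integrable_ball _ _ p) => //; exact: ltW.
have pt x : S x -> ((`|w x| `^ p)%:E <=
    (2 `^ p / v)%:E * f1 x + (2 `^ p * (C4 * Q))%:E * f2 x)%E.
  move=> Sx.
  have A1 := value_sub_average_le p1 r00 mw (Iwb x r0) (@subset_refl _ (eball x r0)).
  rewrite lebesgue_eball_shift -/v -/(f1 x) in A1.
  have A2 := zero_trace_average r00 Lr0 Sx; rewrite -/Q -/(f2 x) in A2.
  have := powR_normD (w x - ball_average w x r0) (ball_average w x r0) (ltW p0).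
  rewrite subrK -lee_fin => /le_trans; apply.
  have two0 : (0 <= (2 `^ p)%:E :> \bar R)%E by rewrite lee_fin powR_ge0.
  rewrite EFinM EFinD [in leRHS]EFinM [X in (_ <= _ + X * _)%E]EFinM -!muleA.
  rewrite -ge0_muleDr//.
  - by apply: lee_wpmul2l => //; apply: leeD.
  - by apply: mule_ge0 => //; rewrite lee_fin invr_ge0 ltW.
  - by apply: mule_ge0 => //; rewrite lee_fin mulr_ge0.
have k1 : 0 <= 2 `^ p / v by rewrite divr_ge0 ?powR_ge0// ltW.
have k2 : 0 <= 2 `^ p * (C4 * Q) by rewrite mulr_ge0 ?powR_ge0// mulr_ge0.
have step1 : (Ip mu p S w <= (2 `^ p / v)%:E * (\int[mu]_(x in S) f1 x) +
    (2 `^ p * (C4 * Q))%:E * (\int[mu]_(x in S) f2 x))%E.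
  have mf1S : measurable_fun S f1 by exact: measurable_funS mf1.
  have mf2S : measurable_fun S f2 by exact: measurable_funS mf2.
  rewrite -!ge0_integralZl//; try by rewrite lee_fin.
  rewrite -ge0_integralD//; first last.
  - exact: measurable_funeM.
  - by move=> x _; apply: mule_ge0 => //; rewrite lee_fin.
  - exact: measurable_funeM.
  - by move=> x _; apply: mule_ge0 => //; rewrite lee_fin.
  apply: ge0_le_integral => //.
  - exact: measurable_powR_norm.
  - by apply: emeasurable_funD; exact: measurable_funeM.
apply: (le_trans step1).
have I0 : (0 <= I)%E by apply: integral_ge0 => z _; rewrite lee_fin.
have sub_mass A : measurable A -> A `<=` ethick D ((3 + L) * r0) ->
    (\int[mu]_(z in A) (G z)%:E <= I)%E.
  move=> mA AI; apply: ge0_subset_integral => //.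
  - exact: measurable_ethick.
  - exact: measurable_EFin_rV.
  - by move=> z _; rewrite lee_fin.
have S1 : (\int[mu]_(x in S) f1 x <= (v * (C * r0 `^ p))%:E * I)%E.
  apply: (le_trans (integral_diff_power_le r00 mS T)); rewrite vE muleA -EFinM.
  apply: lee_wpmul2l; first by rewrite lee_fin mulr_ge0 ?mulr_ge0 ?powR_ge0// ltW.
  apply: sub_mass; first exact: measurable_ethick.
  apply: (subset_trans (@ethick_ethick _ _ _ _ _)); apply: ethickS => //.
  have -> : r0 + K * r0 = (1 + K) * r0 by ring.
  by rewrite ler_wpM2r ?(ltW r00)// /L; move: K0; lra.
have S2 : (\int[mu]_(x in S) f2 x <= ((2 * ((2 + L) * r0)) ^+ n)%:E * I)%E.
  apply: (le_trans (mass_shift _ mG G0 mS)).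
  have K4 : 0 <= (2 + L) * r0 by rewrite mulr_ge0 ?(ltW r00)// addr_ge0// ltW.
  apply: lee_pmul => //.
  - by apply: integral_ge0 => z _; rewrite lee_fin.
  - exact: lebesgue_eball_le.
  - apply: sub_mass; first exact: measurable_ethick.
    apply: (subset_trans (@ethick_ethick _ _ _ _ _)); apply: ethickS => //.
    by rewrite le_eqVlt; apply/orP; left; apply/eqP; ring.
have k1E : (0 <= (2 `^ p / v)%:E)%E by rewrite lee_fin.
have k2E : (0 <= (2 `^ p * (C4 * Q))%:E)%E by rewrite lee_fin.
apply: (le_trans (leeD (lee_wpmul2l k1E S1) (lee_wpmul2l k2E S2))).
rewrite !muleA -!EFinM -ge0_muleDl//; first last.
- by rewrite lee_fin mulr_ge0// exprn_ge0// mulr_ge0// mulr_ge0 ?(ltW r00)// addr_ge0// ltW.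
- by rewrite lee_fin mulr_ge0// mulr_ge0 ?(ltW v0)// mulr_ge0 ?powR_ge0.
apply: lee_wpmul2r => //; rewrite -EFinD lee_fin /hardy_const /Q.
have rn0 : r0 ^+ n != 0 by rewrite gt_eqF// exprn_gt0.
rewrite [2 * (_ * r0)]mulrA [X in _ + _ * X]exprMn.
move: (lt0r_neq0 v0) rn0.
set X := r0 ^+ n; set Y := r0 `^ p; set Z := 2 `^ p; set W := (2 * (2 + L)) ^+ n => vn Xn.
rewrite le_eqVlt; apply/orP; left; apply/eqP; field.
by rewrite vn Xn.
Qed.

End zero_trace.

End trace.

(** * Continuity of translations *)

Section dominated.
Context {d : measure_display} {T : measurableType d} {R : realType}.
Variable mu : {measure set T -> \bar R}.

Lemma Ip_dominated (p : R) (g : T -> R) (v : nat -> T -> R) (e : R) : 0 < p ->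
  measurable_fun [set: T] g -> (forall m, measurable_fun [set: T] (v m)) ->
  (Ip mu p setT g < +oo)%E -> (forall m x, `|v m x| <= `|g x|) ->
  (forall x, v ^~ x @ \oo --> (0 : R)) -> 0 < e ->
  \forall m \near \oo, (Ip mu p setT (v m) <= e%:E)%E.
Proof.
move=> p0 mg mv Ig vg v0 e0.
pose f_ m x := (`|v m x| `^ p)%:E.
have cv : {ae mu, forall x, [set: T] x -> f_ ^~ x @ \oo --> cst 0%E x}.
  apply: aeW => x _; apply: cvg_EFin; first exact: nearW.
  apply/cvgrPdist_le => s s0.
  have s1 : 0 < s `^ p^-1 by exact: powR_gt0.
  have /cvgr0Pnorm_le/(_ _ s1) := v0 x; apply: filterS => m vm.
  rewrite sub0r normrN ger0_norm ?powR_ge0//=.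
  have -> : s = (s `^ p^-1) `^ p by rewrite -powRrM mulVf ?gt_eqF// powRr1// ltW.
  by rewrite ge0_ler_powR ?nnegrE ?(ltW p0)// ltW.
have mf_ m : measurable_fun [set: T] (f_ m) by exact: measurable_powR_norm.
have ig : mu.-integrable setT (fun x => (`|g x| `^ p)%:E).
  apply/integrableP; split; first exact: measurable_powR_norm.
  by under eq_integral do rewrite gee0_abs ?lee_fin ?powR_ge0//.
have fg : {ae mu, forall x m, [set: T] x -> (`|f_ m x| <= (`|g x| `^ p)%:E)%E}.
  apply: aeW => x m _; rewrite gee0_abs ?lee_fin ?powR_ge0//.
  by rewrite ge0_ler_powR ?nnegrE// ltW.
have [_ _] := @dominated_convergence _ T R mu setT measurableT f_ (cst 0%E) _ mf_
  (measurable_cst _) cv ig fg.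
rewrite integral0 => H.
have /H : nbhs 0%E [set z : \bar R | (z < e%:E)%E].
  by apply: open_nbhs_nbhs; split; [exact: open_ereal_lt_ereal|rewrite /= lte_fin].
by move=> [N _ h]; exists N => // m /= /h/= /ltW.
Qed.

End dominated.

Section translation_continuity.
Context {R : realType} {n : nat}.
Local Notation V := 'rV[R]_n.
Local Notation mu := (@lebesgue_rV R n).
Variable p : R.
Hypothesis p0 : 0 < p.
Implicit Types (u v : V -> R) (U A : set V).

Definition translation_continuous u := measurable_fun [set: V] u /\
  forall e, 0 < e -> exists2 delta, 0 < delta & forall h, enorm h < delta ->
    (Ip mu p setT (fun x => (u (x + h) - u x)%R) <= e%:E)%E.

Let k2 : 0 < 2 `^ p * 2 :> R. Proof. by rewrite mulr_gt0// powR_gt0. Qed.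

Lemma Ip_half_gt0 (e : R) : 0 < e -> 0 < e / (2 `^ p * 2).
Proof. by move=> e0; exact: divr_gt0. Qed.

(** The factor $2^p$ of [IpD] plays the role of Minkowski's inequality: two errors of $e / (2^p
    \cdot 2)$ add up to [e]. *)
Lemma Ip_le_add (e : R) S u v : measurable S -> measurable_fun [set: V] u ->
  measurable_fun [set: V] v -> (Ip mu p S u <= (e / (2 `^ p * 2))%:E)%E ->
  (Ip mu p S v <= (e / (2 `^ p * 2))%:E)%E -> (Ip mu p S (u \+ v)%R <= e%:E)%E.
Proof.
move=> mS mu_ mv uc vc; apply: (le_trans (IpD _ (ltW p0) mS mu_ mv)).
have -> : e = 2 `^ p * (e / (2 `^ p * 2) + e / (2 `^ p * 2)).
  have := lt0r_neq0 k2; rewrite mulf_eq0 => /norP[]; set P := 2 `^ p => P0 _.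
  by field.
rewrite [leRHS]EFinM; apply: lee_wpmul2l; first by rewrite lee_fin powR_ge0.
by rewrite EFinD; exact: (leeD uc vc).
Qed.

Lemma measurable_increment (h : V) u : measurable_fun [set: V] u ->
  measurable_fun [set: V] (fun x => u (x + h) - u x).
Proof. by move=> mw; apply: measurable_funB => //; exact: measurable_comp_shift. Qed.

Lemma translation_continuousD u v : translation_continuous u ->
  translation_continuous v -> translation_continuous (u \+ v).
Proof.
move=> [mu_ Hu] [mv Hv]; split; first exact: measurable_funD.
move=> e e0.
have e1 : 0 < e / (2 `^ p * 2) by exact: divr_gt0.
have [a a0 Ha] := Hu _ e1; have [b b0 Hb] := Hv _ e1.
exists (Num.min a b); first by rewrite lt_min a0 b0.
move=> h; rewrite lt_min => /andP[ha hb].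
have -> : (fun x => (u \+ v) (x + h) - (u \+ v) x) =
    (fun x => u (x + h) - u x) \+ (fun x => v (x + h) - v x).
  by apply/funext => x /=; ring.
by apply: Ip_le_add; [|exact: measurable_increment..|exact: Ha|exact: Hb].
Qed.

Lemma translation_continuousZ (c : R) u : translation_continuous u ->
  translation_continuous (fun x => c * u x).
Proof.
move=> [mu_ Hu]; split; first exact: measurable_funM.
move=> e e0.
have c0 : 0 < `|c| `^ p + 1 by rewrite ltr_wpDl ?powR_ge0.
have [a a0 Ha] := Hu _ (divr_gt0 e0 c0).
exists a => // h ha.
under eq_fun do rewrite -mulrBr.
rewrite IpZ ?(ltW p0)//; last first.
  by apply: measurable_funB => //; exact: measurable_comp_shift.
apply: (@le_trans _ _ ((`|c| `^ p)%:E * (e / (`|c| `^ p + 1))%:E)%E).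
  by apply: lee_wpmul2l; [rewrite lee_fin powR_ge0|exact: Ha].
rewrite -EFinM lee_fin mulrCA ger_pMr// ler_pdivrMr// mul1r lerDl//.
Qed.

Lemma translation_continuous_sum (I : Type) (s : seq I) (F : I -> V -> R) :
  (forall i, translation_continuous (F i)) ->
  translation_continuous (fun x => \sum_(i <- s) F i x).
Proof.
move=> HF; elim: s => [|i s IH].
  under eq_fun do rewrite big_nil.
  split; first exact: measurable_cst.
  move=> e e0; exists 1 => // h _.
  rewrite (@eq_Ip _ _ _ _ _ _ _ (cst 0)); last by move=> x _; rewrite subr0.
  rewrite /Ip; under eq_integral do rewrite normr0 powR0 ?gt_eqF//.
  by rewrite integral0 lee_fin ltW.
under eq_fun do rewrite big_cons.
exact: (translation_continuousD (HF i) IH).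
Qed.

(** An increment of [u] is an increment of [v] plus the error [u - v] at two translated points, and
    [Ip] over the whole space is translation invariant. *)
Lemma translation_continuous_limit u : measurable_fun [set: V] u ->
  (forall e, 0 < e -> exists2 v, translation_continuous v &
    (Ip mu p setT (u \- v)%R <= e%:E)%E) -> translation_continuous u.
Proof.
move=> mu_ Hu; split=> // e e0.
pose e1 := e / (2 `^ p * 2); pose e2 := e1 / (2 `^ p * 2).
have e10 : 0 < e1 by exact: divr_gt0.
have e20 : 0 < e2 by exact: divr_gt0.
have [v [mv Hv] uv] := Hu _ e20.
have [a a0 Ha] := Hv _ e10.
exists a => // h ha.
have -> : (fun x => u (x + h) - u x) = (fun x => v (x + h) - v x) \+
    ((fun x => (u \- v) (x + h)) \+ (fun x => - (u \- v) x)).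
  by apply/funext => x /=; ring.
have muv : measurable_fun [set: V] (u \- v)%R by exact: measurable_funB.
have m1 : measurable_fun [set: V] (fun x => (u \- v)%R (x + h)).
  exact: (measurable_comp_shift h muv).
have m2 : measurable_fun [set: V] (fun x => - (u \- v)%R x).
  exact: measurableT_comp muv.
apply: Ip_le_add; [by []|exact: measurable_increment|exact: measurable_funD|exact: Ha|].
apply: Ip_le_add; [by []|by []|by []| |].
- by rewrite (Ip_shiftT _ _ muv).
- by rewrite (IpN mu p setT (u \- v)%R).
Qed.

Lemma Ip_indic S A : measurable S -> measurable A ->
  Ip mu p S (\1_A : V -> R) = mu (A `&` S).
Proof.
move=> mS mA; rewrite -integral_indic//; apply: eq_integral => x _.
by rewrite indicE; case: (_ \in _); rewrite ?normr1 ?powR1// normr0 powR0// gt_eqF.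
Qed.

(** For $|h| < 1/(m+1)$ the increment of the indicator is nonzero only if [x] or [x + h] lies in the
    inner boundary layer [E m]. These layers decrease to the empty set because [U] is open, so
    dominated convergence applies. *)
Lemma translation_continuous_open U : open U -> (mu U < +oo)%E ->
  translation_continuous (\1_U : V -> R).
Proof.
move=> oU Uoo.
have mU : measurable U by exact: open_measurable_rV.
pose E (m : nat) : set V := U `&` ethick (~` U) m.+1%:R^-1.
have mE m : measurable (E m) by apply: measurableI => //; exact: measurable_ethick.
split; first exact: measurable_indic.
move=> e e0.
have e10 : 0 < e / (2 `^ p * 2) by exact: divr_gt0.
have : \forall m \near \oo, (Ip mu p setT (\1_(E m) : V -> R) <= (e / (2 `^ p * 2))%:E)%E.
  apply: (@Ip_dominated _ _ _ _ p (\1_U : V -> R)) => //.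
  - by rewrite Ip_indic// setIT.
  - move=> m x; rewrite !indicE; have [xE|xE] := boolP (x \in E m); last by rewrite normr0.
    by have -> : x \in U by rewrite inE; move: xE; rewrite inE => -[].
  - move=> x; have [Ux|nUx] := pselect (U x); last first.
      apply: cvg_near_cst; apply: nearW => m; rewrite indicE memNset// => -[]//.
    have [r r0 rU] := (open_enormP U).1 oU x Ux.
    apply: cvg_near_cst; near=> m.
    rewrite indicE memNset// => -[_ [y ny]] yx; apply: ny; apply: rU.
    apply: eballC; apply: (lt_trans yx); near: m.
    exact: near_infty_natSinv_lt (PosNum r0).
move=> /filter_ex[m Em]; exists m.+1%:R^-1 => // h hm.
have mI : measurable_fun [set: V] (\1_(E m) : V -> R) by exact: measurable_indic.
have mI' := measurable_comp_shift h mI.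
have Em' : (Ip mu p setT (fun x => \1_(E m) (x + h)%R) <= (e / (2 `^ p * 2))%:E)%E.
  by rewrite (Ip_shiftT _ _ mI).
apply: le_trans (Ip_le_add measurableT mI mI' Em Em').
have mJ : measurable_fun [set: V] (\1_U : V -> R) by exact: measurable_indic.
apply: le_Ip; [exact: ltW|by []|exact: measurable_increment|exact: measurable_funD|].
move=> x _ /=; rewrite !indicE.
have [Ux|nUx] := boolP (x \in U); have [Uy|nUy] := boolP (x + h \in U).
+ by rewrite subrr normr0.
+ suff -> : x \in E m by rewrite sub0r normrN normr1 ger0_norm ?lerDl// addr_ge0.
  rewrite inE; split; first by move: Ux; rewrite inE.
  exists (x + h); first by move=> /mem_set; exact/negP.
  by rewrite /eball/= opprD addrA subrr sub0r enormN.
+ suff -> : x + h \in E m by rewrite subr0 normr1 ger0_norm ?lerDr// addr_ge0.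
  rewrite inE; split; first by move: Uy; rewrite inE.
  exists x; first by move=> /mem_set; exact/negP.
  by rewrite /eball/= addrAC subrr add0r.
+ by rewrite subrr normr0.
Unshelve. all: by end_near. Qed.

Lemma Ip_indic_fin A : measurable A -> (mu A < +oo)%E ->
  (Ip mu p setT (\1_A : V -> R) < +oo)%E.
Proof. by move=> mA Aoo; rewrite Ip_indic// setIT. Qed.

Lemma translation_continuous_setU A B : A `&` B = set0 ->
  translation_continuous (\1_A : V -> R) -> translation_continuous (\1_B : V -> R) ->
  translation_continuous (\1_(A `|` B) : V -> R).
Proof.
move=> AB tA tB.
have -> : \1_(A `|` B) = \1_A \+ (\1_B : V -> R).
  apply/funext => x /=; rewrite !indicE in_setU.
  have : ~ ((x \in A) && (x \in B)).
    by rewrite -in_setI AB in_set0.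
  by case: (x \in A); case: (x \in B); rewrite /= ?addr0 ?add0r//.
exact: translation_continuousD.
Qed.

(** Finite unions are handled by additivity and approximate the whole union by dominated
    convergence. *)
Lemma translation_continuous_bigcup (F : nat -> set V) : (forall k, measurable (F k)) ->
  trivIset [set: nat] F -> (mu (\bigcup_k F k) < +oo)%E ->
  (forall k, translation_continuous (\1_(F k) : V -> R)) ->
  translation_continuous (\1_(\bigcup_k F k) : V -> R).
Proof.
move=> mF tF Foo HF.
pose G m := \bigcup_(k < m) F k.
have mG m : measurable (G m) by exact: bigcup_measurable.
have tG m : translation_continuous (\1_(G m) : V -> R).
  elim: m => [|m IH]; rewrite /G bigcup_mkord.
    rewrite big_ord0 (_ : \1_set0 = (fun x => 0 * \1_(F 0%N) x : R)).
      exact: translation_continuousZ.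
    by apply/funext => x; rewrite indicE in_set0 mul0r.
  rewrite big_ord_recr/= -bigcup_mkord.
  apply: (translation_continuous_setU _ IH (HF m)).
  apply/seteqP; split=> // x [[k /= km Fk] Fm].
  have E := tF k m Logic.I Logic.I (ex_intro _ x (conj Fk Fm)).
  by rewrite E ltnn in km.
have mU : measurable (\bigcup_k F k) by exact: bigcup_measurable.
apply: translation_continuous_limit => [|e e0]; first exact: measurable_indic.
have [m Hm] : exists m, (Ip mu p setT
    ((\1_(\bigcup_k F k) : V -> R) \- \1_(G m))%R <= e%:E)%E.
  apply: (@filter_ex _ \oo).
  apply: (@Ip_dominated _ _ _ _ p (\1_(\bigcup_k F k) : V -> R)) => //.
  - by move=> m; apply: measurable_funB; exact: measurable_indic.
  - exact: Ip_indic_fin.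
  - move=> m x /=; rewrite !indicE.
    have [xG|_] := boolP (x \in G m); last by rewrite subr0.
    have -> : x \in \bigcup_k F k.
      by move: xG; rewrite !inE => -[k _ Fk]; exists k.
    by rewrite subrr normr0.
  - move=> x; apply: cvg_near_cst.
    have [[k _ Fk]|nF] := pselect ((\bigcup_k F k) x).
      exists k.+1 => // m /= km; rewrite !indicE !mem_set ?subrr//; first by exists k.
      by exists k.
    apply: nearW => m /=; rewrite !indicE !memNset ?subrr//.
    by move=> [k _ Fk]; apply: nF; exists k.
by exists (\1_(G m)).
Qed.

(** Dynkin's theorem, starting from the open sets. Intersecting with a fixed ball keeps measures
    finite and turns complements into differences from the indicator of the ball. *)
Lemma translation_continuous_bounded_set A (N : R) : measurable A ->
  translation_continuous (\1_(A `&` eball 0 N) : V -> R).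
Proof.
have mB : measurable (eball 0 N : set V) by exact: measurable_eball.
have Boo : (mu (eball 0 N : set V) < +oo)%E.
  by rewrite -ge0_fin_numE//; exact: lebesgue_eball_fin.
have fin S : measurable S -> (mu (S `&` eball 0 N) < +oo)%E.
  by move=> mS; apply: le_lt_trans Boo; apply: le_measure; rewrite ?inE//; exact: measurableI.
have tB : translation_continuous (\1_(eball 0 N) : V -> R).
  by apply: translation_continuous_open => //; exact: open_eball.
move=> mA.
pose P (S : set V) := translation_continuous (\1_(S `&` eball 0 N) : V -> R).
have PT : P setT by rewrite /P setTI.
have Popen : @open V `<=` P.
  move=> U oU; apply: translation_continuous_open.
    by apply: openI => //; exact: open_eball.
  by apply: fin; exact: open_measurable_rV.
have PC S : measurable S -> P S -> P (~` S).
  move=> mS tS; rewrite /P.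
  have -> : (\1_(~` S `&` eball 0 N) : V -> R) =
      \1_(eball 0 N) \+ (fun x => -1 * \1_(S `&` eball 0 N) x).
    apply/funext => x /=; rewrite !indicE !in_setI in_setC mulN1r.
    by case: (x \in S); case: (x \in eball 0 N); rewrite /= ?subr0 ?subrr ?oppr0.
  apply: (translation_continuousD tB); exact: translation_continuousZ tS.
have Pbig (F : (set V)^nat) : (forall k, measurable (F k)) -> trivIset [set: nat] F ->
    (forall k, P (F k)) -> P (\bigcup_k F k).
  move=> mF tF HF; rewrite /P setI_bigcupl; apply: translation_continuous_bigcup => //.
  - by move=> k; exact: measurableI.
  - exact: trivIset_setIr.
  - by rewrite -setI_bigcupl; apply: fin; exact: bigcup_measurable.
exact: (@dynkin_induction _ _ (@open V) P erefl (@openI _) PT Popen PC Pbig A mA).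
Qed.

Import HBNNSimple.

(** Simple functions cut off to balls are combinations of indicators of bounded sets; they
    approximate a nonnegative function by dominated convergence, and the general case splits into
    positive and negative parts. *)
Lemma translation_continuous_Lp u : measurable_fun [set: V] u ->
  (Ip mu p setT u < +oo)%E -> translation_continuous u.
Proof.
have pos v : (forall x, 0 <= v x) -> measurable_fun [set: V] v ->
    (Ip mu p setT v < +oo)%E -> translation_continuous v.
  move=> v0 mv vI.
  have mvE : measurable_fun [set: V] (EFin \o v) by exact/measurable_EFinP.
  pose s := nnsfun_approx measurableT mvE.
  have v0E x : [set: V] x -> (0 <= (EFin \o v) x)%E by rewrite lee_fin.
  pose w (m : nat) := (fun x : V => s m x * \1_(eball 0 m%:R) x : R).
  have tw m : translation_continuous (w m).
    rewrite /w; under eq_fun do rewrite fimfunEord mulr_suml.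
    apply: translation_continuous_sum => i; under eq_fun do rewrite -mulrA.
    apply: translation_continuousZ; set S := s m @^-1` _.
    rewrite (_ : (fun x => _) = (\1_(S `&` eball 0 m%:R) : V -> R)); last first.
      by apply/funext => x; rewrite indicI.
    apply: translation_continuous_bounded_set.
    rewrite /S -[X in measurable X]setTI; apply: (@measurable_funPT _ _ _ _ (s m)) => //.
  have sle m x : 0 <= s m x <= v x.
    apply/andP; split=> //; rewrite -lee_fin.
    have c := cvg_nnsfun_approx measurableT mvE v0E (Logic.I : [set: V] x).
    have nd : nondecreasing_seq (fun m => (s m x)%:E).
      move=> a b ab; rewrite lee_fin.
      by have /lefP := nd_nnsfun_approx measurableT mvE ab; apply.
    have := ereal_nondecreasing_cvgn nd; move=> /(cvg_unique (@ereal_hausdorff R) c) E.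
    rewrite [leRHS](E : (v x)%:E = _).
    by apply: ereal_sup_ubound; exists m.
  apply: translation_continuous_limit => // e e0.
  have [m Hm] : exists m, (Ip mu p setT (v \- w m)%R <= e%:E)%E.
    apply: (@filter_ex _ \oo); apply: (@Ip_dominated _ _ _ _ p v) => //.
    - by move=> m; apply: measurable_funB => //; have [] := tw m.
    - move=> m x; rewrite /w /= indicE; have /andP[s0 sv] := sle m x.
      case: (_ \in _); rewrite ?mulr1 ?mulr0 ?subr0//.
      by rewrite ger0_norm ?subr_ge0// ger0_norm// lerBlDr lerDl.
    - move=> x; have c := cvg_nnsfun_approx measurableT mvE v0E (Logic.I : [set: V] x).
      have /fine_cvgP[_ {}c] : (EFin \o (fun m => s m x)) @ \oo --> (v x)%:E by exact: c.
      have : v x - s m x @[m --> \oo] --> (0 : R).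
        by rewrite -(subrr (v x)); apply: cvgB => //; exact: cvg_cst.
      apply: cvg_trans; apply: near_eq_cvg; near=> m.
      rewrite /w/= indicE mem_set ?mulr1//= /eball/= subr0.
      by near: m; exact: nbhs_infty_gtr.
  by exists (w m).
move=> mu_ Iu.
have := @pos (fun x => Num.max (u x) 0); have := @pos (fun x => Num.max (- u x) 0).
have mle (w : V -> R) : measurable_fun [set: V] w -> (forall x, `|w x| <= `|u x|) ->
    (Ip mu p setT w < +oo)%E.
  by move=> mw wu; apply: le_lt_trans Iu; apply: le_Ip => //; exact: ltW.
have m1 : measurable_fun [set: V] (fun x => Num.max (u x) 0).
  exact: measurable_maxr.
have m2 : measurable_fun [set: V] (fun x => Num.max (- u x) 0).
  by apply: measurable_maxr => //; exact: measurableT_comp.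
move=> /(_ _ m2 _) H2 /(_ _ m1 _) H1.
have -> : u = (fun x => Num.max (u x) 0) \+ (fun x => -1 * Num.max (- u x) 0).
  apply/funext => x /=; rewrite mulN1r; have [h|h] := leP (u x) 0.
    by rewrite max_l ?oppr_ge0// opprK add0r.
  by rewrite max_r ?subr0// oppr_le0 ltW.
have absmax (a : R) : `|Num.max a 0| <= `|a|.
  by have [h|h] := leP a 0; rewrite ?normr0.
apply: translation_continuousD.
  apply: H1 => [x|]; first by rewrite le_max lexx orbT.
  exact: mle.
apply: translation_continuousZ; apply: H2 => [x|]; first by rewrite le_max lexx orbT.
by apply: mle => // x; rewrite -(normrN (u x)).
Unshelve. all: by end_near. Qed.

End translation_continuity.

(** * Convolution and mollification *)

Section coordinate_path.
Context {R : realType} {n : nat}.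
Local Notation V := 'rV[R]_n.
Local Notation e i := (delta_mx ord0 i : V).
Implicit Types (f : V -> R) (x h v : V).

(** Corners of the path from 0 to [h] along the axes, the directions in which [smooth] provides
    derivatives. *)
Definition coord_prefix h (j : nat) : V := \row_i (if (i < j)%N then h ord0 i else 0).

Lemma coord_prefix0 h : coord_prefix h 0 = 0.
Proof. by apply/rowP => i; rewrite !mxE. Qed.

Lemma coord_prefix_full h : coord_prefix h n = h.
Proof. by apply/rowP => i; rewrite !mxE ltn_ord. Qed.

Lemma coord_prefixS h (i : 'I_n) :
  coord_prefix h i.+1 = coord_prefix h i + h ord0 i *: e i.
Proof.
apply/rowP => j; rewrite !mxE eqxx/= ltnS leq_eqVlt.
have [/val_inj->|ji] := eqVneq (j : nat) i; first by rewrite ltnn eqxx mulr1 add0r.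
by rewrite (_ : (j == i) = false) ?mulr0 ?addr0//; apply/negbTE.
Qed.

Lemma enorm_coord_prefix h j : enorm (coord_prefix h j) <= enorm h.
Proof.
rewrite ler_wsqrtr// ler_sum// => i _; rewrite mxE; case: ifP => // _.
by rewrite expr0n/= sqr_ge0.
Qed.

Lemma coord_prefix_telescope f x h : f (x + h) - f x =
  \sum_(i < n) (f (x + coord_prefix h i + h ord0 i *: e i) - f (x + coord_prefix h i)).
Proof.
under eq_bigr do rewrite -addrA -coord_prefixS.
by rewrite -(big_mkord xpredT (fun i => f (x + coord_prefix h i.+1) - f (x + coord_prefix h i)))
  telescope_sumr// coord_prefix_full coord_prefix0 addr0.
Qed.

Lemma mvt_line_any f x v (h : R) : (forall y, derivable f y v) ->
  exists2 c, `|c| <= `|h| & f (x + h *: v) - f x = h * 'D_v f (x + c *: v).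
Proof.
move=> df; have [h0|h0|->] := ltgtP h 0; last first.
- by exists 0; rewrite // scale0r addr0 subrr mul0r.
- have [c /andP[c0 ch] E] := mvt_line x h0 df.
  by exists c => //; rewrite !gtr0_norm// ltW.
- have hN : 0 < - h by rewrite oppr_gt0.
  have [c /andP[c0 ch] E] := mvt_line (x + h *: v) hN df.
  exists (h + c); first by rewrite ler_norml; move: c0 ch; rewrite ltr0_norm//; lra.
  move: E; rewrite -!addrA -!scalerDl subrr scale0r addr0 => E.
  by rewrite -opprB E mulNr opprK.
Qed.

Lemma mvt_line_le f x v (M h : R) : (forall y, derivable f y v) ->
  (forall y, `|'D_v f y| <= M) -> `|f (x + h *: v) - f x| <= `|h| * M.
Proof.
by move=> df fM; have [c _ ->] := mvt_line_any x h df; rewrite normrM ler_wpM2l.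
Qed.

Lemma lipschitz_smooth f (M : R) x h : smooth f -> (forall i y, `|partial i f y| <= M) ->
  `|f (x + h) - f x| <= n%:R * (M * enorm h).
Proof.
move=> sf fM; rewrite coord_prefix_telescope; apply: (le_trans (ler_norm_sum _ _ _)).
rewrite -[X in X%:R]card_ord mulr_natl -sumr_const ler_sum// => i _.
apply: (@le_trans _ _ (`|h ord0 i| * M)).
  by apply: mvt_line_le => y; [exact: smooth_derivable|exact: fM].
rewrite mulrC ler_wpM2l ?normr_coord_le//.
exact: le_trans (normr_ge0 _) (fM i x).
Qed.

Lemma taylor1_line f x (M h : R) i : smooth f ->
  (forall y, `|partial i (partial i f) y| <= M) ->
  `|f (x + h *: e i) - f x - h * partial i f x| <= M * h ^+ 2.
Proof.
move=> sf fM.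
have [c ch ->] := mvt_line_any x h (fun y => @smooth_derivable _ _ f y i sf).
rewrite -mulrBr normrM.
have := mvt_line_le x c (fun y => @smooth_derivable _ _ _ y i (smooth_partial i sf)) fM.
have M0 : 0 <= M := le_trans (normr_ge0 _) (fM x).
rewrite -(real_normK (num_real h)) expr2 mulrCA => /le_trans H.
rewrite ler_wpM2l//; apply: H; rewrite mulrC; exact: ler_wpM2l.
Qed.

(** Combined with the uniform remainder of [taylor1_line], this differentiates a convolution under
    the integral sign without dominated convergence. *)
Lemma is_derive_quadratic f x v (l K : R) :
  (forall h : R, `|h| <= 1 -> `|f (x + h *: v) - f x - h * l| <= K * h ^+ 2) ->
  is_derive x v f l.
Proof.
move=> H.
have K0 : 0 <= K.
  by have := H 1; rewrite normr1 expr1n mulr1 => /(_ (lexx _)); exact: le_trans.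
have c : h^-1 *: ((f \o shift x) (h *: v) - f x) @[h --> (0 : R)^'] --> l.
  apply/cvgrPdist_le => eps eps0.
  have d0 : 0 < Num.min 1 (eps / (K + 1)) by rewrite lt_min ltr01 divr_gt0// ltr_wpDl.
  near=> h.
  have h0 : h != 0 by near: h; exact: nbhs_dnbhs_neq.
  have : `|h| <= Num.min 1 (eps / (K + 1)).
    near: h; apply: dnbhs0_le => //.
  rewrite le_min => /andP[h1 heps].
  have := H h h1; rewrite /= /shift/= [h *: v + x]addrC => Hh.
  rewrite distrC.
  have -> : h^-1 *: (f (x + h *: v) - f x) - l =
      h^-1 * (f (x + h *: v) - f x - h * l).
    by rewrite [RHS]mulrBr mulrA mulVf// mul1r.
  rewrite normrM normfV ler_pdivrMl ?normr_gt0//; apply: (le_trans Hh).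
  rewrite -(real_normK (num_real h)) expr2 mulrCA ler_wpM2l//.
  apply: (@le_trans _ _ ((K + 1) * `|h|)); first by rewrite ler_wpM2r// lerDl.
  by rewrite mulrC -ler_pdivlMr// ltr_wpDl.
apply: DeriveDef; first by apply/cvg_ex; exists l.
by apply: cvg_lim.
Unshelve. all: by end_near. Qed.

End coordinate_path.

Section convolution.
Context {R : realType} {n : nat}.
Local Notation V := 'rV[R]_n.
Local Notation mu := (@lebesgue_rV R n).
Local Notation e i := (delta_mx ord0 i : V).
Implicit Types (f g rho phi : V -> R) (x h : V).

(** Equivalent to [loc_integrable] by [loc_integrableP], in a form suited to kernels supported in
    centred balls. *)
Definition ball_integrable f := measurable_fun [set: V] f /\
  forall r, mu.-integrable (eball 0 r) (EFin \o f).

Lemma integrable_mul_bounded f phi (M r : R) : ball_integrable f ->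
  measurable_fun [set: V] phi -> (forall x, `|phi x| <= M) ->
  (forall x, phi x != 0 -> enorm x < r) ->
  mu.-integrable setT (EFin \o (fun x => f x * phi x)) /\
  `|\int[mu]_x (f x * phi x)| <= M * \int[mu]_(x in eball 0 r) `|f x|.
Proof.
move=> [mf If] mphi phiM phir.
have mB : measurable (eball 0 r : set V) by exact: measurable_eball.
have M0 : 0 <= M := le_trans (normr_ge0 _) (phiM 0).
have mfp : measurable_fun [set: V] (fun x => f x * phi x) by exact: measurable_funM.
have E : (fun x => (f x * phi x)%:E) =
    ((fun x => (f x * phi x)%:E) \_ (eball 0 r : set V)).
  apply/funext => x; rewrite /patch; case: ifPn => // /negP xB.
  have -> : phi x = 0; last by rewrite mulr0.
  apply: contra_notP xB => /eqP /phir xr; rewrite inE /eball/= subr0//.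
have Iabs : mu.-integrable (eball 0 r) (fun x => (M * `|f x|)%:E).
  under eq_fun do rewrite EFinM; apply: integrableZl => //.
  exact: (integrable_abse (If r)).
have IB : mu.-integrable (eball 0 r) (EFin \o (fun x => f x * phi x)).
  apply: (le_integrable mB _ _ Iabs).
    by apply/measurable_EFinP; exact: measurable_funS mfp.
  move=> x _ /=; rewrite lee_fin normrM mulrC [leRHS]ger0_norm ?mulr_ge0//.
  by rewrite ler_wpM2r.
split.
  by rewrite /comp E; apply/(integrable_mkcond _ mB).
rewrite /Rintegral E -integral_mkcond.
apply: (@le_trans _ _ (\int[mu]_(x in eball 0 r) (M * `|f x|))); last first.
  rewrite RintegralZl//; exact: (integrable_abse (If r)).
apply: (le_trans (le_normr_Rintegral mB IB)).
apply: le_Rintegral => //; first exact: (integrable_abse IB).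
by move=> x _; rewrite normrM mulrC ler_wpM2r.
Qed.

Lemma test_measurable phi : test_function phi -> measurable_fun [set: V] phi.
Proof. by move=> /test_continuous; exact: continuous_measurable_rV. Qed.

(** The kernel is reflected with respect to the usual convention: as a function of [y] it is a
    translate of [rho], hence a test function, at the price of a sign for each derivative in [x]. *)
Definition convol f rho x : R := \int[mu]_y (f y * rho (y - x)).

Lemma test_shift rho x : test_function rho -> test_function (fun y => rho (y - x)).
Proof.
move=> [srho /supp_bounded[r r0 hr]].
have E : (fun y => rho (y - x)) = (fun y => rho (1 *: y + - x)).
  by apply/funext => y; rewrite scale1r.
split; first by rewrite E; exact: smooth_affine.
apply: (@bounded_supp _ _ _ (r + enorm x)) => y /hr yx.
by have := enormD (y - x) x; rewrite subrK => /le_trans; apply; rewrite lerD2r ltW.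
Qed.

Lemma integrable_mul_test f rho : ball_integrable f -> test_function rho ->
  mu.-integrable setT (EFin \o (fun y => f y * rho y)).
Proof.
move=> If trho; have [M M0 hM] := test_bounded trho.
have [_ /supp_bounded[r r0 hr]] := trho.
by have [] := integrable_mul_bounded If (test_measurable trho) hM hr.
Qed.

Lemma derivative_bounds rho : test_function rho -> exists2 M, 0 <= M & forall i j x,
  `|partial i rho x| <= M /\ `|partial j (partial i rho) x| <= M.
Proof.
move=> trho.
have B g : test_function g -> exists M, 0 <= M /\ forall x, `|g x| <= M.
  by move=> /test_bounded[M]; exists M.
have /choice[M1 H1] : forall i, exists M, 0 <= M /\ forall x, `|partial i rho x| <= M.
  by move=> i; apply: B; exact: test_partial.
have /choice[M2 H2] : forall ij : 'I_n * 'I_n, exists M, 0 <= M /\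
    forall x, `|partial ij.2 (partial ij.1 rho) x| <= M.
  by move=> [i j]; apply: B; do 2 apply: test_partial.
have S1 : 0 <= \sum_i M1 i by apply: sumr_ge0 => i _; case: (H1 i).
have S2 : 0 <= \sum_ij M2 ij by apply: sumr_ge0 => i _; case: (H2 i).
exists (\sum_i M1 i + \sum_ij M2 ij); first exact: addr_ge0.
move=> i j x; split.
  apply: le_trans (_ : \sum_i M1 i <= _); last by rewrite lerDl.
  apply: (le_trans ((H1 i).2 x)); rewrite (bigD1 i)//= lerDl sumr_ge0// => k _.
  by case: (H1 k).
apply: le_trans (_ : \sum_ij M2 ij <= _); last by rewrite lerDr.
apply: (le_trans ((H2 (i, j)).2 x)); rewrite (bigD1 (i, j))//= lerDl sumr_ge0// => k _.
by case: (H2 k).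
Qed.

(** The three-term form covers both the increment of a convolution, with [c] equal to 0, and its
    first-order remainder. *)
Lemma convol_linear f rho1 rho2 rho3 (c : R) x1 x2 x3 : ball_integrable f ->
  test_function rho1 -> test_function rho2 -> test_function rho3 ->
  convol f rho1 x1 - convol f rho2 x2 - c * convol f rho3 x3 =
  \int[mu]_y (f y * (rho1 (y - x1) - rho2 (y - x2) - c * rho3 (y - x3))).
Proof.
move=> If t1 t2 t3.
have I1 := integrable_mul_test If (test_shift x1 t1).
have I2 := integrable_mul_test If (test_shift x2 t2).
have I3 := integrable_mul_test If (test_shift x3 t3).
have I12 : mu.-integrable setT
    (EFin \o (fun y => f y * rho1 (y - x1) - f y * rho2 (y - x2))).
  by have := integrableB measurableT I1 I2.
have I3' : mu.-integrable setT (EFin \o (fun y => c * (f y * rho3 (y - x3)))).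
  have -> : EFin \o (fun y => c * (f y * rho3 (y - x3))) =
      (fun y => c%:E * (EFin \o (fun y => f y * rho3 (y - x3))%R) y)%E by [].
  exact: integrableZl.
rewrite /convol -RintegralB// -RintegralZl// -RintegralB//.
by apply: eq_Rintegral => y _; ring.
Qed.

Lemma convol_increment f rho x : ball_integrable f -> test_function rho ->
  exists2 K, 0 <= K & forall h, enorm h <= 1 ->
    `|convol f rho (x + h) - convol f rho x| <= K * enorm h.
Proof.
move=> If trho.
have [M M0 hM] := derivative_bounds trho.
have [srho /supp_bounded[r r0 hr]] := trho.
pose B := eball (0 : V) (r + enorm x + 1).
have J0 : 0 <= \int[mu]_(y in B) `|f y| by exact: Rintegral_ge0.
exists (n%:R * M * \int[mu]_(y in B) `|f y|); first by rewrite !mulr_ge0.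
move=> h h1.
have := convol_linear 0 (x + h) x x If trho trho trho; rewrite mul0r subr0 => ->.
have -> : n%:R * M * (\int[mu]_(y in B) `|f y|) * enorm h =
    (n%:R * (M * enorm h)) * \int[mu]_(y in B) `|f y|.
  by set J := Rintegral _ _ _; ring.
pose psi y := rho (y - (x + h)) - rho (y - x) - 0 * rho (y - x).
have mpsi : measurable_fun [set: V] psi.
  have m z := test_measurable (test_shift z trho).
  by apply: measurable_funB; [exact: measurable_funB|exact: measurable_funM].
apply: (integrable_mul_bounded If mpsi _ _).2 => y; rewrite /psi mul0r subr0.
  have := lipschitz_smooth (y - x) (- h) srho (fun i z => (hM i i z).1).
  by rewrite opprD addrA enormN.
move=> nz.
have ub z : rho (y - z) != 0 -> enorm y < r + enorm z.
  move=> /hr yz; have := enormD (y - z) z; rewrite subrK => /le_lt_trans; apply.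
  by rewrite ltrD2r.
have [/eqP E|] := eqVneq (rho (y - (x + h))) 0.
  have /ub yr : rho (y - x) != 0.
    by apply: contraNneq nz => ->; rewrite (eqP E) subrr.
  by apply: (lt_le_trans yr); rewrite lerDl.
move=> /ub /lt_le_trans; apply; rewrite -addrA lerD2l.
by apply: (le_trans (enormD _ _)); rewrite lerD2l.
Qed.

Lemma convol_continuous f rho : ball_integrable f -> test_function rho ->
  continuous (convol f rho).
Proof.
move=> If trho; rewrite /continuous_at => x; have [K K0 H] := convol_increment x If trho.
apply/(@cvgrPdist_le _ _ _ (nbhs (x : V))) => eps eps0.
have d0 : 0 < Num.min 1 (eps / (K + 1)) by rewrite lt_min ltr01 divr_gt0// ltr_wpDl.
apply/nbhs_enormP; exists (Num.min 1 (eps / (K + 1))) => // y.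
rewrite /eball/= lt_min => /andP[y1 y2]; rewrite distrC.
have := H (y - x) (ltW y1); rewrite [x + _]addrC subrK => /le_trans; apply.
apply: (@le_trans _ _ ((K + 1) * enorm (y - x))).
  by rewrite ler_wpM2r ?enorm_ge0// lerDl.
by rewrite mulrC -ler_pdivlMr ?(ltW y2)// ltr_wpDl.
Qed.

Lemma convol_derive f rho x i : ball_integrable f -> test_function rho ->
  is_derive x (e i) (convol f rho) (convol f (\- partial i rho) x).
Proof.
move=> If trho.
have [M M0 hM] := derivative_bounds trho.
have tp : test_function (partial i rho) by exact: test_partial.
have tN : test_function (\- partial i rho) by exact: testN.
have [srho /supp_bounded[r1 r10 hr1]] := trho.
have [_ /supp_bounded[r2 r20 hr2]] := tp.
pose B := eball (0 : V) (r1 + r2 + enorm x + 1).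
apply: (@is_derive_quadratic _ _ _ _ _ _ (M * \int[mu]_(y in B) `|f y|)) => h h1.
rewrite convol_linear// -mulrA [X in M * X]mulrC mulrA.
pose psi y := rho (y - (x + h *: e i)) - rho (y - x) - h * (\- partial i rho) (y - x).
have mpsi : measurable_fun [set: V] psi.
  apply: measurable_funB; first apply: measurable_funB.
  - exact: (test_measurable (test_shift _ trho)).
  - exact: (test_measurable (test_shift _ trho)).
  - by apply: measurable_funM => //; exact: (test_measurable (test_shift x tN)).
apply: (integrable_mul_bounded If mpsi _ _).2 => y; rewrite /psi.
  have := taylor1_line (y - x) (- h) srho (fun z => (hM i i z).2).
  by rewrite sqrrN scaleNr opprD addrA/= mulNr mulrN.
move=> nz.
have ub (r' : R) z : enorm (y - z) < r' -> enorm y < r' + enorm z.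
  move=> yz; have := enormD (y - z) z; rewrite subrK => /le_lt_trans; apply.
  by rewrite ltrD2r.
have xh : enorm (x + h *: e i) <= enorm x + 1.
  by apply: (le_trans (enormD _ _)); rewrite lerD2l enormZ enorm_delta mulr1.
have [E1|/hr1/ub] := eqVneq (rho (y - (x + h *: e i))) 0; last first.
  by move=> h2; move: xh h2 r10 r20; lra.
have x0 := enorm_ge0 x.
have [E2|/hr1/ub] := eqVneq (rho (y - x)) 0; last by move: x0 r10 r20; lra.
have [E3|/hr2/ub] := eqVneq (partial i rho (y - x)) 0; last by move: x0 r10 r20; lra.
by exfalso; move/eqP: nz; apply; rewrite E1 E2/= E3 !(oppr0, mulr0, addr0).
Qed.

Definition neg_partials s rho := foldr (fun i g => \- partial i g) rho s.

Lemma test_neg_partials s rho : test_function rho -> test_function (neg_partials s rho).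
Proof. by move=> t; elim: s => //= i s IH; apply/testN/test_partial. Qed.

Lemma neg_partialsE s rho : smooth rho ->
  neg_partials s rho = fun x => (-1) ^+ size s * foldr partial rho s x.
Proof.
move=> sr; elim: s => [|i s IH] /=; first by apply/funext => x; rewrite expr0 mul1r.
apply/funext => x; rewrite IH exprS mulN1r mulNr; congr (- _).
have := @partialM _ _ i (cst ((-1) ^+ size s)) (foldr partial rho s).
move=> -> => [|y|y]; last first.
- by have [_] := sr s; exact.
- exact: derivable_cst.
by rewrite /= partial_cst mul0r addr0.
Qed.

Lemma foldr_partial_convol f rho s : ball_integrable f -> test_function rho ->
  foldr partial (convol f rho) s = convol f (neg_partials s rho).
Proof.
move=> If trho; elim: s => //= i s ->; apply/funext => x.
by rewrite /partial; have [_ ->] := convol_derive x i If (test_neg_partials s trho).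
Qed.

Lemma convol_smooth f rho : ball_integrable f -> test_function rho -> smooth (convol f rho).
Proof.
move=> If trho s; rewrite foldr_partial_convol//.
have t := test_neg_partials s trho.
split=> [|x i]; first exact: convol_continuous.
by have [] := convol_derive x i If t.
Qed.

(** The translated kernel is a test function; the sign in the definition of the weak derivative
    cancels that of [neg_partials]. *)
Lemma convol_weak_partial alpha u g rho : ball_integrable u -> test_function rho ->
  is_weak_partial alpha u g -> foldr partial (convol u rho) (mi_seq alpha) = convol g rho.
Proof.
move=> Iu trho [_ _ ug]; rewrite foldr_partial_convol//; apply/funext => x.
have [srho _] := trho.
rewrite /convol neg_partialsE//.
have := ug _ (test_shift x trho); rewrite partial_miE.
have -> : foldr partial (fun y => rho (y - x)) (mi_seq alpha) =
    fun y => foldr partial rho (mi_seq alpha) (y - x).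
  have -> : (fun y => rho (y - x)) = (fun y => rho (1 *: y + - x)).
    by apply/funext => y; rewrite scale1r.
  by rewrite foldr_partial_affine//; apply/funext => y; rewrite expr1n mul1r scale1r.
rewrite size_mi_seq => E.
have I : mu.-integrable setT
    (EFin \o (fun y => u y * foldr partial rho (mi_seq alpha) (y - x))).
  by apply: integrable_mul_test => //; apply: test_shift; exact: test_foldr_partial.
under eq_Rintegral do rewrite mulrCA.
rewrite RintegralZl// E mulrA -exprD addnn -mul2n exprM sqrrN !expr1n mul1r.
by [].
Qed.

End convolution.

(** * Local integrability and integration by parts *)

Section local_integrability.
Context {R : realType} {n : nat}.
Local Notation V := 'rV[R]_n.
Local Notation mu := (@lebesgue_rV R n).
Implicit Types (f g u rho phi : V -> R) (x h : V).

Lemma loc_integrableP f : loc_integrable f <-> ball_integrable f.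
Proof.
split=> [If|[mf If] K cK].
  have Ib r : mu.-integrable (eball 0 r) (EFin \o f).
    have cK : compact (closure (eball (0 : V) r)).
      (* Presenting the ball as the nonzero set of its indicator makes its closure a [supp], which
         [bounded_supp] shows to be compact. *)
      have -> : eball (0 : V) r = [set x | (\1_(eball (0 : V) r) x : R) != 0].
        apply/seteqP; split=> x /=; rewrite indicE.
          by move=> xr; rewrite mem_set// oner_eq0.
        by have [/[!inE]|] := boolP (x \in _); rewrite ?eqxx.
      apply: (@bounded_supp _ _ _ r) => x /=; rewrite indicE.
      have [/[!inE]|] := boolP (x \in _); rewrite ?eqxx// /eball/= subr0 => /ltW//.
    have mC : measurable (closure (eball (0 : V) r)).
      by apply: closed_measurable_rV; exact: closed_closure.
    apply: (integrableS mC (measurable_eball _ _) (@subset_closure _ _)).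
    exact: If.
  split=> //.
  have -> : [set: V] = \bigcup_k eball 0 k%:R.
    apply/seteqP; split=> // x _; have [k] := archi_boundP (enorm_ge0 x).
    by exists (Num.bound (enorm x)) => //; rewrite /eball/= subr0 archi_boundP ?enorm_ge0.
  apply/measurable_fun_bigcup => [k|k]; first exact: measurable_eball.
  by have /integrableP[/measurable_EFinP] := Ib k%:R.
have [M [_ HM]] := compact_bounded cK.
have mK : measurable K.
  by apply: closed_measurable_rV; apply: compact_closed => //; exact: norm_hausdorff.
apply: (integrableS (measurable_eball 0 (n.+1%:R * (`|M| + 1))) mK _ (If _)).
move=> x Kx; rewrite /eball/= subr0; apply: (le_lt_trans (enorm_le_mx _)).
apply: (@le_lt_trans _ _ (n%:R * (`|M| + 1))).
  rewrite ler_wpM2l//; apply: (HM (`|M| + 1)) => //.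
  by rewrite (le_lt_trans (ler_norm M))// ltrDl.
by rewrite ltr_pM2r ?ltr_nat// ltr_pwDr.
Qed.

Lemma ball_integrable_cst (c : R) : ball_integrable (cst c : V -> R).
Proof. by split=> [|r]; [exact: measurable_cst|exact: integrable_cst_ball]. Qed.

Lemma Ip_ball_integrable p u : 1 <= p -> measurable_fun [set: V] u ->
  (Ip mu p setT u < +oo)%E -> ball_integrable u.
Proof. by move=> p1 mu_ Iu; split=> // r; exact: Ip_integrable_ball Iu. Qed.

Lemma test_integrable phi : test_function phi -> mu.-integrable setT (EFin \o phi).
Proof.
move=> t; have := integrable_mul_test (ball_integrable_cst 1) t.
by under [X in integrable _ _ (_ \o X)]eq_fun do rewrite /= mul1r.
Qed.

Lemma test_ball_integrable phi : test_function phi -> ball_integrable phi.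
Proof.
move=> t; split=> [|r]; first exact: test_measurable.
apply: (integrableS measurableT (measurable_eball _ _) (@subsetT _ _)).
exact: test_integrable.
Qed.

Lemma ball_integrableB u g : ball_integrable u -> ball_integrable g ->
  ball_integrable (u \- g)%R.
Proof.
move=> [mu_ Iu] [mg Ig]; split=> [|r]; first exact: measurable_funB.
by have := integrableB (measurable_eball 0 r) (Iu r) (Ig r).
Qed.

Lemma Rintegral_shift f h : measurable_fun [set: V] f ->
  \int[mu]_x f (x + h) = \int[mu]_x f x.
Proof.
move=> mf; have mfE : measurable_fun [set: V] (EFin \o f) by exact/measurable_EFinP.
have Hp := @ge0_integral_shift R n h _ setT measurableT (measurable_funepos mfE)
  (fun x _ => funepos_ge0 (EFin \o f) x).
have Hn := @ge0_integral_shift R n h _ setT measurableT (measurable_funeneg mfE)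
  (fun x _ => funeneg_ge0 (EFin \o f) x).
rewrite preimage_setT in Hp Hn.
rewrite /Rintegral; congr fine; rewrite [RHS]integralE [LHS]integralE.
rewrite -/(EFin \o f) [in RHS]Hp [in RHS]Hn.
have -> : (fun x : V => (f (x + h))%:E) = (EFin \o f) \o (fun x => x + h) by [].
by rewrite funepos_comp funeneg_comp.
Qed.

(** The convolution of the constant 1 with [phi] is constant, so its derivative, which is minus this
    integral, vanishes. *)
Lemma integral_partial_test phi i : test_function phi ->
  \int[mu]_x partial i phi x = 0.
Proof.
move=> t.
have E : convol (cst 1) phi = cst (\int[mu]_y phi y).
  apply/funext => x; rewrite /convol/=; under eq_Rintegral do rewrite mul1r.
  by rewrite (@Rintegral_shift phi (- x))//; exact: test_measurable.
have [_] := convol_derive (0 : V) i (ball_integrable_cst 1) t.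
rewrite E derive_cst /convol => /esym.
under eq_Rintegral do rewrite /= mul1r subr0 -mulN1r.
rewrite RintegralZl//; last by apply: test_integrable; exact: test_partial.
by rewrite mulN1r => /eqP; rewrite oppr_eq0 => /eqP.
Qed.

Lemma integral_by_parts phi psi i : smooth phi -> test_function psi ->
  \int[mu]_x (phi x * partial i psi x) = - \int[mu]_x (partial i phi x * psi x).
Proof.
move=> sphi tpsi; have [spsi _] := tpsi.
apply/eqP; rewrite -addr_eq0; apply/eqP.
have := integral_partial_test i (test_smoothM sphi tpsi).
rewrite partialM => [|x|x]; try exact: smooth_derivable.
rewrite RintegralD//; apply: test_integrable.
  exact: (test_smoothM sphi (test_partial i tpsi)).
exact: (test_smoothM (smooth_partial i sphi) tpsi).
Qed.

Lemma integral_by_parts_foldr phi psi s : smooth phi -> test_function psi ->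
  \int[mu]_x (phi x * foldr partial psi s x) =
  (-1) ^+ size s * \int[mu]_x (foldr partial phi s x * psi x).
Proof.
move=> + tpsi; elim: s phi => [|i s IH] phi sphi /=; first by rewrite expr0 mul1r.
rewrite integral_by_parts//; last exact: test_foldr_partial.
by rewrite IH ?foldr_partialC ?exprS ?mulN1r ?mulNr//; exact: smooth_partial.
Qed.

Lemma test_weak_partial alpha phi : test_function phi ->
  is_weak_partial alpha phi (partial_mi alpha phi).
Proof.
move=> t; have [s _] := t; split.
- by apply/loc_integrableP; exact: test_ball_integrable.
- rewrite partial_miE; apply/loc_integrableP; apply: test_ball_integrable.
  exact: test_foldr_partial.
- by move=> psi tpsi; rewrite !partial_miE integral_by_parts_foldr// size_mi_seq.
Qed.

Lemma weak_partialB alpha u1 u2 g1 g2 : is_weak_partial alpha u1 g1 ->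
  is_weak_partial alpha u2 g2 -> is_weak_partial alpha (u1 \- u2) (g1 \- g2).
Proof.
move=> [/loc_integrableP Iu1 /loc_integrableP Ig1 H1]
  [/loc_integrableP Iu2 /loc_integrableP Ig2 H2].
split; [exact/loc_integrableP/ball_integrableB|exact/loc_integrableP/ball_integrableB|].
move=> phi tphi.
have tp : test_function (partial_mi alpha phi).
  by rewrite partial_miE; exact: test_foldr_partial.
under eq_Rintegral do rewrite /= mulrBl.
rewrite RintegralB//; try exact: integrable_mul_test.
rewrite H1// H2// -mulrBr; congr (_ * _).
rewrite -RintegralB//; try exact: integrable_mul_test.
by apply: eq_Rintegral => x _; rewrite /= mulrBl.
Qed.

End local_integrability.

Section mollifier.
Context {R : realType} {n : nat}.
Local Notation V := 'rV[R]_n.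
Local Notation mu := (@lebesgue_rV R n).
Implicit Types (f g u w rho phi : V -> R) (x h : V).

(** Taken at scale [e] itself, so that the normalisation calls for no dilation formula; a bound of
    order $e^{-n}$ on its inverse is enough. *)
Definition bump_mass (e : R) : R := \int[mu]_y smooth_bump (e^-1 *: (y : V)).

Definition mollifier (e : R) (z : V) : R := (bump_mass e)^-1 * smooth_bump (e^-1 *: z).

Lemma bump_scale_test e : 0 < e -> test_function (fun z : V => smooth_bump (e^-1 *: z)).
Proof.
move=> e0; split.
  have -> : (fun z : V => smooth_bump (e^-1 *: z)) = (fun z => smooth_bump (e^-1 *: z + 0)).
    by apply/funext => z; rewrite addr0.
  by apply: smooth_affine; exact: bump_smooth.
apply: (@bounded_supp _ _ _ e) => x /bump_supp.
by rewrite enormZ gtr0_norm ?invr_gt0// ltr_pdivrMl// mulr1 => /ltW.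
Qed.

(** On the concentric ball of radius $e/2$ the scaled bump is at least the [m] of [bump_lower], and
    the volume of that ball is at least [ball_lower] times $(e/2)^n$. *)
Lemma bump_mass_lower : exists2 M, 0 < M & forall e, 0 < e ->
  0 < bump_mass e /\ (bump_mass e)^-1 <= M / e ^+ n.
Proof.
have [m m0 hm] := @bump_lower R n.
have b0 : 0 < @ball_lower R n := ball_lower_gt0.
exists (2 ^+ n / (m * @ball_lower R n)).
  by rewrite divr_gt0 ?exprn_gt0// mulr_gt0.
move=> e e0.
have t := bump_scale_test e0.
have I := test_integrable t.
have ge : m * (@ball_lower R n * (e / 2) ^+ n) <= bump_mass e.
  rewrite -lee_fin /bump_mass /Rintegral fineK; last exact: integrable_fin_num.
  have e2 : 0 < e / 2 by rewrite divr_gt0.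
  have mB : measurable (eball (0 : V) (e / 2)) by exact: measurable_eball.
  apply: (@le_trans _ _ (\int[mu]_(y in eball 0 (e / 2)) cst m%:E y)%E).
    rewrite integral_cst// EFinM; apply: lee_wpmul2l; first by rewrite lee_fin ltW.
    exact: lebesgue_eball_ge.
  have I' : measurable_fun [set: V] (fun y : V => (smooth_bump (e^-1 *: y))%:E).
    by apply/measurable_EFinP; exact: test_measurable.
  apply: (@le_trans _ _ (\int[mu]_(y in eball 0 (e / 2)) (smooth_bump (e^-1 *: y))%:E)%E).
    apply: ge0_le_integral => //.
    - by move=> y _; rewrite lee_fin ltW.
    - exact: measurable_funS I'.
    - move=> y; rewrite /eball/= subr0 => ye; rewrite lee_fin; apply: hm.
      rewrite enormZ gtr0_norm ?invr_gt0// ler_pdivrMl//; exact: ltW.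
  by apply: ge0_subset_integral => // y _; rewrite lee_fin bump_ge0.
have S0 : 0 < m * (@ball_lower R n * (e / 2) ^+ n).
  by rewrite mulr_gt0// mulr_gt0// exprn_gt0// divr_gt0.
have mass0 := lt_le_trans S0 ge.
split=> //.
have -> : 2 ^+ n / (m * @ball_lower R n) / e ^+ n =
    (m * (@ball_lower R n * (e / 2) ^+ n))^-1.
  rewrite expr_div_n; have := lt0r_neq0 b0.
  have : e ^+ n != 0 by rewrite gt_eqF// exprn_gt0.
  have : 2 ^+ n != 0 :> R by rewrite gt_eqF// exprn_gt0.
  set A := @ball_lower R n; set B := e ^+ n; set D := 2 ^+ n => D0 B0 A0.
  by field; rewrite D0 B0 A0 lt0r_neq0.
by rewrite lef_pV2// posrE.
Qed.

Lemma bump_mass_gt0 e : 0 < e -> 0 < bump_mass e.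
Proof. by move=> e0; have [M _ /(_ _ e0)[]] := bump_mass_lower. Qed.

Lemma mollifier_test e : 0 < e -> test_function (mollifier e).
Proof. by move=> e0; exact: (test_smoothM (smooth_cst _) (bump_scale_test e0)). Qed.

Lemma mollifier_ge0 e z : 0 < e -> 0 <= mollifier e z.
Proof. by move=> e0; rewrite mulr_ge0 ?bump_ge0// invr_ge0 ltW// bump_mass_gt0. Qed.

Lemma mollifier_supp e z : 0 < e -> mollifier e z != 0 -> enorm z < e.
Proof.
move=> e0; rewrite mulf_eq0 negb_or => /andP[_ /bump_supp].
by rewrite enormZ gtr0_norm ?invr_gt0// ltr_pdivrMl// mulr1.
Qed.

Lemma Rintegral_mollifier e x : 0 < e -> \int[mu]_y mollifier e (y - x) = 1.
Proof.
move=> e0; rewrite (@Rintegral_shift _ _ (mollifier e) (- x)); last first.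
  exact: (test_measurable (mollifier_test e0)).
rewrite RintegralZl//; last exact/test_integrable/bump_scale_test.
by rewrite mulVf// gt_eqF// bump_mass_gt0.
Qed.

Lemma foldr_partialZ (c : R) f s : smooth f ->
  foldr partial (fun x => c * f x) s = fun x => c * foldr partial f s x.
Proof.
move=> sf; elim: s => //= i s ->.
have := @partialM _ _ i (cst c) (foldr partial f s).
move=> -> => [|y|y]; last first.
- by have [_] := sf s; exact.
- exact: derivable_cst.
by apply/funext => x; rewrite /= partial_cst mul0r addr0.
Qed.

Lemma mollifier_bound s : exists2 M, 0 < M & forall e z, 0 < e ->
  `|foldr partial (mollifier e) s z| <= M / e ^+ (size s) / e ^+ n.
Proof.
have [M M0 hM] := bump_mass_lower.
have [N N0 hN] := test_bounded (test_foldr_partial s (@bump_test R n)).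
exists (M * (N + 1)); first by rewrite mulr_gt0// ltr_wpDl.
move=> e z e0; have [m0 mM] := hM e e0.
have sb : smooth (fun z : V => smooth_bump (e^-1 *: z)) by have [] := bump_scale_test e0.
rewrite /mollifier foldr_partialZ// normrM gtr0_norm ?invr_gt0//.
have -> : (fun z : V => smooth_bump (e^-1 *: z)) = (fun z => smooth_bump (e^-1 *: z + 0)).
  by apply/funext => y; rewrite addr0.
rewrite foldr_partial_affine; last exact: bump_smooth.
rewrite normrM normrX gtr0_norm ?invr_gt0// exprVn.
have en : 0 < e ^+ n by rewrite exprn_gt0.
have es : 0 < e ^+ size s by rewrite exprn_gt0.
apply: (@le_trans _ _ (M / e ^+ n * ((e ^+ size s)^-1 * (N + 1)))).
  apply: ler_pM => //.
  - by rewrite invr_ge0 ltW.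
  - by rewrite mulr_ge0// invr_ge0 ltW.
  - rewrite ler_wpM2l ?invr_ge0 ?(ltW es)//; apply: (le_trans (hN _)).
    by rewrite lerDl.
rewrite le_eqVlt; apply/orP; left; apply/eqP.
by move: (lt0r_neq0 en) (lt0r_neq0 es); set A := e ^+ n; set B := e ^+ _ => *; field; apply/andP.
Qed.

End mollifier.

Section mollification.
Context {R : realType} {n : nat}.
Local Notation V := 'rV[R]_n.
Local Notation mu := (@lebesgue_rV R n).
Implicit Types (f g u w rho phi : V -> R) (x h : V).

(** The exponent 1 is included for the sake of [weak_partial_unique]. *)
Lemma jensen_power_ge1 p (S : set V) f : 1 <= p -> measurable S -> (mu S < +oo)%E ->
  measurable_fun [set: V] f ->
  ((\int[mu]_(x in S) `|f x|%:E) `^ p <= mu S `^ (p - 1) * Ip mu p S f)%E.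
Proof.
rewrite le_eqVlt => /orP[/eqP<-|p1] mS Soo mf; last exact: jensen_power.
rewrite subrr poweRe0 mul1e poweRe1 ?integral_ge0// /Ip.
by under [leRHS]eq_integral do rewrite powRr1//.
Qed.

(** The mollifier has mass 1, so $w(x)$ goes under the integral; its support restricts the increment
    to $|h| < e$. *)
Lemma mollify_pointwise (M e : R) w x : 0 < e -> ball_integrable w ->
  (forall z : V, `|mollifier e z| <= M) ->
  (`|convol w (mollifier e) x - w x|%:E <=
    M%:E * \int[mu]_(h in eball 0 e) `|w (x + h)%R - w x|%:E)%E.
Proof.
move=> e0 Iw HM; have [mw _] := Iw.
have t : test_function (mollifier e : V -> R) := mollifier_test e0.
have tx := test_shift x t.
have M0 : 0 <= M := le_trans (normr_ge0 _) (HM 0).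
have I1 := integrable_mul_test Iw tx.
have I2 := integrable_mul_test (ball_integrable_cst (w x)) tx.
have mB : measurable (eball 0 e : set V) by exact: measurable_eball.
have -> : convol w (mollifier e) x - w x =
    \int[mu]_y ((w y - w x) * mollifier e (y - x)).
  have wx : w x = \int[mu]_y (w x * mollifier e (y - x)).
    by rewrite RintegralZl ?Rintegral_mollifier ?mulr1//; exact: test_integrable.
  rewrite [X in _ - X]wx /convol -RintegralB//.
  by apply: eq_Rintegral => y _; rewrite mulrBl.
have I3 : mu.-integrable setT (EFin \o (fun y => (w y - w x) * mollifier e (y - x))).
  have -> : (fun y => (w y - w x) * mollifier e (y - x)) =
      (fun y => w y * mollifier e (y - x)) \- (fun y => w x * mollifier e (y - x)).
    by apply/funext => y /=; rewrite mulrBl.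
  by have := integrableB measurableT I1 I2.
rewrite EFin_normr_Rintegral//; have /integrableP[m3 _] := I3.
apply: (le_trans (le_abse_integral mu measurableT m3)).
pose F z := `|w (z + x) - w x| * mollifier e z.
have mF : measurable_fun [set: V] F.
  apply: measurable_funM; last exact: (test_measurable t).
  apply: measurableT_comp => //; apply: measurable_funB => //.
  exact: measurable_comp_shift.
have -> : (\int[mu]_y `|(EFin \o (fun y => (w y - w x) * mollifier e (y - x))%R) y| =
    \int[mu]_y (F y)%:E)%E.
  have mF' := measurable_comp_shift (- x) mF.
  have F0 y : (0 <= (F (y - x))%:E)%E by rewrite lee_fin mulr_ge0// mollifier_ge0.
  have H := @ge0_integral_shift R n x (fun y => (F (y - x))%:E) setT measurableT
    (measurable_EFin_rV mF') (fun y _ => F0 y).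
  rewrite preimage_setT in H.
  have E : (\int[mu]_y (F (y + x - x)%R)%:E = \int[mu]_y (F y)%:E)%E.
    by apply: eq_integral => y _; rewrite addrK.
  rewrite -E -H; apply: eq_integral => y _.
  by rewrite /F/= subrK normrM (ger0_norm (mollifier_ge0 _ e0)).
have -> : (\int[mu]_y (F y)%:E = \int[mu]_(y in eball 0 e) (F y)%:E)%E.
  rewrite [RHS]integral_mkcond; apply: eq_integral => y _.
  rewrite /patch; case: ifPn => // /negP yB; congr (_%:E); rewrite /F.
  have -> : mollifier e y = 0; last by rewrite mulr0.
  by apply: contra_notP yB => /eqP /(mollifier_supp e0); rewrite inE /eball/= subr0.
have mw' : measurable_fun [set: V] (fun h : V => w (x + h) - w x).
  apply: measurable_funB => //.
  by under eq_fun do rewrite addrC; exact: measurable_comp_shift.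
have mwE : measurable_fun (eball 0 e : set V) (fun h : V => `|w (x + h)%R - w x|%:E).
  by apply/measurable_EFinP; apply: measurable_funS (measurableT_comp _ mw').
rewrite -ge0_integralZl//.
apply: ge0_le_integral => //.
- by move=> y _; rewrite lee_fin mulr_ge0// mollifier_ge0.
- exact: measurable_EFin_rV.
- exact: measurable_funeM.
- move=> y _; rewrite -EFinM lee_fin /F mulrC [y + x]addrC ler_wpM2r//.
  by have := HM y; rewrite ger0_norm// mollifier_ge0.
Qed.

(** The kernel bound $e^{-n}$ to the power [p] meets the volume of $B(0,e)$ to the power $p - 1$
    from Jensen's inequality and once more from integrating over increments, so [M] is independent
    of [e]. *)
Lemma mollify_close : exists2 M : R, 0 < M & forall (p : R) w (e : R) (eta : \bar R),
  1 <= p -> 0 < e -> ball_integrable w -> (0 <= eta)%E ->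
  (forall h, enorm h < e -> (Ip mu p setT (fun x => (w (x + h) - w x)%R) <= eta)%E) ->
  (Ip mu p setT (convol w (mollifier e) \- w)%R <= (M `^ p)%:E * eta)%E.
Proof.
have [m m0 hm] := @mollifier_bound R n [::].
exists (m * 2 ^+ n); first by rewrite mulr_gt0// exprn_gt0.
move=> p w e eta p1 e0 Iw eta0 H; have [mw _] := Iw.
have p0 : 0 < p by exact: lt_le_trans p1.
have t : test_function (mollifier e : V -> R) := mollifier_test e0.
pose B := eball (0 : V) e.
have mB : measurable B by exact: measurable_eball.
pose v := fine (mu B).
have v0 : 0 < v by exact: fine_eball_gt0.
have vE : mu B = v%:E by rewrite fineK// lebesgue_eball_fin.
have en0 : 0 < e ^+ n by rewrite exprn_gt0.
have a0 : 0 <= m / e ^+ n by rewrite divr_ge0 ?ltW.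
pose k := (m / e ^+ n) `^ p * v `^ (p - 1).
have k0 : 0 <= k by rewrite mulr_ge0 ?powR_ge0.
have pt x : ((`|(convol w (mollifier e) \- w)%R x| `^ p)%:E <=
    k%:E * \int[mu]_(h in B) diff_power p w (x, h))%E.
  have hM (z : V) : `|mollifier e z| <= m / e ^+ n.
    by have := hm e z e0; rewrite /= expr0 divr1.
  have := mollify_pointwise x e0 Iw hM.
  have mw' : measurable_fun [set: V] (fun h : V => w (x + h) - w x).
    apply: measurable_funB => //.
    by under eq_fun do rewrite addrC; exact: measurable_comp_shift.
  have J := jensen_power_ge1 p1 mB _ mw'.
  move: J; rewrite vE ltry poweR_EFin => /(_ isT) J.
  set I := (\int[mu]_(h in eball 0 e) _)%E => HI.
  have I0 : (0 <= I)%E by exact: integral_ge0.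
  have -> : ((`|(convol w (mollifier e) \- w)%R x| `^ p)%:E =
      `|(convol w (mollifier e) x - w x)%R|%:E `^ p)%E by rewrite poweR_EFin.
  apply: (@le_trans _ _ (((m / e ^+ n)%:E * I) `^ p)%E).
    apply: gt0_ler_poweR => //; first exact: ltW.
    - by rewrite in_itv/= leey lee_fin normr_ge0.
    - by rewrite in_itv/= leey andbT mule_ge0// lee_fin.
  rewrite poweRM// poweR_EFin /k EFinM -muleA; apply: lee_wpmul2l.
    by rewrite lee_fin powR_ge0.
  exact: J.
have mD := measurable_diff_power_inner p mw mB.
apply: (@le_trans _ _ (k%:E * \int[mu]_x \int[mu]_(h in B) diff_power p w (x, h))%E).
  rewrite -ge0_integralZl//; last first.
    by move=> x _; apply: integral_ge0 => h _; exact: diff_power_ge0.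
  apply: ge0_le_integral => //.
  - apply: measurable_powR_norm; apply: measurable_funB => //.
    by apply: continuous_measurable_rV; exact: convol_continuous.
  - exact: measurable_funeM.
rewrite (tonelli_sets mu mu)//; [|exact: measurable_diff_power|exact: diff_power_ge0].
apply: (@le_trans _ _ (k%:E * (eta * mu B))%E).
  apply: lee_wpmul2l => //.
  rewrite -integral_cst//; apply: ge0_le_integral => //.
  - by move=> h _; apply: integral_ge0 => x _; exact: diff_power_ge0.
  - have mFp' : measurable_fun [set: V * V] (diff_power p w \o (fun z : V * V => (z.2, z.1))).
      apply: measurableT_comp; first exact: measurable_diff_power.
      exact: measurable_fun_pair.
    have := measurable_inner_integral mu measurableT mFp' (fun z => diff_power_ge0 _ _ _).
    exact: measurable_funS.
  - by move=> h; rewrite /B/eball/= subr0 => /H.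
rewrite vE [(eta * _)%E]muleC muleA -EFinM; apply: lee_wpmul2r => //.
rewrite lee_fin /k -mulrA.
have -> : v `^ (p - 1) * v = v `^ p.
  by rewrite -{2}(powRr1 (ltW v0)) -powRD ?subrK// (gt_eqF v0) implybT.
rewrite -powRM ?(ltW v0)//; apply: ge0_ler_powR; rewrite ?nnegrE ?(ltW p0)//.
- by rewrite mulr_ge0 ?(ltW v0).
- by rewrite mulr_ge0 ?(ltW m0)// exprn_ge0.
have : v <= (2 * e) ^+ n by rewrite -lee_fin -vE lebesgue_eball_le// ltW.
move=> /(ler_wpM2l a0)/le_trans; apply.
rewrite exprMn; move: (lt0r_neq0 en0); set X := e ^+ n; set Y := 2 ^+ n => X0.
by rewrite (_ : m / X * (Y * X) = m * Y)//; field.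
Qed.

Lemma mollify_Lp p u eps : 1 <= p -> measurable_fun [set: V] u ->
  (Ip mu p setT u < +oo)%E -> 0 < eps ->
  exists2 delta, 0 < delta & forall e, 0 < e < delta ->
    (Ip mu p setT (convol u (mollifier e) \- u)%R <= eps%:E)%E.
Proof.
move=> p1 mu_ Iu eps0; have p0 : 0 < p by exact: lt_le_trans p1.
have [M M0 HM] := mollify_close.
have Mp : 0 < M `^ p by exact: powR_gt0.
have [_ H] := translation_continuous_Lp p0 mu_ Iu.
have [delta d0 Hd] := H _ (divr_gt0 eps0 Mp).
exists delta => // e /andP[e0 ed].
have Iu' := Ip_ball_integrable p1 mu_ Iu.
apply: (le_trans (HM p u e (eps / M `^ p)%:E p1 e0 Iu' _ _)).
- by rewrite lee_fin ltW// divr_gt0.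
- by move=> h he; apply: Hd; exact: lt_trans ed.
- by rewrite -EFinM lee_fin mulrC divfK// gt_eqF.
Qed.

(** The difference [g] integrates to 0 against test functions. Truncated to $B(0, N+1)$ it is
    integrable, and its mollifications at scales below 1 vanish on $B(0,N)$, where the truncation is
    not felt; since they converge in $L^1$, [g] is 0 almost everywhere there. *)
Lemma weak_partial_unique alpha u g1 g2 : is_weak_partial alpha u g1 ->
  is_weak_partial alpha u g2 -> {ae mu, forall x, g1 x = g2 x}.
Proof.
move=> [_ /loc_integrableP Ig1 H1] [_ /loc_integrableP Ig2 H2].
pose g := (g1 \- g2)%R.
have Ig : ball_integrable g by exact: ball_integrableB.
have [mg Ig'] := Ig.
have g0 phi : test_function phi -> \int[mu]_x (g x * phi x) = 0.
  move=> t; have E : \int[mu]_x (g1 x * phi x) = \int[mu]_x (g2 x * phi x).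
    have := H1 _ t; rewrite (H2 _ t) => /(mulfI _) -> //.
    by rewrite expf_neq0// oppr_eq0 oner_neq0.
  under eq_Rintegral do rewrite /g/= mulrBl.
  by rewrite RintegralB ?E ?subrr//; exact: integrable_mul_test.
have gB (N : nat) : {ae mu, forall x, eball 0 N%:R x -> g x = 0}.
  pose B := eball (0 : V) (N%:R + 1).
  have mB : measurable B by exact: measurable_eball.
  have mBN : measurable (eball 0 N%:R : set V) by exact: measurable_eball.
  pose w (x : V) : R := g x * \1_B x.
  have mw : measurable_fun [set: V] w.
    by apply: measurable_funM => //; exact: measurable_indic.
  have Iw : (Ip mu 1 setT w < +oo)%E.
    have /integrableP[_] := Ig' (N%:R + 1); rewrite integral_mkcond /Ip.
    congr (_ < _)%E; apply: eq_integral => x _.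
    rewrite /w /patch indicE; case: ifP => _; rewrite ?mulr1 ?mulr0 powRr1//.
    by rewrite normr0.
  have : Ip mu 1 (eball 0 N%:R) g = 0%E.
    apply/eqP; rewrite eq_le Ip_ge0 andbT; apply/lee_addgt0Pr => eps eps0.
    rewrite add0e.
    have [d d0 Hd] := mollify_Lp (lexx 1) mw Iw eps0.
    pose e := Num.min (d / 2) (2^-1).
    have e0 : 0 < e by rewrite lt_min divr_gt0//= invr_gt0.
    have ed : 0 < e < d.
      rewrite e0 /= (@le_lt_trans _ _ (d / 2)) ?ge_min ?lexx//.
      by rewrite ltr_pdivrMr// ltr_pMr// ltr1n.
    have e1 : e < 1.
      by rewrite (@le_lt_trans _ _ 2^-1) ?ge_min ?lexx ?orbT// invf_lt1// ltr1n.
    apply: le_trans (Hd e ed).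
    have mc : measurable_fun [set: V] (convol w (mollifier e) \- w)%R.
      apply: measurable_funB => //; apply: continuous_measurable_rV.
      apply: convol_continuous; last exact: mollifier_test.
      exact: (Ip_ball_integrable (lexx 1) mw Iw).
    apply: le_trans (Ip_subset mu 1 mBN measurableT mc (@subsetT _ _)).
    rewrite (@eq_Ip _ _ _ _ _ _ g (convol w (mollifier e) \- w)%R)// => x.
    rewrite /eball/= subr0 => xN.
    have -> : convol w (mollifier e) x = 0.
      rewrite -[RHS](g0 _ (test_shift x (mollifier_test e0))).
      apply: eq_Rintegral => y _; rewrite /w indicE.
      have [yB|/negP yB] := boolP (y \in B); first by rewrite mulr1.
      have -> : mollifier e (y - x) = 0; last by rewrite !mulr0.
      apply: contra_notP yB => /eqP /(mollifier_supp e0) yx.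
      rewrite inE /B/eball/= subr0; have := enormD (y - x) x; rewrite subrK.
      move=> /le_lt_trans; apply; rewrite addrC; apply: ltrD => //.
      exact: lt_trans yx e1.
    rewrite sub0r normrN /w indicE mem_set ?mulr1// /B/eball/= subr0.
    by apply: (lt_trans xN); rewrite ltrDl.
  by move=> /(Ip_eq0 ltr01 mBN mg).
have : {ae mu, forall x, forall N : nat, eball 0 N%:R x -> g x = 0}.
  exact/ae_foralln.
apply: filterS => x Hx; apply/eqP; rewrite -subr_eq0; apply/eqP.
by apply: (Hx (Num.bound (enorm x))); rewrite /eball/= subr0 archi_boundP ?enorm_ge0.
Qed.

End mollification.

(** * Cutoffs and density of test functions *)

Section leibniz.
Context {R : realType} {n : nat}.
Local Notation V := 'rV[R]_n.
Local Notation mu := (@lebesgue_rV R n).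
Implicit Types (f g u w theta phi : V -> R) (x h : V) (s : seq 'I_n).

(** The $2^{|s|}$ ways of letting each derivative fall on one of two factors, listed with repetition
    in place of binomial coefficients. *)
Fixpoint splits s : seq (seq 'I_n * seq 'I_n) :=
  if s is i :: s' then
    [seq (i :: ab.1, ab.2) | ab <- splits s'] ++ [seq (ab.1, i :: ab.2) | ab <- splits s']
  else [:: ([::], [::])].

Lemma size_splits s ab : ab \in splits s -> (size ab.1 + size ab.2)%N = size s.
Proof.
elim: s ab => [|i s IH] ab /=; first by rewrite inE => /eqP ->.
by rewrite mem_cat => /orP[] /mapP[c /IH <- ->]; rewrite ?addSn ?addnS.
Qed.

Lemma foldr_partialM s theta f : smooth theta -> smooth f ->
  foldr partial (theta \* f) s = fun x =>
    \sum_(ab <- splits s) foldr partial theta ab.1 x * foldr partial f ab.2 x.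
Proof.
move=> st sf; elim: s => [|i s IH] /=; first by apply/funext => x; rewrite big_seq1.
rewrite IH; apply/funext => x.
rewrite big_cat/= !big_map -big_split/=.
(* An arbitrary list of pairs, so that the sum can be differentiated by induction on the list. *)
have : forall l : seq (seq 'I_n * seq 'I_n),
    derivable (fun x => \sum_(ab <- l) foldr partial theta ab.1 x * foldr partial f ab.2 x)
      x (delta_mx ord0 i) /\
    partial i (fun x => \sum_(ab <- l) foldr partial theta ab.1 x * foldr partial f ab.2 x) x =
    \sum_(ab <- l) (foldr partial theta (i :: ab.1) x * foldr partial f ab.2 x +
      foldr partial theta ab.1 x * foldr partial f (i :: ab.2) x).
  elim=> [|ab l [IHd IHe]].
    rewrite big_nil; under eq_fun do rewrite big_nil.
    by split; [exact: derivable_cst|rewrite /partial derive_cst].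
  have dt : derivable (foldr partial theta ab.1) x (delta_mx ord0 i).
    exact: (smooth_derivable (smooth_foldr_partial ab.1 st)).
  have df : derivable (foldr partial f ab.2) x (delta_mx ord0 i).
    exact: (smooth_derivable (smooth_foldr_partial ab.2 sf)).
  have dM := derivableM dt df.
  rewrite big_cons -IHe; under eq_fun do rewrite big_cons.
  split; first exact: derivableD dM IHd.
  rewrite /partial (deriveD dM IHd); congr (_ + _).
  by rewrite (deriveM dt df) /= addrC /GRing.scale/= [X in X + _]mulrC.
by move=> /(_ (splits s))[_ ->].
Qed.

Lemma measurable_foldr_partial f s : smooth f -> measurable_fun [set: V] (foldr partial f s).
Proof. by move=> sf; apply: continuous_measurable_rV; have [] := sf s. Qed.

Definition leibniz_const (p : R) s : R := (2 `^ p) ^+ size (splits s).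

Lemma Ip_leibniz (p : R) theta f s (S : set V) (B : seq 'I_n -> R) : 0 < p ->
  smooth theta -> smooth f -> measurable S ->
  (forall a x, `|foldr partial theta a x| <= B a) ->
  (forall a x, ~ S x -> foldr partial theta a x = 0) ->
  (Ip mu p setT (foldr partial (theta \* f)%R s) <= (leibniz_const p s)%:E *
    \sum_(ab <- splits s) (B ab.1 `^ p)%:E * Ip mu p S (foldr partial f ab.2))%E.
Proof.
move=> p0 st sf mS tB tS; rewrite foldr_partialM//.
have mt a := measurable_foldr_partial a st.
have mf a := measurable_foldr_partial a sf.
pose F (ab : seq 'I_n * seq 'I_n) x := foldr partial theta ab.1 x * foldr partial f ab.2 x.
have mF ab : measurable_fun [set: V] (F ab) by exact: measurable_funM.
have L0 : 0 <= leibniz_const p s by rewrite exprn_ge0// powR_ge0.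
apply: (@le_trans _ _ (\int[mu]_x ((leibniz_const p s)%:E *
    \sum_(ab <- splits s) (`|F ab x| `^ p)%:E))%E).
  apply: ge0_le_integral => //.
  - by apply: measurable_powR_norm; exact: measurable_sum.
  - apply: measurable_funeM; apply: emeasurable_sum => ab.
    exact: measurable_powR_norm.
  - move=> x _; rewrite sumEFin -EFinM lee_fin.
    exact: (powR_norm_sum (splits s) (fun ab => F ab x)).
rewrite ge0_integralZl//; first last.
- by move=> x _; apply: sume_ge0 => ab _; rewrite lee_fin powR_ge0.
- by apply: emeasurable_sum => ab; exact: measurable_powR_norm.
apply: lee_wpmul2l => //.
rewrite ge0_integral_sum//; last by move=> ab; exact: measurable_powR_norm.
apply: lee_sum => ab _; rewrite -/(Ip mu p setT (F ab)).
have B0 : 0 <= B ab.1 := le_trans (normr_ge0 _) (tB _ 0).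
rewrite -(ger0_norm B0) -IpZ ?(ltW p0)//.
rewrite /Ip [leRHS]integral_mkcond; apply: ge0_le_integral => //.
- exact: measurable_powR_norm.
- have mBf : measurable_fun [set: V] (fun x => B ab.1 * foldr partial f ab.2 x).
    exact: measurable_funM.
  have H := @measurable_powR_norm _ _ R p S _ mBf.
  exact: ((measurable_restrictT _ mS).1 H).
- move=> x _; rewrite patchE; case: ifPn => xS.
    rewrite lee_fin ge0_ler_powR ?nnegrE ?(ltW p0)//.
    by rewrite /F !normrM (ger0_norm B0) ler_wpM2r.
  rewrite /F tS ?mul0r ?normr0 ?powR0 ?gt_eqF//.
  by move: xS => /negP; rewrite inE.
Qed.

End leibniz.

Section cutoff.
Context {R : realType} {n : nat}.
Local Notation V := 'rV[R]_n.
Local Notation mu := (@lebesgue_rV R n).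
Implicit Types (A : set V) (x : V) (s : seq 'I_n).

Definition cutoff A (delta : R) : V -> R := convol (\1_A) (mollifier delta).

Lemma ball_integrable_indic A : measurable A -> ball_integrable (\1_A : V -> R).
Proof.
move=> mA; split=> [|r]; first exact: measurable_indic.
have mB : measurable (eball (0 : V) r) by exact: measurable_eball.
apply: (le_integrable mB _ _ (integrable_cst_ball 1 0 r)).
  by apply/measurable_EFinP; apply: (measurable_funS measurableT) => //; exact: measurable_indic.
move=> x _ /=; rewrite lee_fin indicE normr1.
by case: (_ \in _); rewrite ?normr1 ?normr0.
Qed.

Lemma cutoff_smooth A delta : measurable A -> 0 < delta -> smooth (cutoff A delta).
Proof.
move=> mA d0; apply: convol_smooth; first exact: ball_integrable_indic.
exact: mollifier_test.
Qed.

(** Derivatives live on the closed support, where only $|z| \le e$ is available; the factor 2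
    restores a strict bound. *)
Lemma foldr_mollifier_supp e s (z : V) : 0 < e ->
  foldr partial (mollifier e) s z != 0 -> enorm z < 2 * e.
Proof.
move=> e0 nz.
have : supp (mollifier e) z by apply: (@supp_foldr_partial _ _ s); exact: subset_closure.
move=> /(_ (eball z e)) [|y [/= /(mollifier_supp e0) ye zy]].
  by apply/nbhs_enormP; exists e.
have := enormD (z - y) y; rewrite subrK enormB => /le_lt_trans; apply.
by rewrite mulr_natl mulr2n; exact: ltrD.
Qed.

(** After the shift, the kernel is centred at 0 and [x] occurs only in the indicator, which makes
    the bounds uniform in [x] and [A]. *)
Lemma cutoff_partial A delta s x : measurable A -> 0 < delta ->
  foldr partial (cutoff A delta) s x =
  \int[mu]_y (\1_A (y + x) * ((-1) ^+ size s * foldr partial (mollifier delta) s y)).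
Proof.
move=> mA d0; have t : test_function (mollifier delta : V -> R) := mollifier_test d0.
have [st _] := t.
rewrite foldr_partial_convol//; last exact: ball_integrable_indic.
rewrite /convol neg_partialsE//.
pose F y := \1_A (y + x) * ((-1) ^+ size s * foldr partial (mollifier delta) s y).
have mF : measurable_fun [set: V] F.
  apply: measurable_funM.
    by apply: (measurable_comp_shift x (f := \1_A)); exact: measurable_indic.
  by apply: measurable_funM => //; exact: measurable_foldr_partial.
rewrite -[RHS](Rintegral_shift (- x) mF).
by apply: eq_Rintegral => y _; rewrite /F subrK.
Qed.

Lemma cutoff0 A delta s x : measurable A -> 0 < delta -> eball x (2 * delta) `&` A = set0 ->
  foldr partial (cutoff A delta) s x = 0.
Proof.
move=> mA d0 xA; rewrite cutoff_partial//.
rewrite (@eq_Rintegral _ _ _ _ _ (cst 0)) ?Rintegral_cst ?mul0r// => y _ /=.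
rewrite indicE; have [yA|yA] := boolP (y + x \in A); last by rewrite mul0r.
rewrite (_ : foldr partial (mollifier delta) s y = 0) ?mulr0//.
apply/eqP/negP => /negP /(foldr_mollifier_supp d0) y2.
suff : (eball x (2 * delta) `&` A) (y + x) by rewrite xA.
by split; [rewrite /eball/= addrK|rewrite inE in yA].
Qed.

Lemma cutoff1 A delta x : measurable A -> 0 < delta -> eball x delta `<=` A ->
  cutoff A delta x = 1.
Proof.
move=> mA d0 xA; rewrite -(@Rintegral_mollifier R n delta x d0) /cutoff /convol.
apply: eq_Rintegral => y _; rewrite indicE.
have [yA|/negP yA] := boolP (y \in A); first by rewrite mul1r.
rewrite mul0r; apply/esym; apply: contra_notP yA => /eqP /(mollifier_supp d0) yx.
by rewrite inE; exact: xA.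
Qed.

(** A derivative of the kernel is of size $\delta^{-|s|-n}$ on a ball of volume at most
    $(4\delta)^n$. *)
Lemma cutoff_bound : exists C : seq 'I_n -> R, forall A delta s x, measurable A ->
  0 < delta -> `|foldr partial (cutoff A delta) s x| <= C s / delta ^+ size s.
Proof.
have /choice[M HM] : forall s, exists M, 0 < M /\ forall e (z : V), 0 < e ->
    `|foldr partial (mollifier e) s z| <= M / e ^+ (size s) / e ^+ n.
  by move=> s; have [M M0 H] := @mollifier_bound R n s; exists M.
exists (fun s => M s * 4 ^+ n) => A delta s x mA d0.
have [M0 hM] := HM s.
rewrite cutoff_partial//.
have dn : 0 < delta ^+ n by rewrite exprn_gt0.
have ds : 0 < delta ^+ size s by rewrite exprn_gt0.
have mf : measurable_fun [set: V] (fun y => \1_A (y + x) : R).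
  by apply: (measurable_comp_shift x (f := \1_A)); exact: measurable_indic.
have le1 (y : V) : `|\1_A (y + x) : R| <= 1.
  by rewrite indicE; case: (_ \in _); rewrite ?normr1 ?normr0.
have If : ball_integrable (fun y => \1_A (y + x) : R).
  split=> // r; have mB : measurable (eball (0 : V) r) by exact: measurable_eball.
  apply: (le_integrable mB _ _ (integrable_cst_ball 1 0 r)).
    by apply/measurable_EFinP; exact: (measurable_funS measurableT).
  by move=> y _ /=; rewrite lee_fin normr1 le1.
have t : test_function (mollifier delta : V -> R) := mollifier_test d0.
have mg : measurable_fun [set: V]
    (fun y => (-1) ^+ size s * foldr partial (mollifier delta) s y).
  apply: measurable_funM => //; apply: measurable_foldr_partial.
  by have [] := t.
pose g y := (-1) ^+ size s * foldr partial (mollifier delta) s y.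
have gM y : `|g y| <= M s / delta ^+ size s / delta ^+ n.
  by rewrite normrM normrX normrN1 expr1n mul1r; exact: hM.
have gs y : g y != 0 -> enorm y < 2 * delta.
  by rewrite mulf_eq0 negb_or => /andP[_]; exact: foldr_mollifier_supp.
have [_ /le_trans] := integrable_mul_bounded If mg gM gs; apply.
have mB : measurable (eball (0 : V) (2 * delta)) by exact: measurable_eball.
apply: (@le_trans _ _ (M s / delta ^+ size s / delta ^+ n * (4 * delta) ^+ n)).
  rewrite ler_wpM2l//; first by rewrite !mulr_ge0 ?invr_ge0 ?ltW.
  apply: (@le_trans _ _ (\int[mu]_(y in eball 0 (2 * delta)) 1)).
    apply: le_Rintegral => //; last exact: (integrable_cst_ball 1 0 (2 * delta)).
    exact: (integrable_abse (If.2 (2 * delta))).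
  rewrite Rintegral_cst// mul1r -lee_fin fineK ?lebesgue_eball_fin//.
  have -> : 4 * delta = 2 * (2 * delta) by ring.
  by rewrite lebesgue_eball_le// mulr_ge0// ltW.
rewrite exprMn; move: (lt0r_neq0 dn) (lt0r_neq0 ds).
set X := delta ^+ n; set Y := delta ^+ _; set Z := 4 ^+ n => X0 Y0.
by rewrite le_eqVlt; apply/orP; left; apply/eqP; field; rewrite X0 Y0.
Qed.

End cutoff.

Section vanishing.
Context {d : measure_display} {T : measurableType d} {R : realType}.
Variable mu : {measure set T -> \bar R}.

(** Dominated convergence off the null set [D], each point of whose complement eventually leaves
    [S N]. *)
Lemma Ip_vanishing_sets (p : R) (f : T -> R) (D : set T) (S : nat -> set T) (e : R) :
  0 < p -> measurable_fun [set: T] f -> (Ip mu p setT f < +oo)%E ->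
  measurable D -> mu D = 0%E -> (forall N, measurable (S N)) ->
  (forall x, ~ D x -> \forall N \near \oo, ~ S N x) -> 0 < e ->
  \forall N \near \oo, (Ip mu p (S N) f <= e%:E)%E.
Proof.
move=> p0 mf If mD D0 mS SD e0.
pose v N x := f x * \1_(S N `\` D) x.
have mSD N : measurable (S N `\` D) by exact: measurableD.
have mv N : measurable_fun [set: T] (v N).
  by apply: measurable_funM => //; exact: measurable_indic.
have := @Ip_dominated _ _ _ mu p f v e p0 mf mv If.
have vE N x : v N x = if x \in S N `\` D then f x else 0.
  by rewrite /v indicE; case: ifP; rewrite ?mulr1 ?mulr0.
move=> /(_ _ _ e0) H.
apply: filterS (H _ _) => [N|N x|x].
- suff -> : Ip mu p (S N) f = Ip mu p setT (v N) by [].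
  rewrite /Ip [LHS]integral_mkcond; apply: ae_eq_integral => //.
  + apply: (measurable_restrictT _ (mS N)).1.
    exact: (@measurable_powR_norm _ _ R p (S N) _ mf).
  + exact: measurable_powR_norm.
  + exists D; split=> // x /= nx; apply: contrapT => Dx; apply: nx => _.
    rewrite patchE vE in_setD (memNset Dx) andbT.
    by case: ifP => // _; rewrite normr0 powR0// gt_eqF.
- by rewrite vE; case: ifP => // _; rewrite normr0.
- apply: cvg_near_cst; have [Dx|nDx] := pselect (D x).
    by apply: nearW => N; rewrite vE memNset// => -[].
  by apply: filterS (SD x nDx) => N nS; rewrite vE memNset// => -[].
Qed.

Lemma IpB_lty (p : R) (f g : T -> R) : 0 < p -> measurable_fun [set: T] f ->
  measurable_fun [set: T] g -> (Ip mu p setT f < +oo)%E -> (Ip mu p setT g < +oo)%E ->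
  (Ip mu p setT (f \- g)%R < +oo)%E.
Proof.
move=> p0 mf mg If Ig; apply: le_lt_trans (IpB _ (ltW p0) measurableT mf mg) _.
apply: lte_mul_pinfty; [by rewrite lee_fin powR_ge0|by []|exact: (lte_add_pinfty If Ig)].
Qed.

End vanishing.

Lemma near_weighted_sum_le {R : realType} (I : Type) (l : seq I) (c : I -> R)
    (T : Type) (F : set_system T) {FF : Filter F} (a : I -> T -> \bar R) :
  (forall i, 0 <= c i) -> (forall i t, (0 <= a i t)%E) ->
  (forall i e, 0 < e -> \forall t \near F, (a i t <= e%:E)%E) ->
  forall e, 0 < e ->
  \forall t \near F, (\sum_(i <- l) (c i)%:E * a i t <= e%:E)%E.
Proof.
move=> c0 a0 Ha; elim: l => [|i l IH] e e0.
  by apply: nearW => t; rewrite big_nil lee_fin ltW.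
have e2 : 0 < e / 2 by rewrite divr_gt0.
have ec : 0 < e / 2 / (c i + 1) by rewrite divr_gt0// ltr_wpDl.
have := Ha i _ ec; have := IH _ e2; apply: filterS2 => t h1 h2.
rewrite big_cons [e]splitr EFinD; apply: leeD => //.
apply: (@le_trans _ _ ((c i)%:E * (e / 2 / (c i + 1))%:E)%E).
  by apply: lee_wpmul2l => //; rewrite lee_fin.
rewrite -EFinM lee_fin mulrCA ger_pMr// ler_pdivrMr ?mul1r ?lerDl// ltr_wpDl//.
Qed.

(** * Density of test functions *)

Section density.
Context {R : realType} {n : nat}.
Local Notation V := 'rV[R]_n.
Local Notation mu := (@lebesgue_rV R n).
Implicit Types (u f phi : V -> R) (x : V) (s : seq 'I_n) (alpha : 'I_n -> nat).

Lemma foldr_partial_mi s f : smooth f ->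
  foldr partial f s = partial_mi (fun i => count_mem i s) f.
Proof.
move=> sf; rewrite partial_miE; apply: perm_foldr_partial => //.
by apply/allP => i _ /=; rewrite count_mi_seq.
Qed.

Lemma partial_miB alpha f g : smooth f -> smooth g ->
  partial_mi alpha (f \- g) = partial_mi alpha f \- partial_mi alpha g.
Proof.
move=> sf sg; rewrite !partial_miE (_ : f \- g = f \+ (\- g))//.
by rewrite (foldr_partialD _ sf (smoothN sg)) (foldr_partialN _ sg).
Qed.

Lemma mi_order_count s : mi_order (fun i => count_mem i s) = size s.
Proof.
rewrite -size_mi_seq; apply/esym/perm_size/allP => i _ /=.
by rewrite count_mi_seq.
Qed.

(** Multi-indices of order at most [k] take values in ['I_k.+1]; this finite encoding lets their
    eventual properties hold simultaneously. *)
Lemma near_multi_index (k : nat) (T : Type) (F : set_system T) {FF : Filter F}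
    (P : ('I_n -> nat) -> T -> Prop) :
  (forall alpha, (mi_order alpha <= k)%N -> \forall t \near F, P alpha t) ->
  \forall t \near F, forall alpha, (mi_order alpha <= k)%N -> P alpha t.
Proof.
move=> H.
have : \forall t \near F, forall a : {ffun 'I_n -> 'I_k.+1},
    (mi_order (fun i => a i) <= k)%N -> P (fun i => a i) t.
  apply: filter_forall => a; have [ak|_] := boolP (mi_order (fun i => a i) <= k)%N.
    by apply: filterS (H _ ak) => t Pt _.
  by apply: filterS filterT => t _.
apply: filterS => t Ht alpha ak.
have E : alpha = (fun i => [ffun i => inord (alpha i) : 'I_k.+1] i : nat).
  apply/funext => i; rewrite ffunE inordK// ltnS (leq_trans _ ak)//.
  by rewrite /mi_order (bigD1 i)//= leq_addr.
by rewrite E; apply: Ht; rewrite -E.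
Qed.

(** Derivatives of the kernel reach as far as [2 * N], so from the radius [3 * N] they do not meet
    $B(0,N)$. Beyond [4 * N] the function [theta] is 1, whence the compact support. *)
Lemma cutoff_at_infinity (N : R) : 0 < N ->
  let theta := cutoff (~` eball 0 (3 * N)) N : V -> R in
  [/\ smooth theta,
    forall s x, ~ (~` eball 0 N) x -> foldr partial theta s x = 0 &
    forall f, smooth f -> test_function (fun x => f x - theta x * f x)].
Proof.
move=> N0 theta.
have mA : measurable (~` eball (0 : V) (3 * N)).
  by apply: measurableC; exact: measurable_eball.
have st : smooth theta by exact: cutoff_smooth.
split; [exact: st|move=> s x xN|move=> f sf].
  apply: cutoff0 => //; apply/seteqP; split=> // y [xy]; apply.
  move: xN => /contrapT; move: xy; rewrite /eball/= !subr0 => xy xN.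
  have := enormD (y - x) x; rewrite subrK => /le_lt_trans; apply.
  by move: xy xN; lra.
split; first exact: smoothD sf (smoothN (smoothM st sf)).
apply: (@bounded_supp _ _ _ (4 * N)) => x; apply: contraNT; rewrite -ltNge => xN.
rewrite [theta x]cutoff1 ?mul1r ?subrr// => y xy; rewrite /eball/= subr0 => yN.
have := enormD (x - y) y; rewrite subrK enormB; move: xy; rewrite /eball/=.
by move: xN yN; lra.
Qed.

Variables (k : nat) (p : R) (u : V -> R) (g : ('I_n -> nat) -> V -> R).
Hypotheses (p1 : 1 <= p) (mu_ : measurable_fun [set: V] u) (Iu : (Ip mu p setT u < +oo)%E).
Hypothesis Hg : forall alpha, (mi_order alpha <= k)%N ->
  [/\ measurable_fun [set: V] (g alpha), (Ip mu p setT (g alpha) < +oo)%E &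
      is_weak_partial alpha u (g alpha)].

Let p0 : 0 < p. Proof. exact: lt_le_trans p1. Qed.

(** Weak derivatives commute with mollification, and one scale serves the finitely many
    multi-indices. *)
Lemma mollification_dense eps : 0 < eps -> exists f, smooth f /\
  forall alpha, (mi_order alpha <= k)%N ->
    (Ip mu p setT (partial_mi alpha f) < +oo)%E /\
    (Ip mu p setT (g alpha \- partial_mi alpha f)%R <= eps%:E)%E.
Proof.
move=> eps0.
have Iub := Ip_ball_integrable p1 mu_ Iu.
have [e [e0 He]] : exists e, 0 < e /\ forall alpha, (mi_order alpha <= k)%N ->
    (Ip mu p setT (convol (g alpha) (mollifier e) \- g alpha)%R <= eps%:E)%E.
  have : \forall e \near (0 : R)^'+, forall alpha, (mi_order alpha <= k)%N ->
      (Ip mu p setT (convol (g alpha) (mollifier e) \- g alpha)%R <= eps%:E)%E.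
    apply: near_multi_index => alpha /Hg[mg Ig _].
    have [delta d0 Hd] := mollify_Lp p1 mg Ig eps0.
    near=> e; apply: Hd; apply/andP; split.
      by near: e; exact: nbhs_right_gt.
    by near: e; exact: nbhs_right_lt.
  move=> H; have : \forall e \near (0 : R)^'+, 0 < e /\ forall alpha,
      (mi_order alpha <= k)%N ->
      (Ip mu p setT (convol (g alpha) (mollifier e) \- g alpha)%R <= eps%:E)%E.
    by near=> e; split; [near: e; exact: nbhs_right_gt|near: e; exact: H].
  by move=> /filter_ex.
have t : test_function (mollifier e : V -> R) := mollifier_test e0.
exists (convol u (mollifier e)); split; first exact: convol_smooth.
move=> alpha ak; have [mg Ig wg] := Hg ak.
have Igb := Ip_ball_integrable p1 mg Ig.
have E : partial_mi alpha (convol u (mollifier e)) = convol (g alpha) (mollifier e).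
  by rewrite partial_miE; exact: convol_weak_partial.
have mc : measurable_fun [set: V] (convol (g alpha) (mollifier e)).
  by apply: continuous_measurable_rV; exact: convol_continuous.
have H : (Ip mu p setT (g alpha \- convol (g alpha) (mollifier e))%R <= eps%:E)%E.
  rewrite -(IpN mu p setT); apply: le_trans (He _ ak).
  by rewrite le_eqVlt; apply/orP; left; apply/eqP; apply: eq_Ip => x _ /=; rewrite opprB.
rewrite E; split; last exact: H.
have -> : convol (g alpha) (mollifier e) =
    (g alpha \- (g alpha \- convol (g alpha) (mollifier e)))%R.
  by apply/funext => x /=; rewrite opprB addrC subrK.
exact: (IpB_lty p0 mg (measurable_funB mg mc) Ig (le_lt_trans H (ltry _))).
Unshelve. all: by end_near. Qed.

(** Mollification precedes truncation because the Leibniz formula is stated for smooth functions.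
    The discarded part [theta N \* f] only sees the tails of the derivatives of [f]. *)
Lemma test_dense eps : 0 < eps -> exists phi, test_function phi /\
  forall alpha, (mi_order alpha <= k)%N ->
    (Ip mu p setT (g alpha \- partial_mi alpha phi)%R <= eps%:E)%E.
Proof.
move=> eps0; have e1 := Ip_half_gt0 p eps0.
have [f [sf Hf]] := mollification_dense e1.
have [C HC] := @cutoff_bound R n.
pose theta (N : nat) : V -> R := cutoff (~` eball 0 (3 * N.+1%:R)) N.+1%:R.
have mA (r : R) : measurable (~` eball (0 : V) r).
  by apply: measurableC; exact: measurable_eball.
have mS (N : nat) : measurable (~` eball (0 : V) N.+1%:R) by exact: mA.
have tail s e : (size s <= k)%N -> 0 < e -> \forall N \near \oo,
    (Ip mu p (~` eball (0 : V) N.+1%:R) (foldr partial f s) <= e%:E)%E.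
  move=> sk e0.
  have [] := Hf (fun i => count_mem i s); first by rewrite mi_order_count.
  rewrite -foldr_partial_mi// => If _.
  have := @Ip_vanishing_sets _ _ _ mu p _ set0 _ e p0 (measurable_foldr_partial s sf) If
    measurable0 (measure0 _) mS.
  apply=> //.
  move=> x _; near=> N; apply; rewrite /eball/= subr0.
  apply: (@lt_trans _ _ N%:R); last by rewrite ltr_nat.
  by near: N; exact: nbhs_infty_gtr.
have [N HN] : exists N, forall alpha, (mi_order alpha <= k)%N ->
    (Ip mu p setT (partial_mi alpha (theta N \* f)%R) <= (eps / (2 `^ p * 2))%:E)%E.
  suff : \forall N \near \oo, forall alpha, (mi_order alpha <= k)%N ->
      (Ip mu p setT (partial_mi alpha (theta N \* f)%R) <= (eps / (2 `^ p * 2))%:E)%E.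
    by move=> /filter_ex.
  apply: near_multi_index => alpha ak.
  pose s := mi_seq alpha.
  have L0 : 0 < leibniz_const p s by rewrite exprn_gt0// powR_gt0.
  (* [near_weighted_sum_le] ranges over all pairs; the default 0 serves those of order above [k],
     which do not occur in [splits s]. *)
  pose a (ab : seq 'I_n * seq 'I_n) (N : nat) : \bar R :=
    if (size ab.2 <= k)%N then Ip mu p (~` eball (0 : V) N.+1%:R) (foldr partial f ab.2) else 0%E.
  have a0 ab N : (0 <= a ab N)%E by rewrite /a; case: ifP => // _; exact: Ip_ge0.
  have Ha ab e : 0 < e -> \forall N \near \oo, (a ab N <= e%:E)%E.
    move=> e0; have [h|h] := boolP (size ab.2 <= k)%N.
      by apply: filterS (tail _ _ h e0) => N; rewrite /a h.
    by apply: nearW => N; rewrite /a (negPf h) lee_fin ltW.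
  have := near_weighted_sum_le (splits s) (fun ab => powR_ge0 `|C ab.1| p) a0 Ha
    (divr_gt0 e1 L0).
  move=> H; apply: filterS (H _).
  move=> N HN; have N0 : 0 < N.+1%:R :> R by [].
  have [st tS _] := cutoff_at_infinity N0.
  rewrite partial_miE.
  apply: le_trans (@Ip_leibniz _ _ p (theta N) f s (~` eball (0 : V) N.+1%:R)
    (fun a => `|C a|) p0 st sf (mS N) _ tS) _.
    (* The cutoff has scale at least 1, so its derivatives are bounded independently of [N]. *)
    move=> b x; apply: (le_trans (HC _ _ b x (mA _) N0)).
    rewrite ler_pdivrMr ?exprn_gt0//; apply: (le_trans (ler_norm _)).
    by rewrite ler_peMr// exprn_ege1// ler1n.
  have -> : eps / (2 `^ p * 2) =
      leibniz_const p s * (eps / (2 `^ p * 2) / leibniz_const p s).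
    by rewrite [RHS]mulrC divfK// gt_eqF.
  rewrite [leRHS]EFinM; apply: lee_wpmul2l; first by rewrite lee_fin ltW.
  apply: le_trans HN; rewrite le_eqVlt; apply/orP; left; apply/eqP.
  rewrite big_seq [RHS]big_seq; apply: eq_bigr => ab abs; rewrite /a.
  rewrite ifT// (leq_trans _ ak)// -(size_mi_seq alpha) -(size_splits abs).
  by rewrite leq_addl.
have N0 : 0 < N.+1%:R :> R by [].
have [st _ tt] := cutoff_at_infinity N0.
exists (fun x => f x - theta N x * f x); split; first exact: tt.
move=> alpha ak; have [If Hfa] := Hf _ ak.
have stf : smooth (theta N \* f) by exact: smoothM.
have E : partial_mi alpha (fun x => f x - theta N x * f x) =
    partial_mi alpha f \- partial_mi alpha (theta N \* f).
  exact: partial_miB.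
have -> : (g alpha \- partial_mi alpha (fun x => f x - theta N x * f x)) =
    (g alpha \- partial_mi alpha f) \+ partial_mi alpha (theta N \* f).
  by apply/funext => x; rewrite E/=; ring.
have [mg _ _] := Hg ak.
have mf s : measurable_fun [set: V] (foldr partial f s) by exact: measurable_foldr_partial.
have mpf : measurable_fun [set: V] (partial_mi alpha f) by rewrite partial_miE.
have mpt : measurable_fun [set: V] (partial_mi alpha (theta N \* f)).
  by rewrite partial_miE; exact: measurable_foldr_partial.
exact: (Ip_le_add p0 measurableT (measurable_funB mg mpf) mpt Hfa (HN _ ak)).
Unshelve. all: by end_near. Qed.

End density.

(** * Sobolev functions *)

Section sobolev_translation.
Context {R : realType} {n : nat}.
Local Notation V := 'rV[R]_n.
Local Notation mu := (@lebesgue_rV R n).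
Local Notation e i := (delta_mx ord0 i : V).
Local Notation lambda := (@lebesgue_measure R).
Local Notation RR := (measurableTypeR R).
Implicit Types (w psi : V -> R) (dw : 'I_n -> V -> R) (x z h : V) (S : set V).
Variable p : R.
Hypothesis p1 : 1 < p.

Let p0 : 0 < p. Proof. exact: lt_trans p1. Qed.

Lemma is_derive_coord_line psi z i (t s : R) : smooth psi ->
  is_derive s 1 (fun s : R => psi (z + (s * t) *: e i))
    (partial i psi (z + (s * t) *: e i) * t).
Proof.
move=> spsi.
have d1 : is_derive s 1 (fun s : R => s * t) t.
  have -> : (fun s : R => s * t) = t \*: (@id R).
    by apply/funext => r /=; rewrite mulrC.
  by apply: is_derive_eq; rewrite /GRing.scale/= mulr1.
have d2 := is_derive_line (smooth_derivable (x := z + (s * t) *: e i) (i := i) spsi).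
exact: (@is_derive1_comp _ (fun r : R => psi (z + r *: e i)) (fun s : R => s * t)).
Qed.

Lemma continuous_coord_line psi z i (t : R) : smooth psi ->
  continuous (fun s : R => psi (z + (s * t) *: e i)).
Proof.
move=> spsi s; apply: differentiable_continuous; apply/derivable1_diffP.
by case: (is_derive_coord_line z i t s spsi).
Qed.

(** The segment is parametrised by $[0,1]$, of measure 1, so Jensen's inequality brings in no
    constant. *)
Lemma increment_FTC psi z i (t : R) : smooth psi ->
  ((`|psi (z + t *: e i) - psi z| `^ p)%:E <= (`|t| `^ p)%:E *
    \int[lambda]_(s in `[0%R, 1%R]) (`|partial i psi (z + (s * t) *: e i)%R| `^ p)%:E)%E.
Proof.
move=> spsi.
pose F (s : R) : R := psi (z + (s * t) *: e i).
pose f (s : R) : R := partial i psi (z + (s * t) *: e i) * t.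
have dF (s : R) : is_derive s 1 F (f s) by exact: is_derive_coord_line.
have cp := @continuous_coord_line (partial i psi) z i t (smooth_partial i spsi).
have cf : continuous f by move=> s; apply: cvgMr_tmp; exact: cp.
have cF : continuous F by exact: continuous_coord_line.
have FTC : (\int[lambda]_(s in `[0%R, 1%R]) (f s)%:E = (F 1)%:E - (F 0)%:E)%E.
  apply: continuous_FTC2 => //.
  - exact: continuous_subspaceT.
  - split=> [s _||]; first by case: (dF s).
    + by apply: cvg_at_right_filter; exact: cF.
    + by apply: cvg_at_left_filter; exact: cF.
  - by move=> s _; rewrite derive1E; case: (dF s).
have mI : measurable (`[0 : R, 1 : R]%classic : set RR) by exact: measurable_itv.
have I1 : lambda `[0 : R, 1 : R]%classic = 1%E.
  by rewrite lebesgue_measure_itv/= lte01 oppr0 adde0.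
have mf : measurable_fun [set: RR] f by exact: continuous_measurable_fun.
have lt1 : (lambda `[0%R, 1%R]%classic < +oo)%E by rewrite I1 ltry.
have J : ((\int[lambda]_(s in `[0%R, 1%R]) `|f s|%:E) `^ p <= Ip lambda p `[0%R, 1%R]%classic f)%E.
  apply: (le_trans (@jensen_power _ RR R lambda p _ f p1 mI lt1 mf)).
  by set m := (X in (X `^ _)%E); have -> : m = 1%E := I1; rewrite poweR1r mul1e.
have E : `|psi (z + t *: e i) - psi z|%:E = `|\int[lambda]_(s in `[0%R, 1%R]) (f s)%:E|%E.
  by rewrite FTC -EFinB/= /F mul1r mul0r scale0r addr0.
have -> : ((`|psi (z + t *: e i) - psi z| `^ p)%:E =
    `|\int[lambda]_(s in `[0%R, 1%R]) (f s)%:E| `^ p)%E by rewrite -E poweR_EFin.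
have mfE : measurable_fun (`[0, 1]%classic : set RR) (EFin \o f).
  by apply/measurable_EFinP; exact: measurable_funS mf.
apply: (@le_trans _ _ ((\int[lambda]_(s in `[0%R, 1%R]) `|f s|%:E) `^ p)%E).
  apply: gt0_ler_poweR => //; first exact: ltW.
  - by rewrite in_itv/= leey abse_ge0.
  - by rewrite in_itv/= leey andbT integral_ge0.
  - exact: (le_abse_integral lambda mI mfE).
apply: (le_trans J).
have mp : measurable_fun [set: RR] (fun s : R => partial i psi (z + (s * t) *: e i)).
  exact: continuous_measurable_fun.
rewrite -(IpZ lambda _ (ltW p0) mI mp) le_eqVlt; apply/orP; left; apply/eqP.
by apply: eq_Ip => s _; rewrite /f mulrC.
Qed.

Lemma Ip_shift_le S h (r : R) (f : V -> R) : measurable S ->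
  measurable_fun [set: V] f -> enorm h < r ->
  (Ip mu p S (fun x => f (x + h)%R) <= Ip mu p (ethick S r) f)%E.
Proof.
move=> mS mf hr; rewrite (Ip_shift _ _ mS mf); apply: Ip_subset => //.
- exact: preimage_shift_measurable.
- exact: measurable_ethick.
- by move=> x Sx; exists (x - h) => //; rewrite /eball/= opprB addrC subrK.
Qed.

Lemma line_increment_Ip S psi i (t r : R) : measurable S -> smooth psi -> `|t| < r ->
  (Ip mu p S (fun z => (psi (z + t *: e i) - psi z)%R) <=
    (`|t| `^ p)%:E * Ip mu p (ethick S r) (partial i psi))%E.
Proof.
move=> mS spsi tr.
have mI : measurable (`[0 : R, 1 : R]%classic : set RR) by exact: measurable_itv.
have I1 : lambda `[0 : R, 1 : R]%classic = 1%E.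
  by rewrite lebesgue_measure_itv/= lte01 oppr0 adde0.
have mpsi : measurable_fun [set: V] psi.
  by apply: continuous_measurable_rV; exact: smooth_continuous.
have mdpsi : measurable_fun [set: V] (partial i psi).
  by apply: continuous_measurable_rV; apply: smooth_continuous; exact: smooth_partial.
pose F (zs : V * RR) : \bar R := (`|partial i psi (zs.1 + (zs.2 * t) *: e i)%R| `^ p)%:E.
have mF : measurable_fun [set: V * RR] F.
  have m1 : measurable_fun [set: V * RR] (fun zs : V * RR => zs.1 + (zs.2 * t) *: e i).
    apply: measurable_funD_rV; first exact: measurable_fst.
    apply/measurable_rVP => j; under eq_fun do rewrite mxE.
    by apply: measurable_funM => //; apply: measurable_funM => //; exact: measurable_snd.
  exact: (@measurable_powR_norm _ _ R p setT _ (measurableT_comp mdpsi m1)).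
have F0 zs : (0 <= F zs)%E by rewrite lee_fin powR_ge0.
have mG := measurable_inner_integral lambda mI mF F0.
apply: (@le_trans _ _ (\int[mu]_(z in S) ((`|t| `^ p)%:E *
    \int[lambda]_(s in `[0%R, 1%R]) F (z, s)))%E).
  apply: ge0_le_integral => //.
  - apply: (@measurable_powR_norm _ _ R p S); apply: measurable_funB => //.
    exact: measurable_comp_shift.
  - by apply: measurable_funeM; exact: measurable_funS mG.
  - by move=> z _; exact: increment_FTC.
rewrite ge0_integralZl//; first last.
- by move=> z _; apply: integral_ge0.
- exact: measurable_funS mG.
apply: lee_wpmul2l; first by rewrite lee_fin powR_ge0.
rewrite (tonelli_sets mu lambda mS mI mF F0).
set J := Ip mu p (ethick S r) _.
have -> : J = (\int[lambda]_(s in `[0%R, 1%R]) cst J s)%E.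
  rewrite (integral_cst lambda mI).
  by set m := (X in (_ * X)%E); have -> : m = 1%E := I1; rewrite mule1.
have mF' : measurable_fun [set: RR * V] (fun sz => F (sz.2, sz.1)).
  by apply: measurableT_comp mF _; exact: measurable_fun_pair.
have mG' := measurable_inner_integral mu mS mF' (fun sz => F0 _).
apply: (@ge0_le_integral _ _ R lambda _ mI).
- by move=> s _; apply: integral_ge0.
- exact: (measurable_funS measurableT (@subsetT _ _) mG').
- exact: measurable_cst.
move=> s s01; have /andP[s0 s1] : 0 <= (s : R) <= 1 by move: s01; rewrite /= in_itv.
have hs : enorm ((s * t) *: e i) < r.
  rewrite enormZ enorm_delta mulr1 normrM (ger0_norm s0).
  by apply: le_lt_trans tr; rewrite ler_piMl.
exact: (Ip_shift_le mS mdpsi hs).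
Qed.

Definition translation_const : R := (2 `^ p) ^+ n.

(** The increment is split along the axes. Corners lie within [r] of [x] and segments have length at
    most [r]; both are rounded up to [2 * r] to fit open neighbourhoods, whence [4 * r]. *)
Lemma smooth_translation psi S h (r : R) : smooth psi -> measurable S -> 0 < r ->
  enorm h <= r -> (Ip mu p S (fun x => (psi (x + h) - psi x)%R) <=
    (translation_const * r `^ p)%:E *
      \sum_(i < n) Ip mu p (ethick S (4 * r)) (partial i psi))%E.
Proof.
move=> spsi mS r0 hr.
have mpsi : measurable_fun [set: V] psi.
  by apply: continuous_measurable_rV; exact: smooth_continuous.
have mdpsi i : measurable_fun [set: V] (partial i psi).
  by apply: continuous_measurable_rV; apply: smooth_continuous; exact: smooth_partial.
have r2 : r < 2 * r by rewrite ltr_pMl// ltr1n.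
pose Delta (i : 'I_n) z := psi (z + h ord0 i *: e i) - psi z.
have mDelta i : measurable_fun [set: V] (Delta i).
  by apply: measurable_funB => //; exact: measurable_comp_shift.
pose Di (i : 'I_n) x := Delta i (x + coord_prefix h i).
have mDi i : measurable_fun [set: V] (Di i) by exact: measurable_comp_shift.
have A0 : 0 <= translation_const by rewrite exprn_ge0// powR_ge0.
apply: (@le_trans _ _ (\int[mu]_(x in S) (translation_const%:E *
    \sum_(i < n) (`|Di i x| `^ p)%:E))%E).
  apply: ge0_le_integral => //.
  - apply: (@measurable_powR_norm _ _ R p S); apply: measurable_funB => //.
    exact: measurable_comp_shift.
  - apply: measurable_funeM; apply: emeasurable_sum => i.
    exact: (@measurable_powR_norm _ _ R p S).
  - move=> x _; rewrite sumEFin -EFinM lee_fin coord_prefix_telescope.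
    have := powR_norm_sum (enum 'I_n) (fun i => Di i x) p0.
    by rewrite !big_enum/= size_enum_ord.
rewrite ge0_integralZl//; first last.
- by move=> x _; apply: sume_ge0 => i _; rewrite lee_fin powR_ge0.
- by apply: emeasurable_sum => i; exact: (@measurable_powR_norm _ _ R p S).
rewrite EFinM -muleA; apply: lee_wpmul2l => //.
rewrite ge0_integral_sum//; last by move=> i; exact: (@measurable_powR_norm _ _ R p S).
rewrite ge0_sume_distrr; last by move=> i _; exact: Ip_ge0.
apply: lee_sum => i _; rewrite -/(Ip mu p S (Di i)).
have mS2 : measurable (ethick S (2 * r)) by exact: measurable_ethick.
apply: (@le_trans _ _ (Ip mu p (ethick S (2 * r)) (Delta i))).
  apply: Ip_shift_le => //; apply: le_lt_trans r2.
  exact: le_trans (enorm_coord_prefix h i) hr.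
have hi : `|h ord0 i| <= r by exact: le_trans (normr_coord_le h i) hr.
apply: (le_trans (line_increment_Ip i mS2 spsi (le_lt_trans hi r2))).
apply: lee_pmul; [by rewrite lee_fin powR_ge0|exact: Ip_ge0| |].
  by rewrite lee_fin ge0_ler_powR ?nnegrE ?(ltW p0)// ltW.
apply: Ip_subset; [exact: measurable_ethick|exact: measurable_ethick|exact: mdpsi|].
apply: (subset_trans (@ethick_ethick _ _ _ _ _)); apply: ethickS => //.
by rewrite le_eqVlt; apply/orP; left; apply/eqP; ring.
Qed.

Definition gradient_power (dw : 'I_n -> V -> R) x : R := \sum_(i < n) `|dw i x| `^ p.

Lemma measurable_gradient_power dw : (forall i, measurable_fun [set: V] (dw i)) ->
  measurable_fun [set: V] (gradient_power dw).
Proof.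
move=> mdw; apply: measurable_sum => i; apply/measurable_EFinP.
exact: (@measurable_powR_norm _ _ R p setT).
Qed.

Lemma gradient_power_ge0 dw x : 0 <= gradient_power dw x.
Proof. by apply: sumr_ge0 => i _; exact: powR_ge0. Qed.

Lemma integral_gradient_power dw S : measurable S ->
  (forall i, measurable_fun [set: V] (dw i)) ->
  (\int[mu]_(x in S) (gradient_power dw x)%:E = \sum_(i < n) Ip mu p S (dw i))%E.
Proof.
move=> mS mdw; rewrite -ge0_integral_sum//.
  by apply: eq_integral => x _; rewrite sumEFin.
by move=> i; exact: (@measurable_powR_norm _ _ R p S).
Qed.

(** One factor $2^p$ for separating $w$ from its smooth approximation, the other for replacing the
    derivatives of the approximation by [dw]. *)
Definition sobolev_translation_const : R := 2 `^ p * (translation_const * 2 `^ p).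

(** The approximation errors add up to [k * eps], where [k] depends on [r] but not on the
    approximation, so they disappear in the limit. *)
Lemma limit_translation_bound w dw : measurable_fun [set: V] w ->
  (forall i, measurable_fun [set: V] (dw i)) ->
  (forall eps, 0 < eps -> exists psi, [/\ smooth psi,
     (Ip mu p setT (w \- psi)%R <= eps%:E)%E &
     forall i, (Ip mu p setT (dw i \- partial i psi)%R <= eps%:E)%E]) ->
  translation_bound p sobolev_translation_const 4 w (gradient_power dw).
Proof.
move=> mw mdw approx; split=> //; [exact: measurable_gradient_power|exact: gradient_power_ge0|].
move=> S h r mS r0 hr.
have mT : measurable (ethick S (4 * r)) by exact: measurable_ethick.
rewrite integral_gradient_power//.
set P := 2 `^ p; have P0 : 0 < P by exact: powR_gt0.
set A := translation_const * r `^ p.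
have A0 : 0 <= A by rewrite mulr_ge0 ?powR_ge0// exprn_ge0// powR_ge0.
set Sig := (\sum_(i < n) _)%E.
pose k := P * (P * 2 + A * (P * n%:R)).
have Pge0 := ltW P0.
have k0 : 0 <= k.
  by apply: mulr_ge0 => //; apply: addr_ge0; apply: mulr_ge0 => //; exact: mulr_ge0.
apply/lee_addgt0Pr => e e0.
have [psi [spsi wpsi dpsi]] := approx (e / (k + 1)) (divr_gt0 e0 (ltr_wpDl k0 ltr01)).
set eps := e / (k + 1) in wpsi dpsi.
have mpsi : measurable_fun [set: V] psi.
  by apply: continuous_measurable_rV; exact: smooth_continuous.
have mdpsi i : measurable_fun [set: V] (partial i psi).
  by apply: continuous_measurable_rV; apply: smooth_continuous; exact: smooth_partial.
have mv : measurable_fun [set: V] (w \- psi)%R by exact: measurable_funB.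
have Ev : (fun x => w (x + h) - w x) = (fun x => (w \- psi) (x + h) - (w \- psi) x) \+
    (fun x => psi (x + h) - psi x) by apply/funext => x /=; ring.
rewrite Ev.
have H1 : (Ip mu p S (fun x => ((w \- psi)%R (x + h) - (w \- psi)%R x)%R) <=
    (P * (2 * eps))%:E)%E.
  have mv' := measurable_comp_shift h mv.
  apply: (le_trans (IpB mu (ltW p0) mS mv' mv)); rewrite [leRHS]EFinM.
  apply: lee_wpmul2l; first by rewrite lee_fin ltW.
  rewrite mulr_natl mulr2n EFinD; apply: leeD.
    apply: (le_trans _ wpsi); rewrite -(Ip_shiftT p h mv).
    exact: Ip_subset.
  by apply: (le_trans _ wpsi); exact: Ip_subset.
have H2 : (Ip mu p S (fun x => (psi (x + h) - psi x)%R) <=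
    A%:E * (P%:E * (Sig + (n%:R * eps)%:E)))%E.
  apply: (le_trans (smooth_translation spsi mS r0 hr)).
  apply: lee_wpmul2l; first by rewrite lee_fin.
  have -> : (n%:R * eps)%:E = (\sum_(i < n) eps%:E)%E.
    by rewrite sumEFin sumr_const card_ord mulr_natl.
  rewrite -big_split/= ge0_sume_distrr; last first.
    by move=> i _; rewrite adde_ge0 ?Ip_ge0// lee_fin divr_ge0 ?ltW// ltr_wpDl.
  apply: lee_sum => i _.
  have -> : partial i psi = dw i \- (dw i \- partial i psi).
    by apply/funext => x /=; ring.
  have md := measurable_funB (mdw i) (mdpsi i).
  apply: (le_trans (IpB mu (ltW p0) mT (mdw i) md)).
  apply: lee_wpmul2l; first by rewrite lee_fin ltW.
  apply: leeD; first exact: lexx.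
  exact: le_trans (Ip_subset mu p mT measurableT md (@subsetT _ _)) (dpsi i).
apply: (le_trans (IpD mu (ltW p0) mS (measurable_increment h mv) (measurable_increment h mpsi))).
apply: (@le_trans _ _ (P%:E * ((P * (2 * eps))%:E +
    A%:E * (P%:E * (Sig + (n%:R * eps)%:E))))%E).
  by apply: lee_wpmul2l; [rewrite lee_fin ltW|exact: leeD].
have Sig0 : (0 <= Sig)%E by apply: sume_ge0 => i _; exact: Ip_ge0.
have eps0 : 0 <= eps by rewrite divr_ge0 ?ltW// ltr_wpDl.
have neps0 : 0 <= n%:R * eps by exact: mulr_ge0.
have PE0 : (0 <= P%:E)%E by rewrite lee_fin.
have AE0 : (0 <= A%:E)%E by rewrite lee_fin.
have x1 : (0 <= P%:E * Sig)%E by exact: mule_ge0.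
have x2 : (0 <= P%:E * (n%:R * eps)%:E)%E by rewrite -EFinM lee_fin mulr_ge0.
have x3 : (0 <= A%:E * (P%:E * Sig))%E by exact: mule_ge0.
have x4 : (0 <= A%:E * (P%:E * (n%:R * eps)%:E))%E by exact: mule_ge0.
have x5 : (0 <= (P * (2 * eps))%:E)%E by rewrite lee_fin mulr_ge0// mulr_ge0.
rewrite (@ge0_muleDr _ P%:E Sig) ?lee_fin// (ge0_muleDr _ x1 x2).
rewrite (@ge0_muleDr _ P%:E) ?adde_ge0// (ge0_muleDr _ x3 x4).
rewrite addeCA; apply: leeD.
  rewrite !muleA -!EFinM; apply: lee_wpmul2r => //.
  rewrite lee_fin /sobolev_translation_const -/P /A le_eqVlt; apply/orP; left; apply/eqP.
  by set X := translation_const; set Y := r `^ p; ring.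
rewrite -!EFinM -EFinD lee_fin.
have -> : P * (P * (2 * eps)) + P * (A * (P * (n%:R * eps))) = k * eps by rewrite /k; ring.
by rewrite /eps mulrCA ger_pMr// ler_pdivrMr ?ltr_wpDl// mul1r lerDl.
Qed.

End sobolev_translation.

(** * Representatives of weak derivatives and the Sobolev norm *)

Section sobolev_functions.
Context {R : realType} {n : nat}.
Local Notation V := 'rV[R]_n.
Local Notation mu := (@lebesgue_rV R n).
Implicit Types (u f phi : V -> R) (alpha : 'I_n -> nat).
Variables (k : nat) (p : R).
Hypothesis p1 : 1 < p.

Let p0 : 0 < p. Proof. exact: lt_trans p1. Qed.

Lemma Lnorm_Ip f : ('N[mu]_(p%:E)[EFin \o f] `^ p = Ip mu p setT f)%E.
Proof.
rewrite poweR_Lnorm ?gt_eqF//; exact: eq_integral.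
Qed.

Lemma Lfun_Ip f : f \in Lfun mu p%:E <->
  measurable_fun [set: V] f /\ (Ip mu p setT f < +oo)%E.
Proof.
rewrite -Lnorm_Ip; split.
  move=> /andP[/[!inE]/= mf]; rewrite /finite_norm => If; split=> //.
  by rewrite poweR_lty.
move=> [mf If]; apply/andP; split; rewrite !inE/=; first exact: mf.
rewrite /finite_norm ltey; apply: contraTneq If => ->.
by rewrite poweRyr ?ltxx// gt_eqF.
Qed.

(** The representative picked by [xget] is a priori only a weak derivative; uniqueness almost
    everywhere transfers to it the integrability of the derivative supplied by [sobolev]. *)
Lemma weak_partialP u alpha : sobolev k p u -> (mi_order alpha <= k)%N ->
  [/\ measurable_fun [set: V] (weak_partial alpha u),
    (Ip mu p setT (weak_partial alpha u) < +oo)%E &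
    is_weak_partial alpha u (weak_partial alpha u)].
Proof.
move=> [_ /(_ alpha) H] /H[g /Lfun_Ip[mg Ig] wg].
have W : is_weak_partial alpha u (weak_partial alpha u).
  by rewrite /weak_partial; case: xgetP => [f _ //|/(_ g)].
have [_ /loc_integrableP[mw _] _] := W.
split; [exact: mw| |exact: W].
by rewrite (ae_eq_Ip p measurableT mw mg (weak_partial_unique W wg)).
Qed.

(** Representatives for [u] and for [u \- phi] are picked independently, so linearity holds only
    almost everywhere, which is enough under the integral. *)
Lemma Ip_weak_partialB u phi alpha : sobolev k p u -> test_function phi ->
  (mi_order alpha <= k)%N ->
  Ip mu p setT (weak_partial alpha (u \- phi)%R) =
  Ip mu p setT (weak_partial alpha u \- partial_mi alpha phi)%R.
Proof.
move=> su tphi ak; have [mw _ W] := weak_partialP su ak.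
have WB := weak_partialB W (test_weak_partial alpha tphi).
have W' : is_weak_partial alpha (u \- phi) (weak_partial alpha (u \- phi)).
  by rewrite [X in is_weak_partial _ _ X]/weak_partial; case: xgetP => [f _ //|/(_ _ WB)].
have [_ /loc_integrableP[m1 _] _] := W'.
have [_ /loc_integrableP[m2 _] _] := WB.
apply: ae_eq_Ip => //; exact: weak_partial_unique W' WB.
Qed.

Lemma sobolev_norm_test u phi : sobolev k p u -> test_function phi ->
  sobolev_norm k p (u \- phi) =
  ((\sum_(a : {ffun 'I_n -> 'I_k.+1} | (mi_order (fun i => a i) <= k)%N)
    Ip mu p setT (weak_partial (fun i => a i) u \- partial_mi (fun i => a i) phi)%R) `^ p^-1)%E.
Proof.
move=> su tphi; rewrite /sobolev_norm; congr (_ `^ _)%E.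
by apply: eq_bigr => a ak; rewrite Lnorm_Ip Ip_weak_partialB.
Qed.

Lemma multi_index_ffun alpha : (mi_order alpha <= k)%N ->
  exists a : {ffun 'I_n -> 'I_k.+1}, alpha = (fun i => a i : nat).
Proof.
move=> ak; exists [ffun i => inord (alpha i)]; apply/funext => i.
by rewrite ffunE inordK// ltnS (leq_trans _ ak)// /mi_order (bigD1 i)//= leq_addr.
Qed.

Lemma sobolev_norm_lt_Ip u phi (eps : R) alpha : sobolev k p u -> test_function phi ->
  0 < eps -> (sobolev_norm k p (u \- phi)%R < eps%:E)%E -> (mi_order alpha <= k)%N ->
  (Ip mu p setT (weak_partial alpha u \- partial_mi alpha phi)%R <= (eps `^ p)%:E)%E.
Proof.
move=> su tphi e0; rewrite sobolev_norm_test// => lt ak.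
have [a aE] := multi_index_ffun ak.
set Sig := (\sum_(a | _) _)%E in lt.
have S0 : (0 <= Sig)%E by apply: sume_ge0 => b _; exact: Ip_ge0.
apply: (@le_trans _ _ Sig).
  rewrite /Sig (bigD1 a) -?aE//= leeDl//.
  by apply: sume_ge0 => b _; exact: Ip_ge0.
have -> : (Sig = (Sig `^ p^-1) `^ p)%E by rewrite -poweRrM mulVf ?gt_eqF// poweRe1.
rewrite -poweR_EFin; apply: gt0_ler_poweR; first exact: ltW.
- by rewrite in_itv/= leey poweR_ge0.
- by rewrite in_itv/= leey lee_fin ltW.
- exact: ltW.
Qed.

Lemma Ip_sobolev_norm_lt u (eps : R) : sobolev k p u -> 0 < eps ->
  exists2 eta, 0 < eta & forall phi, test_function phi ->
    (forall alpha, (mi_order alpha <= k)%N ->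
      (Ip mu p setT (weak_partial alpha u \- partial_mi alpha phi)%R <= eta%:E)%E) ->
    (sobolev_norm k p (u \- phi)%R < eps%:E)%E.
Proof.
move=> su e0; pose N := #|{ffun 'I_n -> 'I_k.+1}|.
(* Half of [eps] leaves room for the strict inequality. *)
have h0 : 0 < (eps / 2) `^ p by rewrite powR_gt0// divr_gt0.
exists ((eps / 2) `^ p / N.+1%:R); first by rewrite divr_gt0.
move=> phi tphi H; rewrite sobolev_norm_test//.
set Sig := (\sum_(a | _) _)%E.
have S0 : (0 <= Sig)%E by apply: sume_ge0 => b _; exact: Ip_ge0.
have SE : (Sig <= ((eps / 2) `^ p)%:E)%E.
  apply: (@le_trans _ _ (\sum_(a : {ffun 'I_n -> 'I_k.+1})
      ((eps / 2) `^ p / N.+1%:R)%:E)%E).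
    rewrite /Sig big_mkcond/=; apply: lee_sum => a _; case: ifPn => [/H//|_].
    by rewrite lee_fin divr_ge0// ltW.
  rewrite sumEFin lee_fin sumr_const -/N -[leLHS]mulr_natr [leLHS]mulrAC ler_pdivrMr//.
  by rewrite ler_pM2l// ler_nat.
apply: (@le_lt_trans _ _ (((eps / 2) `^ p)%:E `^ p^-1)%E).
  apply: gt0_ler_poweR => //.
  - by rewrite invr_ge0 ltW.
  - by rewrite in_itv/= leey S0.
  - by rewrite in_itv/= leey lee_fin ltW.
rewrite poweR_EFin lte_fin -powRrM mulfV ?gt_eqF// powRr1 ?divr_ge0 ?ltW//.
by rewrite ltr_pdivrMr// ltr_pMr// ltr1n.
Qed.

Definition mi_incr alpha (i : 'I_n) : 'I_n -> nat := fun j => (alpha j + (j == i))%N.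

Lemma mi_order_incr alpha i : mi_order (mi_incr alpha i) = (mi_order alpha).+1.
Proof.
rewrite /mi_order /mi_incr big_split/= -addn1; congr (_ + _)%N.
by rewrite (bigD1 i)//= eqxx big1 ?addn0// => j /negPf ->.
Qed.

Lemma partial_partial_mi alpha i f : smooth f ->
  partial i (partial_mi alpha f) = partial_mi (mi_incr alpha i) f.
Proof.
move=> sf; rewrite !partial_miE -[LHS]/(foldr partial f (i :: mi_seq alpha)).
apply: perm_foldr_partial => //; apply/allP => j _ /=.
by rewrite !count_mi_seq /mi_incr (eq_sym j i) addnC.
Qed.

Lemma smooth_partial_mi alpha f : smooth f -> smooth (partial_mi alpha f).
Proof. by move=> sf; rewrite partial_miE; exact: smooth_foldr_partial. Qed.

Lemma measurable_smooth f : smooth f -> measurable_fun [set: V] f.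
Proof. by move=> /smooth_continuous; exact: continuous_measurable_rV. Qed.

Lemma sobolev_dense u eps : sobolev k p u -> 0 < eps ->
  exists phi, test_function phi /\ forall alpha, (mi_order alpha <= k)%N ->
    (Ip mu p setT (weak_partial alpha u \- partial_mi alpha phi)%R <= eps%:E)%E.
Proof.
move=> su e0; have [/Lfun_Ip[mu_ Iu] _] := su.
exact: (@test_dense _ _ k p u (fun alpha => weak_partial alpha u) (ltW p1) mu_ Iu
  (fun alpha ak => weak_partialP su ak) _ e0).
Qed.

(** Applied with an approximating test function for the first inclusion and with 0 for the Hardy
    inequality. *)
Lemma sobolev_translation_bound u phi alpha : sobolev k p u -> smooth phi ->
  (mi_order alpha < k)%N ->
  translation_bound p (@sobolev_translation_const R n p) 4
    (weak_partial alpha u \- partial_mi alpha phi)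
    (gradient_power p (fun i => weak_partial (mi_incr alpha i) u \-
       partial_mi (mi_incr alpha i) phi)).
Proof.
move=> su sphi ak.
have [mw _ _] := weak_partialP su (ltnW ak).
have mp beta : measurable_fun [set: V] (partial_mi beta phi).
  exact: (measurable_smooth (smooth_partial_mi beta sphi)).
have aki i : (mi_order (mi_incr alpha i) <= k)%N by rewrite mi_order_incr.
have mdw i : measurable_fun [set: V] (weak_partial (mi_incr alpha i) u).
  by have [] := weak_partialP su (aki i).
apply: (limit_translation_bound p1 (measurable_funB mw (mp alpha))
  (fun i => measurable_funB (mdw i) (mp (mi_incr alpha i)))) => eps e0.
have [phi' [[sphi' _] H]] := sobolev_dense su e0.
have sB : smooth (phi' \- phi) := smoothD sphi' (smoothN sphi).
have cancel beta : (mi_order beta <= k)%N -> (Ip mu p setT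
    ((weak_partial beta u \- partial_mi beta phi) \- partial_mi beta (phi' \- phi))%R <=
    eps%:E)%E.
  move=> bk; apply: le_trans (H _ bk); rewrite (partial_miB beta sphi' sphi).
  rewrite le_eqVlt; apply/orP; left; apply/eqP.
  by apply: eq_Ip => x _ /=; congr `|_|; ring.
exists (partial_mi alpha (phi' \- phi)); split; [exact: smooth_partial_mi| |move=> i].
  exact: (cancel _ (ltnW ak)).
by rewrite (partial_partial_mi alpha i sB); exact: (cancel _ (aki i)).
Qed.

End sobolev_functions.

(** * The two inclusions *)

Section sobolev_trace.
Context {R : realType} {n : nat}.
Local Notation V := 'rV[R]_n.
Local Notation mu := (@lebesgue_rV R n).
Implicit Types (u w phi : V -> R) (alpha : 'I_n -> nat) (D : set V).

Definition nonzero_trace D w : set V :=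
  [set y | D y /\ ~ (ball_average w y r @[r --> 0^'+] --> (0 : R))].

Lemma ball_average_local w phi alpha y : test_function phi -> ~ supp phi y ->
  \forall r \near 0^'+, ball_average w y r = ball_average (w \- partial_mi alpha phi)%R y r.
Proof.
move=> tphi ny.
have /nbhs_enormP[delta d0 Hd] : nbhs y (~` supp phi).
  by apply: open_nbhs_nbhs; split=> //; apply: closed_openC; exact: closed_closure.
near=> r; have rd : r < delta by near: r; exact: nbhs_right_lt.
rewrite /ball_average; congr (_ * _); apply: eq_Rintegral => z /[!inE] zr /=.
rewrite (_ : partial_mi alpha phi z = 0) ?subr0//.
apply/eqP/negPn/negP => nz; apply: (Hd z); first exact: lt_trans zr rd.
rewrite partial_miE in nz.
apply: (@supp_foldr_partial _ _ (mi_seq alpha)); exact: subset_closure.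
Unshelve. all: by end_near. Qed.

Variables (k : nat) (d p : R) (D : set V).
Hypotheses (d0 : 0 < d) (p1 : 1 < p) (pd : n%:R - d < p).

Let p0 : 0 < p. Proof. exact: lt_trans p1. Qed.

Let C0 : 0 <= @sobolev_translation_const R n p.
Proof. by rewrite mulr_ge0 ?powR_ge0// mulr_ge0 ?powR_ge0// exprn_ge0// powR_ge0. Qed.

Let four0 : 0 <= 4 :> R. Proof. by []. Qed.

(** [trace_null] is fed with the derivative of $u - \phi$, where [phi] vanishes near each point of
    [D] and hence does not change averages over small balls. *)
Lemma sobolev_vanishing_trace u alpha : sobolev_vanishing D k p u ->
  (mi_order alpha < k)%N -> hausdorff d (nonzero_trace D (weak_partial alpha u)) = 0%E.
Proof.
move=> [su approx] ak; apply: (trace_null p1 C0 four0 d0 pd) => e e0.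
(* The energy is a sum of [n] integrals, each at most [q]. *)
pose q := e / n.+1%:R; have q0 : 0 < q by rewrite divr_gt0.
pose eps := q `^ p^-1; have eps0 : 0 < eps by exact: powR_gt0.
have epsE : eps `^ p = q by rewrite /eps -powRrM mulVf ?gt_eqF// powRr1// ltW.
have [phi [tphi Dphi lt]] := approx _ eps0; have [sphi _] := tphi.
have H beta : (mi_order beta <= k)%N ->
    (Ip mu p setT (weak_partial beta u \- partial_mi beta phi)%R <= q%:E)%E.
  by rewrite -epsE; exact: sobolev_norm_lt_Ip su tphi eps0 lt.
have aki i : (mi_order (mi_incr alpha i) <= k)%N by rewrite mi_order_incr.
have mw beta : (mi_order beta <= k)%N ->
    measurable_fun [set: V] (weak_partial beta u \- partial_mi beta phi).
  move=> bk; apply: measurable_funB; first by have [] := weak_partialP p1 su bk.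
  exact: (measurable_smooth (smooth_partial_mi beta sphi)).
have qe : n%:R * q <= e.
  by rewrite /q mulrA ler_pdivrMr// mulrC ler_pM2l// ler_nat.
exists (weak_partial alpha u \- partial_mi alpha phi)%R.
exists (gradient_power p (fun i => weak_partial (mi_incr alpha i) u \-
  partial_mi (mi_incr alpha i) phi)); split.
- exact: (sobolev_translation_bound p1 su sphi ak).
- apply: (le_trans (H _ (ltnW ak))); rewrite lee_fin /q ler_pdivrMr// ler_peMr ?(ltW e0)//.
  by rewrite ler1n.
- rewrite (integral_gradient_power p measurableT (fun i => mw _ (aki i))).
  apply: (@le_trans _ _ (\sum_(i < n) q%:E)%E); first by apply: lee_sum => i _; exact: H.
  by rewrite sumEFin sumr_const card_ord lee_fin -mulr_natl.
- move=> y Dy; apply: ball_average_local => // sy.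
  by have : (D `&` supp phi) y by []; rewrite Dphi.
Qed.

Lemma vanishing_is_restriction u : sobolev_vanishing D k p u ->
  hausdorff d [set x | D x /\ ~ is_restriction k u x (fun=> 0)] = 0%E.
Proof.
move=> vu; pose H := @hausdorff_outer R n d d0.
pose bad (a : {ffun 'I_n -> 'I_k.+1}) : set V :=
  if (mi_order (fun i => a i) < k)%N then nonzero_trace D (weak_partial (fun i => a i) u)
  else set0.
have bad0 a : H (bad a) = 0%E.
  rewrite /bad; case: ifPn => [ak|_]; last exact: hausdorff0.
  exact: sobolev_vanishing_trace.
have sub : [set x | D x /\ ~ is_restriction k u x (fun=> 0)] `<=`
    \big[setU/set0]_(a <- enum {ffun 'I_n -> 'I_k.+1}) bad a.
  move=> x [Dx nr]; apply: contrapT => nb; apply: nr => alpha ak.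
  apply: contrapT => nc; apply: nb.
  have [a aE] := multi_index_ffun (ltnW ak).
  have ba : bad a x by rewrite /bad -aE ak.
  by rewrite -bigcup_seq; exists a => //=; rewrite mem_enum.
have big0 (l : seq {ffun 'I_n -> 'I_k.+1}) : H (\big[setU/set0]_(a <- l) bad a) = 0%E.
  elim: l => [|a l IH]; first by rewrite big_nil; exact: hausdorff0.
  rewrite big_cons; apply/eqP; rewrite eq_le outer_measure_ge0 andbT.
  by apply: (le_trans (outer_measureU2 H _ _)); rewrite bad0 IH adde0.
apply/eqP; rewrite eq_le hausdorff_ge0 andbT.
apply: (le_trans (le_hausdorff d sub)).
by have -> : hausdorff d (\big[setU/set0]_(a <- enum {ffun 'I_n -> 'I_k.+1}) bad a) = 0%E
  by exact: big0.
Qed.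

Variables (c c' rho1 : R) (u : V -> R).
Hypotheses (c0 : 0 < c) (c'0 : 0 < c') (rho10 : 0 < rho1)
  (HD : forall y r, D y -> 0 < r <= rho1 ->
    (hausdorff d (eball y r `&` D) <= (c * r `^ d)%:E)%E)
  (HL : forall y r, D y -> 0 < r <= rho1 ->
    ((c' * r `^ d)%:E <= hausdorff d (eball y r `&` D))%E)
  (su : sobolev k p u)
  (tr0 : hausdorff d [set x | D x /\ ~ is_restriction k u x (fun=> 0)] = 0%E).

(** All orders up to [k] are included, so that the iteration of the Hardy inequality may stop at any
    order. *)
Let neighbourhood_energy (r : R) : \bar R :=
  (\sum_(a : {ffun 'I_n -> 'I_k.+1} | (mi_order (fun i => a i) <= k)%N)
    Ip mu p (ethick D r) (weak_partial (fun i => a i) u))%E.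

(* 20 = 3 + (1 + 4 K) is the enlargement in [hardy_neighbourhood] for [K = 4]. *)
Lemma sobolev_hardy j alpha : (mi_order alpha + j <= k)%N ->
  exists C rho : R, [/\ 0 <= C, 0 < rho & forall r, 0 < r <= rho ->
    (Ip mu p (ethick D r) (weak_partial alpha u) <=
      (C * (r `^ p) ^+ j)%:E * neighbourhood_energy (20 ^+ j * r))%E].
Proof.
elim: j alpha => [|j IH] alpha.
  rewrite addn0 => ak; exists 1, 1; split=> // r _.
  rewrite !expr0 mul1r mul1e mul1r; have [a aE] := multi_index_ffun ak.
  rewrite /neighbourhood_energy (bigD1 a) -?aE//= leeDl//.
  by apply: sume_ge0 => b _; exact: Ip_ge0.
rewrite addnS => ak1.
have ak : (mi_order alpha < k)%N by apply: leq_ltn_trans ak1; rewrite leq_addr.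
have aki i : (mi_order (mi_incr alpha i) + j <= k)%N by rewrite mi_order_incr addSn.
have aki' i : (mi_order (mi_incr alpha i) <= k)%N by rewrite mi_order_incr.
have [mw Iw _] := weak_partialP p1 su (ltnW ak).
have mdw i : measurable_fun [set: V] (weak_partial (mi_incr alpha i) u).
  by have [] := weak_partialP p1 su (aki' i).
have Idw i : (Ip mu p setT (weak_partial (mi_incr alpha i) u) < +oo)%E.
  by have [] := weak_partialP p1 su (aki' i).
have /choice[C /choice[rho H]] := fun i => IH (mi_incr alpha i) (aki i).
have TB : translation_bound p (@sobolev_translation_const R n p) 4 (weak_partial alpha u)
    (gradient_power p (fun i => weak_partial (mi_incr alpha i) u)).
  have := sobolev_translation_bound p1 su (@smooth_cst R n 0) ak.
  have E beta : (weak_partial beta u \- partial_mi beta (cst 0))%R = weak_partial beta u.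
    rewrite partial_miE; apply/funext => x /=.
    suff -> : foldr partial (cst 0 : V -> R) (mi_seq beta) = cst 0 by rewrite subr0.
    by elim: (mi_seq beta) => //= i s ->; exact: partial_cst.
  rewrite E; congr (translation_bound _ _ _ _ (gradient_power _ _)).
  by apply/funext => i; exact: E.
have IG : (\int[mu]_z (gradient_power p
    (fun i => weak_partial (mi_incr alpha i) u) z)%:E < +oo)%E.
  rewrite (integral_gradient_power p measurableT mdw).
  by apply: lte_sum_pinfty => i _; exact: Idw.
have w0 : hausdorff d (nonzero_trace D (weak_partial alpha u)) = 0%E.
  apply/eqP; rewrite eq_le hausdorff_ge0 andbT -tr0; apply: le_hausdorff.
  by move=> y [Dy ny]; split=> // res; apply: ny; exact: res.
set hc := @hardy_const R n p (@sobolev_translation_const R n p) 4 d c c'.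
(* [34] is [2 * L] for [L = 1 + 4 * K] and [K = 4]. *)
have hardy r0 : 0 < r0 -> 34 * r0 <= rho1 ->
    (Ip mu p (ethick D r0) (weak_partial alpha u) <= (hc * r0 `^ p)%:E *
      \sum_(i < n) Ip mu p (ethick D (20 * r0)) (weak_partial (mi_incr alpha i) u))%E.
  move=> r00 r0rho.
  rewrite -integral_gradient_power//; last exact: measurable_ethick.
  have -> : 20 * r0 = (3 + (1 + 4 * 4)) * r0 by ring.
  apply: (hardy_neighbourhood p1 C0 four0 d0 pd c0 c'0 HD HL TB Iw IG w0 r00).
  by apply: le_trans r0rho; rewrite (_ : 2 * (1 + 4 * 4) * r0 = 34 * r0)//; ring.
have [rho2 [rho20 rho21 rho2i]] : exists rho2 : R,
    [/\ 0 < rho2, 34 * rho2 <= rho1 & forall i, 20 * rho2 <= rho i].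
  have : \forall t \near (0 : R)^'+, [/\ 0 < t, 34 * t <= rho1 & forall i, 20 * t <= rho i].
    have N1 : \forall t \near (0 : R)^'+, forall i, 20 * t <= rho i.
      apply: filter_forall => i; near=> t; rewrite mulrC -ler_pdivlMr//.
      by near: t; apply: nbhs_right_le; rewrite divr_gt0//; have [] := H i.
    near=> t; split; last by near: t.
      by near: t; exact: nbhs_right_gt.
    rewrite mulrC -ler_pdivlMr//; near: t; apply: nbhs_right_le.
    by rewrite divr_gt0.
  by move=> /filter_ex.
have hi i : 0 <= C i by have [] := H i.
(* The induction hypothesis is used at radius [20 * r], whence the powers of 20; the absolute value
   spares a discussion of the sign of [hc]. *)
exists (`|hc| * (\sum_(i < n) C i * (20 `^ p) ^+ j)), rho2; split=> //.
  by rewrite mulr_ge0// sumr_ge0// => i _; rewrite mulr_ge0// exprn_ge0// powR_ge0.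
move=> r /andP[r0 rr].
have r34 : 34 * r <= rho1 by apply: le_trans rho21; rewrite ler_pM2l.
apply: (le_trans (hardy r r0 r34)).
have rp0 : 0 <= r `^ p := powR_ge0 _ _.
set E := neighbourhood_energy (20 ^+ j.+1 * r).
have E0 : (0 <= E)%E by apply: sume_ge0 => a _; exact: Ip_ge0.
have hcle : hc * r `^ p <= `|hc| * r `^ p by rewrite ler_wpM2r// ler_norm.
apply: (@le_trans _ _ ((`|hc| * r `^ p)%:E *
    \sum_(i < n) (C i * (20 `^ p) ^+ j * (r `^ p) ^+ j)%:E * E)%E).
  apply: (@le_trans _ _ ((`|hc| * r `^ p)%:E *
    \sum_(i < n) Ip mu p (ethick D (20 * r)) (weak_partial (mi_incr alpha i) u))%E).
    by apply: lee_wpmul2r; [apply: sume_ge0 => i _; exact: Ip_ge0|rewrite lee_fin].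
  apply: lee_wpmul2l; first by rewrite lee_fin mulr_ge0.
  apply: lee_sum => i _; have [_ _] := H i; move=> /(_ (20 * r)).
  rewrite mulr_gt0// (le_trans _ (rho2i i)) ?ler_pM2l//= => /(_ isT).
  rewrite powRM ?(ltW r0)// exprMn mulrA => /le_trans; apply.
  by rewrite /E exprSr -!mulrA.
rewrite -ge0_sume_distrl; last first.
  by move=> i _; rewrite lee_fin !mulr_ge0// exprn_ge0// powR_ge0.
rewrite sumEFin -mulr_suml muleA -EFinM exprS.
by rewrite [X in (_ <= X%:E * _)%E]mulrACA mulrA.
Unshelve. all: by end_near. Qed.

Hypotheses (clD : closed D) (muD0 : mu D = 0%E).

Let delta (N : nat) : R := N.+1%:R^-1.

Let delta_gt0 N : 0 < delta N. Proof. by rewrite invr_gt0. Qed.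

Let delta_le1 N : delta N <= 1.
Proof. by rewrite invf_le1// ler1n. Qed.

Let near_delta (t : R) : 0 < t -> \forall N \near \oo, delta N < t.
Proof. by move=> t0; exact: near_infty_natSinv_lt (PosNum t0). Qed.

(** The neighbourhoods shrink to the closed set [D], which has volume 0. *)
Lemma neighbourhood_energy_small (M e : R) : 0 < M -> 0 < e ->
  \forall N \near \oo, (neighbourhood_energy (M * delta N) <= e%:E)%E.
Proof.
move=> M0 e0.
pose P (a : {ffun 'I_n -> 'I_k.+1}) := (mi_order (fun i => a i) <= k)%N.
pose F (a : {ffun 'I_n -> 'I_k.+1}) N :=
  if P a then Ip mu p (ethick D (M * delta N)) (weak_partial (fun i => a i) u) else 0%E.
have F0 a N : (0 <= F a N)%E by rewrite /F; case: ifP => // _; exact: Ip_ge0.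
have Fs a t : 0 < t -> \forall N \near \oo, (F a N <= t%:E)%E.
  move=> t0; have [Pa|Pa] := boolP (P a); last first.
    by apply: nearW => N; rewrite /F (negPf Pa) lee_fin ltW.
  have [mw Iw _] := weak_partialP p1 su Pa.
  have mD : measurable D by exact: closed_measurable_rV.
  have mS N : measurable (ethick D (M * delta N)) by exact: measurable_ethick.
  have nD x : ~ D x -> \forall N \near \oo, ~ ethick D (M * delta N) x.
    move=> nDx.
    have oD : open (~` D) by exact: closed_openC.
    have [s s0 sD] := (open_enormP (~` D)).1 oD x nDx.
    near=> N; move=> [y Dy /eballC xy].
    apply: (sD y _ Dy); apply: lt_trans xy _; rewrite mulrC -ltr_pdivlMr//.
    by near: N; apply: near_delta; exact: divr_gt0.
  have := Ip_vanishing_sets p0 mw Iw mD muD0 mS nD t0.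
  by apply: filterS => N; rewrite /F Pa.
have := near_weighted_sum_le (index_enum {ffun 'I_n -> 'I_k.+1}) (fun _ => ler01) F0 Fs e0.
move=> H; apply: filterS (H _) => N; apply: le_trans.
rewrite /neighbourhood_energy big_mkcond/= le_eqVlt; apply/orP; left; apply/eqP.
by apply: eq_bigr => a _; rewrite mul1e.
Unshelve. all: by end_near. Qed.

(** With $j = k - |\alpha| \ge m$ Hardy steps, the gain $\delta^{jp}$ compensates the loss
    $\delta^{-mp}$. For $m = j$ nothing is left over, and the energy of the shrinking neighbourhoods
    provides the smallness. *)
Lemma cutoff_term_small (A : R) (m : nat) alpha e : 0 <= A -> (m + mi_order alpha <= k)%N ->
  0 < e -> \forall N \near \oo,
    (((A / delta N ^+ m) `^ p)%:E *
      Ip mu p (ethick D (4 * delta N)) (weak_partial alpha u) <= e%:E)%E.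
Proof.
move=> A0 mk e0; pose j := (k - mi_order alpha)%N.
have ak : (mi_order alpha <= k)%N by apply: leq_trans mk; rewrite leq_addl.
have mj : (m <= j)%N by rewrite leq_subRL// addnC.
have [C [rho [C0' rho0 H]]] : exists C rho : R, [/\ 0 <= C, 0 < rho & forall r, 0 < r <= rho ->
    (Ip mu p (ethick D r) (weak_partial alpha u) <=
      (C * (r `^ p) ^+ j)%:E * neighbourhood_energy (20 ^+ j * r))%E].
  by apply: sobolev_hardy; rewrite subnKC.
pose B := A `^ p * (C * (4 `^ p) ^+ j).
have B0 : 0 <= B by rewrite !mulr_ge0 ?powR_ge0// exprn_ge0// powR_ge0.
have M0 : 0 < 20 ^+ j * 4 :> R by rewrite mulr_gt0// exprn_gt0.
have eB : 0 < e / (B + 1) by rewrite divr_gt0// ltr_wpDl.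
have NE := neighbourhood_energy_small M0 eB.
near=> N.
have d4 : 0 < 4 * delta N <= rho.
  rewrite mulr_gt0//= mulrC -ler_pdivlMr//; apply/ltW.
  by near: N; apply: near_delta; exact: divr_gt0.
have EN : (neighbourhood_energy (20 ^+ j * 4 * delta N) <= (e / (B + 1))%:E)%E by near: N.
have dm : 0 < delta N ^+ m by exact: exprn_gt0.
have dp0 : 0 < delta N `^ p by exact: powR_gt0.
have dp1 : delta N `^ p <= 1.
  have h1 : (1 : R) `^ p = 1 by rewrite powR1.
  by rewrite -[leRHS]h1 ge0_ler_powR ?nnegrE ?ler01 ?delta_le1 ?(ltW p0) ?(ltW (delta_gt0 N)).
apply: (@le_trans _ _ (B%:E * (e / (B + 1))%:E)%E); last first.
  rewrite -EFinM lee_fin mulrCA ger_pMr// ler_pdivrMr ?ltr_wpDl//.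
  by rewrite mul1r lerDl.
apply: (@le_trans _ _ (((A / delta N ^+ m) `^ p)%:E *
    ((C * ((4 * delta N) `^ p) ^+ j)%:E * neighbourhood_energy (20 ^+ j * 4 * delta N)))%E).
  apply: lee_wpmul2l; first by rewrite lee_fin powR_ge0.
  by have := H _ d4; rewrite mulrA.
rewrite muleA -EFinM; apply: lee_pmul => //.
- rewrite lee_fin mulr_ge0 ?powR_ge0// mulr_ge0// exprn_ge0// powR_ge0//.
- by apply: sume_ge0 => a _; exact: Ip_ge0.
rewrite lee_fin powRM ?invr_ge0 ?(ltW dm)//.
have -> : ((delta N ^+ m)^-1) `^ p = ((delta N `^ p) ^+ m)^-1.
  rewrite -(powR_inv1 (ltW dm)) -powRrM mulN1r powRN; congr (_^-1).
  rewrite -(powR_mulrn _ (ltW (delta_gt0 N))) -(powR_mulrn _ (powR_ge0 _ _)).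
  by rewrite -!powRrM mulrC.
rewrite powRM ?(ltW (delta_gt0 N))// exprMn /B.
have -> : (delta N `^ p) ^+ j = (delta N `^ p) ^+ (j - m) * (delta N `^ p) ^+ m.
  by rewrite -exprD subnK.
have h : (delta N `^ p) ^+ (j - m) <= 1 by apply: exprn_ile1 => //; exact: ltW.
have dq : (delta N `^ p) ^+ m != 0 by rewrite gt_eqF// exprn_gt0.
set X := (delta N `^ p) ^+ (j - m) in h *; set Y := (delta N `^ p) ^+ m in dq *.
set Z := (4 `^ p) ^+ _; set W := A `^ p.
have -> : W * Y^-1 * (C * (Z * (X * Y))) = W * (C * Z) * X by field.
by apply: ler_piMr h; rewrite !mulr_ge0 ?powR_ge0// exprn_ge0// powR_ge0.
Unshelve. all: by end_near. Qed.

(** The test function is $(1 - \theta)\psi$ with [psi] close to [u]. In the Leibniz terms of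
    $\theta\psi$ the derivatives of [psi] are exchanged for those of [u], to which
    [cutoff_term_small] applies. *)
Lemma test_vanishing_approx eps : 0 < eps -> exists phi,
  [/\ test_function phi, D `&` supp phi = set0 &
    forall alpha, (mi_order alpha <= k)%N ->
      (Ip mu p setT (weak_partial alpha u \- partial_mi alpha phi)%R <= eps%:E)%E].
Proof.
move=> eps0.
have e1 := Ip_half_gt0 p eps0; set eps1 := eps / _ in e1.
have e2 := Ip_half_gt0 p e1; set eps2 := eps1 / _ in e2.
have P0 : 0 < 2 `^ p :> R by exact: powR_gt0.
have [Cc HC] := @cutoff_bound R n.
pose B N (a : seq 'I_n) := `|Cc a| / delta N ^+ size a.
have B0 N a : 0 <= B N a by rewrite divr_ge0// exprn_ge0// ltW.
pose mi (s : seq 'I_n) i := count_mem i s.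
pose L alpha := @leibniz_const R n p (mi_seq alpha).
have L0 alpha : 0 < L alpha by rewrite exprn_gt0.
pose G s := weak_partial (mi s) u.
have small alpha : (mi_order alpha <= k)%N -> \forall N \near \oo,
    (\sum_(ab <- splits (mi_seq alpha)) (B N ab.1 `^ p)%:E *
      Ip mu p (ethick D (4 * delta N)) (G ab.2) <= (eps2 / (L alpha * 2 `^ p))%:E)%E.
  move=> ak.
  pose F (ab : seq 'I_n * seq 'I_n) N := if (size ab.1 + size ab.2 <= k)%N then
    ((B N ab.1 `^ p)%:E * Ip mu p (ethick D (4 * delta N)) (G ab.2))%E else 0%E.
  have F0 ab N : (0 <= F ab N)%E.
    by rewrite /F; case: ifP => // _; rewrite mule_ge0 ?Ip_ge0// lee_fin powR_ge0.
  have Fs ab t : 0 < t -> \forall N \near \oo, (F ab N <= t%:E)%E.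
    move=> t0; have [abk|abk] := boolP (size ab.1 + size ab.2 <= k)%N; last first.
      by apply: nearW => N; rewrite /F (negPf abk) lee_fin ltW.
    have := @cutoff_term_small `|Cc ab.1| (size ab.1) (mi ab.2) t (normr_ge0 _).
    rewrite mi_order_count => /(_ abk t0).
    by apply: filterS => N; rewrite /F abk.
  have t0 : 0 < eps2 / (L alpha * 2 `^ p) by rewrite divr_gt0// mulr_gt0.
  have := near_weighted_sum_le (splits (mi_seq alpha)) (fun _ => ler01) F0 Fs t0.
  move=> H; apply: filterS (H _) => N; apply: le_trans.
  rewrite le_eqVlt; apply/orP; left; apply/eqP.
  rewrite big_seq [RHS]big_seq; apply: eq_bigr => ab /size_splits abs.
  by rewrite mul1e /F abs size_mi_seq ak.
have [N HN] : exists N, forall alpha, (mi_order alpha <= k)%N ->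
    (\sum_(ab <- splits (mi_seq alpha)) (B N ab.1 `^ p)%:E *
      Ip mu p (ethick D (4 * delta N)) (G ab.2) <= (eps2 / (L alpha * 2 `^ p))%:E)%E.
  suff : \forall N \near \oo, forall alpha, (mi_order alpha <= k)%N ->
    (\sum_(ab <- splits (mi_seq alpha)) (B N ab.1 `^ p)%:E *
      Ip mu p (ethick D (4 * delta N)) (G ab.2) <= (eps2 / (L alpha * 2 `^ p))%:E)%E.
    by move=> /filter_ex.
  exact: near_multi_index.
(* With [N] fixed, the derivatives of the cutoff have fixed bounds; [eta] is taken so small that the
   approximation error multiplied by them stays below [eps2]. *)
pose K alpha := L alpha * 2 `^ p * \sum_(ab <- splits (mi_seq alpha)) B N ab.1 `^ p.
have K0 alpha : 0 <= K alpha.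
  rewrite mulr_ge0 ?mulr_ge0 ?(ltW (L0 _)) ?(ltW P0)// sumr_ge0// => ab _.
  exact: powR_ge0.
have [eta [eta0 [eta1 HK]]] : exists eta : R, 0 < eta /\ (eta <= eps1 /\
    forall alpha, (mi_order alpha <= k)%N -> K alpha * eta <= eps2).
  have N1 : \forall t \near (0 : R)^'+, forall alpha, (mi_order alpha <= k)%N ->
      K alpha * t <= eps2.
    apply: near_multi_index => alpha ak.
    have K1 : 0 < K alpha + 1 by rewrite ltr_wpDl.
    near=> t; apply: (@le_trans _ _ ((K alpha + 1) * t)).
      rewrite ler_wpM2r ?lerDl//; near: t; exact: nbhs_right_ge.
    rewrite mulrC -ler_pdivlMr//; near: t; apply: nbhs_right_le; exact: divr_gt0.
  have : \forall t \near (0 : R)^'+, 0 < t /\ (t <= eps1 /\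
      forall alpha, (mi_order alpha <= k)%N -> K alpha * t <= eps2).
    near=> t; split; [near: t; exact: nbhs_right_gt|split; last by near: t].
    by near: t; exact: nbhs_right_le.
  by move=> /filter_ex.
have [psi [tpsi Hpsi]] := sobolev_dense p1 su eta0; have [spsi _] := tpsi.
have dN := delta_gt0 N.
have mA : measurable (ethick D (2 * delta N)) by exact: measurable_ethick.
pose theta : V -> R := cutoff (ethick D (2 * delta N)) (delta N).
have st : smooth theta by exact: cutoff_smooth.
have mS : measurable (ethick D (4 * delta N)) by exact: measurable_ethick.
pose phi x := psi x - theta x * psi x.
have tphi : test_function phi.
  have := testD tpsi (testN (test_smoothM st tpsi)); exact.
exists phi; split=> //.
  (* Within [delta N] of [D] the cutoff is 1, so [phi] vanishes on a neighbourhood of each point of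
     [D]. *)
  apply/seteqP; split=> // x [Dx]; move=> /(_ (eball x (delta N))) [|y [/= + xy]].
    by apply/nbhs_enormP; exists (delta N).
  rewrite /phi [theta y]cutoff1 ?mul1r ?subrr ?eqxx// => z yz.
  exists x => //; rewrite /eball/= mulr_natl mulr2n.
  by apply: le_lt_trans (enorm_triangle z y x) _; exact: ltrD.
move=> alpha ak.
have [mw _ _] := weak_partialP p1 su ak.
have stp : smooth (theta \* psi) by exact: smoothM.
have mpsi beta : measurable_fun [set: V] (partial_mi beta psi).
  exact: (measurable_smooth (smooth_partial_mi beta spsi)).
have mtp : measurable_fun [set: V] (partial_mi alpha (theta \* psi)).
  exact: (measurable_smooth (smooth_partial_mi alpha stp)).
have -> : (weak_partial alpha u \- partial_mi alpha phi) =
    (weak_partial alpha u \- partial_mi alpha psi) \+ partial_mi alpha (theta \* psi).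
  rewrite (partial_miB alpha spsi stp : partial_mi alpha phi = _).
  by apply/funext => x /=; ring.
have Hw : (Ip mu p setT (weak_partial alpha u \- partial_mi alpha psi)%R <= eps1%:E)%E.
  by apply: (le_trans (Hpsi _ ak)); rewrite lee_fin.
apply: (Ip_le_add p0 measurableT (measurable_funB mw (mpsi alpha)) mtp Hw).
rewrite -/eps1 partial_miE.
have tB a x : `|foldr partial theta a x| <= B N a.
  apply: (le_trans (HC _ _ a x mA dN)); rewrite /B ler_wpM2r ?ler_norm//.
  by rewrite invr_ge0 exprn_ge0// ltW.
have tS a x : ~ ethick D (4 * delta N) x -> foldr partial theta a x = 0.
  move=> nx; apply: cutoff0 => //; apply/seteqP; split=> // y [xy [z Dz zy]].
  apply: nx; exists z => //; rewrite /eball/=.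
  have -> : 4 * delta N = 2 * delta N + 2 * delta N by ring.
  apply: le_lt_trans (enorm_triangle x y z) _; apply: ltrD => //.
  by rewrite enormB.
apply: (le_trans (Ip_leibniz (mi_seq alpha) p0 st spsi mS tB tS)).
rewrite -/(L alpha).
have abk ab : ab \in splits (mi_seq alpha) -> (size ab.2 <= k)%N.
  move=> /size_splits h; apply: leq_trans ak; rewrite -(size_mi_seq alpha) -h.
  exact: leq_addl.
apply: (@le_trans _ _ ((L alpha)%:E * \sum_(ab <- splits (mi_seq alpha))
    ((2 `^ p)%:E * ((B N ab.1 `^ p)%:E * Ip mu p (ethick D (4 * delta N)) (G ab.2)) +
    (2 `^ p * (B N ab.1 `^ p * eta))%:E))%E).
  apply: lee_wpmul2l; first by rewrite lee_fin ltW.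
  rewrite big_seq [leRHS]big_seq; apply: lee_sum => ab /abk abk2.
  have mk : (mi_order (mi ab.2) <= k)%N by rewrite mi_order_count.
  have [mG _ _] := weak_partialP p1 su mk.
  have E : foldr partial psi ab.2 = G ab.2 \- (G ab.2 \- partial_mi (mi ab.2) psi).
    by rewrite (foldr_partial_mi ab.2 spsi); apply/funext => x /=; ring.
  rewrite E.
  have md := measurable_funB mG (mpsi (mi ab.2)).
  apply: (@le_trans _ _ ((B N ab.1 `^ p)%:E * ((2 `^ p)%:E *
      (Ip mu p (ethick D (4 * delta N)) (G ab.2) + eta%:E)))%E).
    apply: lee_wpmul2l; first by rewrite lee_fin powR_ge0.
    apply: (le_trans (IpB mu (ltW p0) mS mG md)).
    apply: lee_wpmul2l; first by rewrite lee_fin ltW.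
    apply: leeD; first exact: lexx.
    exact: le_trans (Ip_subset mu p mS measurableT md (@subsetT _ _)) (Hpsi _ mk).
  rewrite ge0_muleDr ?Ip_ge0 ?lee_fin ?(ltW eta0)//.
  rewrite ge0_muleDr ?mule_ge0 ?Ip_ge0 ?lee_fin ?(ltW eta0) ?(ltW P0)//.
  rewrite muleCA -!EFinM le_eqVlt; apply/orP; left; apply/eqP.
  by congr (_ + _%:E)%E; ring.
rewrite big_split/= -ge0_sume_distrr; last first.
  by move=> ab _; rewrite mule_ge0 ?Ip_ge0// lee_fin powR_ge0.
rewrite sumEFin -mulr_sumr -mulr_suml.
set S1 := (\sum_(ab <- _) (_ * Ip _ _ _ _))%E; set S2 := \sum_(ab <- _) _ `^ p.
apply: (@le_trans _ _ ((L alpha)%:E * ((2 `^ p)%:E * (eps2 / (L alpha * 2 `^ p))%:E +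
    (2 `^ p * (S2 * eta))%:E))%E).
  apply: lee_wpmul2l; first by rewrite lee_fin ltW.
  apply: leeD => //; apply: lee_wpmul2l; first by rewrite lee_fin ltW.
  exact: HN.
have EE (x y z : R) : (x%:E * y%:E + z%:E = (x * y + z)%:E)%E by rewrite EFinD EFinM.
rewrite EE -EFinM lee_fin.
have -> : L alpha * (2 `^ p * (eps2 / (L alpha * 2 `^ p)) + 2 `^ p * (S2 * eta)) =
    eps2 + K alpha * eta.
  rewrite /K -/S2; move: (lt0r_neq0 (L0 alpha)) (lt0r_neq0 P0).
  set X := L alpha; set Y := 2 `^ p => X0 Y0; field.
  by rewrite X0 Y0.
apply: (@le_trans _ _ (eps2 + eps2)); first by rewrite lerD2l; exact: HK.
rewrite -mulr2n -mulr_natl /eps2 mulrA ler_pdivrMr ?mulr_gt0// mulrC ler_pM2l//.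
rewrite ler_peMl// -[leLHS](powRr0 2); apply: ler_powR; first by rewrite ler1n.
exact: ltW.
Unshelve. all: by end_near. Qed.

End sobolev_trace.

Theorem theorem4p4 (R : realType) (n : nat) (d : R) (D : set 'rV[R]_n)
    (k : nat) (p : R)
    (hn : (2 <= n)%N)
    (hd : 0 < d < n%:R)
    (clD : closed D)
    (regD : ahlfors_regular d D)
    (* A singleton is vacuously Ahlfors regular, and must be excluded. *)
    (hD : forall x, D <> [set x])
    (hp : Num.max 1 (n%:R - d) < p) :
  sobolev_vanishing D k p =
  [set u | sobolev k p u /\
    hausdorff d [set x | D x /\ ~ is_restriction k u x (fun=> 0)] = 0%E].
Proof.
move: hp; rewrite gt_max => /andP[p1 pd].
have d0 : 0 < d by case/andP: hd.
have approx u : sobolev k p u ->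
    (forall eps, 0 < eps -> exists phi,
      [/\ test_function phi, D `&` supp phi = set0 &
        forall alpha, (mi_order alpha <= k)%N ->
          (Ip lebesgue_rV p setT (weak_partial alpha u \- partial_mi alpha phi)%R
            <= eps%:E)%E]) ->
    sobolev_vanishing D k p u.
  move=> su H; split=> // e e0.
  have [eta eta0 He] := Ip_sobolev_norm_lt p1 su e0.
  by have [phi [tphi Dphi Hphi]] := H _ eta0; exists phi; split=> //; exact: He.
apply/seteqP; split=> [u vu|u [su tr0]].
  by split; [case: vu | exact: vanishing_is_restriction d0 p1 pd _ vu].
apply: approx => // eps eps0.
(* For an empty [D] the condition on supports is void and density of test functions is enough. *)
have [D0|/set0P[x Dx]] := eqVneq D set0.
  have [phi [tphi Hphi]] := sobolev_dense p1 su eps0.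
  by exists phi; split=> //; rewrite D0 set0I.
(* A second point makes the diameter positive, so regularity is available at every radius up to
   [enorm (y - x)]. A singleton has no $\mathcal{H}^d$-measure, and its trace condition would hold
   for every [u]. *)
have [y Dy yx] : exists2 y, D y & y != x.
  apply: contrapT => H; apply: (hD x); apply/seteqP; split=> [z Dz|_ ->//].
  by apply: contrapT => /eqP zx; apply: H; exists z.
have [C C1 HC] := regD; have C0 : 0 < C by exact: lt_le_trans C1.
have r0 : 0 < enorm (y - x).
  rewrite lt_neqAle enorm_ge0 andbT; apply: contraNneq yx => yx0; apply/eqP/rowP => i.
  apply/eqP; rewrite -subr_eq0 -normr_le0 yx0.
  by have := normr_coord_le (y - x) i; rewrite !mxE.
have diamD r : r <= enorm (y - x) -> (r%:E <= ediam D)%E.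
  by move=> rr; apply: le_trans (le_ediam Dy Dx); rewrite lee_fin.
have HD z r : D z -> 0 < r <= enorm (y - x) ->
    (hausdorff d (eball z r `&` D) <= (C * r `^ d)%:E)%E.
  by move=> Dz /andP[r_gt0 /diamD rD]; have /andP[] := HC _ _ Dz r_gt0 rD.
have HL z r : D z -> 0 < r <= enorm (y - x) ->
    ((C^-1 * r `^ d)%:E <= hausdorff d (eball z r `&` D))%E.
  by move=> Dz /andP[r_gt0 /diamD rD]; have /andP[] := HC _ _ Dz r_gt0 rD.
have muD0 : lebesgue_rV D = 0%E.
  apply: (@ahlfors_null R n D d (C * enorm (y - x) `^ d) (enorm (y - x))) => //.
  - exact: leq_trans hn.
  - by rewrite mulr_ge0 ?powR_ge0// ltW.
  - by move=> z Dz; apply: HD; rewrite ?r0 ?lexx.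
have C'0 : 0 < C^-1 by rewrite invr_gt0.
exact: (test_vanishing_approx d0 p1 pd C0 C'0 r0 HD HL su tr0 clD muD0).
Qed.
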